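(* Let $\alpha\in(0,2)$, let $G$ be a free group of finite rank $d\ge 2$, let $\{\phi_t\}_{t\in G}$ be a nonsingular action of $G$ on a $\sigma$-finite standard measure space $(S,\mathcal S,m)$, and let $\mathcal A$ be the nondegenerate part of this action. For any $f\in\mathcal L^\alpha(S,m)$ whose support has nontrivial intersection with $\mathcal A$ (i.e. $m(\{f\ne0\}\cap\mathcal A)>0$), one has $$\liminf_{n\to\infty}\frac{b_n(f)}{|E_n|^{1/\alpha}}>0 .$$ Moreover, let $\{X_t\}_{t\in G}$ be the stationary S$\alpha$S random field $X_t\overset{\text{fdd}}{=}\int_S f_t\,dM$ with $f_t(s)=c_t(s)\big(\tfrac{d(m\circ\phi_t)}{dm}(s)\big)^{1/\alpha}f(\phi_t(s))$ for such an $f$ and a measurable $\{-1,+1\}$-valued cocycle $\{c_t\}$ for $\{\phi_t\}$, and let $M_n=\max_{t\in E_n}|X_t|$. Then for any subsequence $M_{n_k}$ of $M_n$ there exist a further subsequence $M_{n_{k_\ell}}$ and a constant $c>0$ such that $$M_{n_{k_\ell}}/|E_{n_{k_\ell}}|^{1/\alpha}\Rightarrow cZ_\alpha ,$$ where $P(Z_\alpha\le x)=e^{-x^{-\alpha}}$ for $x>0$.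
   Context: Group actions: an action of $G$ (identity $e$) on $(S,\mathcal S)$ is a family of measurable maps $\phi_t:S\to S$, $t\in G$, with $\phi_e=\mathrm{id}$ and $\phi_{uv}=\phi_v\circ\phi_u$ for all $u,v\in G$. It is nonsingular if $m\circ\phi_t\sim m$ (equivalence of measures) for every $t$. A $\{-1,+1\}$-valued measurable cocycle is a family of measurable maps $c_t:S\to\{-1,+1\}$ with $c_{uv}(s)=c_u(s)c_v(\phi_u(s))$ for $m$-almost all $s$, for all $u,v\in G$. $G$ is generated by $D=\{a_1,a_1^{-1},\dots,a_d,a_d^{-1}\}$ ($a_1,\dots,a_d$ free generators); $|t|$ is the word length of $t$ with respect to $D$, and $E_n=\{t\in G:|t|\le n\}$. $\mathcal L^\alpha(S,m)$ is the set of measurable $f:S\to\mathbb R$ with $\int|f|^\alpha dm<\infty$. For $f\in\mathcal L^\alpha(S,m)$, $$b_n(f)=\Big(\int_S\max_{t\in E_n}|f_t(s)|^\alpha\,m(ds)\Big)^{1/\alpha},\qquad |f_t(s)|^\alpha=\tfrac{d(m\circ\phi_t)}{dm}(s)|f(\phi_t(s))|^\alpha .$$ Nondegenerate part: $S$ decomposes uniquely (modulo $m$-null sets) into two disjoint $\{\phi_t\}$-invariant measurable sets $\mathcal A$ (nondegenerate part) and $\mathcal B$ (degenerate part) such that for any $f\in\mathcal L^\alpha(S,m)$: if $f$ is supported on $\mathcal B$ then $\lim_n b_n(f)/|E_n|^{1/\alpha}=0$; if $m(\{f\ne0\}\cap\mathcal A)>0$ then $\limsup_n b_n(f)/|E_n|^{1/\alpha}>0$.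 $M$ is an S$\alpha$S random measure on $S$ with control measure $m$: it is independently scattered and $E\exp(i\theta\int h\,dM)=\exp(-|\theta|^\alpha\int|h|^\alpha dm)$ for $h\in\mathcal L^\alpha(S,m)$. ''Stationary'' means left-stationary: $\{X_{st}\}_{t}$ has the same law as $\{X_t\}_t$ for all $s\in G$. $\overset{\text{fdd}}{=}$ is equality of finite-dimensional distributions and $\Rightarrow$ is convergence in distribution. *)

(* Defs.v *)
From HB Require Import structures.
From mathcomp Require Import all_boot all_order all_algebra.
From mathcomp Require Import finmap complex.
From mathcomp Require Import all_classical all_reals all_analysis.

Set Implicit Arguments.
Unset Strict Implicit.
Unset Printing Implicit Defensive.

Import Order.TTheory GRing.Theory Num.Theory.
Import numFieldNormedType.Exports.

Local Open Scope classical_set_scope.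
Local Open Scope ring_scope.

Section FreeGroup.
Context {d : nat} {G : groupType}.
Variable a : 'I_d -> G.

(* [(i, true)] stands for the letter [a i], [(i, false)] for its inverse. *)
Definition letter_val (x : 'I_d * bool) : G :=
  if x.2 then a x.1 else ((a x.1)^-1)%g.

Definition word_val (w : seq ('I_d * bool)) : G :=
  (\prod_(x <- w) letter_val x)%g.

Definition reduced (w : seq ('I_d * bool)) : bool :=
  sorted (fun x y => ~~ ((x.1 == y.1) && (x.2 != y.2))) w.

Definition free_generators : Prop :=
  forall t : G, exists! w : seq ('I_d * bool), reduced w /\ word_val w = t.

Definition word_length (t : G) : nat :=
  xget 0%N [set n | (exists2 w, size w = n & word_val w = t) /\
                    (forall w, word_val w = t -> (n <= size w)%N)].

Definition word_ball (n : nat) : {fset G} :=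
  fset_set [set t : G | (word_length t <= n)%N].

End FreeGroup.

Section StandardBorel.
Context (R : realType) {d : measure_display} (S : measurableType d).

(* The measurable sets of [S] are the Borel sets of a Polish space: a pseudometric
   space that is Hausdorff is a metric space. *)
Definition standard_borel : Prop :=
  exists (E : completePseudoMetricType R) (h : S -> E),
    [/\ hausdorff_space E,
        exists D : set E, countable D /\ dense D,
        bijective h
      & forall A : set S, measurable A <-> <<s @open E >> (h @` A)].

End StandardBorel.

Section RadonNikodym.
Context {R : realType} {d : measure_display} {S : measurableType d}.

Definition is_density (m : {measure set S -> \bar R}) (nu : set S -> \bar R)
    (g : S -> R) : Prop :=
  [/\ measurable_fun [set: S] g, (forall s, 0 <= g s)
    & forall A, measurable A -> nu A = (\int[m]_(s in A) (g s)%:E)%E].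

(* The library's ['d nu '/d mu] requires [nu] to be finite, whereas the measures
   [m \o phi t] are only sigma-finite. *)
Definition density (m : {measure set S -> \bar R}) (nu : set S -> \bar R) :
    S -> R :=
  xget (cst 0) [set g | is_density m nu g].

Definition Lalpha (m : {measure set S -> \bar R}) (alpha : R) (f : S -> R) :
    Prop :=
  measurable_fun [set: S] f /\
  (\int[m]_s (`|f s| `^ alpha)%:E < +oo)%E.

End RadonNikodym.

Section GroupAction.
Context {R : realType} {G : groupType} {d : measure_display}
  {S : measurableType d}.
Variables (m : {measure set S -> \bar R}) (phi : G -> S -> S).

Definition group_action : Prop :=
  [/\ forall t, measurable_fun [set: S] (phi t),
      phi 1%g = id
    & forall u v, phi (u * v)%g = phi v \o phi u].

(* [m \o phi t] in the sense A |-> m (phi t (A)); each [phi t] is a bijection. *)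
Definition image_measure (t : G) (A : set S) : \bar R := m (phi t @` A).

Definition nonsingular : Prop :=
  forall t A, measurable A -> image_measure t A = 0%E <-> m A = 0%E.

Definition sign_cocycle (c : G -> S -> R) : Prop :=
  [/\ forall t, measurable_fun [set: S] (c t),
      forall t s, c t s = 1 \/ c t s = -1
    & forall u v, {ae m, forall s, c (u * v)%g s = c u s * c v (phi u s)}].

Definition action_density (t : G) : S -> R := density m (image_measure t).

Definition field_kernel (alpha : R) (c : G -> S -> R) (f : S -> R) (t : G) :
    S -> R :=
  fun s => c t s * (action_density t s) `^ alpha^-1 * f (phi t s).

Definition invariant_set (A : set S) : Prop := forall t, phi t @^-1` A = A.

End GroupAction.

Section NondegeneratePart.
Context {R : realType} {r : nat} {G : groupType} {d : measure_display}
  {S : measurableType d}.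
Variables (m : {measure set S -> \bar R}) (a : 'I_r -> G) (phi : G -> S -> S).
Variable alpha : R.

Definition b_seq (f : S -> R) (n : nat) : \bar R :=
  ((\int[m]_s (\big[Num.max/0]_(t <- word_ball a n)
     (action_density m phi t s * `|f (phi t s)| `^ alpha))%:E) `^ alpha^-1)%E.

Definition ball_scale (n : nat) : R := #|` word_ball a n|%:R `^ alpha^-1.

Definition b_ratio (f : S -> R) (n : nat) : \bar R :=
  (b_seq f n * ((ball_scale n)^-1)%:E)%E.

Definition nondegenerate_decomposition (A B : set S) : Prop :=
  [/\ measurable A /\ measurable B,
      A `|` B = [set: S] /\ A `&` B = set0,
      invariant_set phi A /\ invariant_set phi B,
      forall f, Lalpha m alpha f -> [set s | f s != 0] `<=` B ->
        b_ratio f n @[n --> \oo] --> 0%E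
    & forall f, Lalpha m alpha f -> (0 < m ([set s | f s != 0%R] `&` A))%E ->
        (0 < limn_esup (b_ratio f))%E].

Definition nondegenerate_part (A : set S) : Prop :=
  exists B : set S, nondegenerate_decomposition A B.

End NondegeneratePart.

Section Probability.
Context {R : realType}.

Definition charfun {d} {T : measurableType d} (P : probability T R)
    (Y : {RV P >-> R}) (theta : R) : R[i] :=
  Complex (\int[P]_w cos (theta * Y w)) (\int[P]_w sin (theta * Y w)).

Definition joint {I : Type} {T : Type} (n : nat) (X : I -> T -> R)
    (t : n.-tuple I) (w : T) : n.-tuple (measurableTypeR R) :=
  [tuple X (tnth t i) w | i < n].

Definition eq_fdd {I : Type} {d d'} {T : measurableType d}
    {T' : measurableType d'} (P : probability T R) (P' : probability T' R)
    (X : I -> {RV P >-> R}) (Y : I -> {RV P' >-> R}) : Prop :=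
  forall (n : nat) (t : n.-tuple I) (B : set (n.-tuple (measurableTypeR R))),
    measurable B ->
    P [set w | B (joint X t w)] = P' [set w | B (joint Y t w)].

Definition left_stationary {G : groupType} {d} {T : measurableType d}
    (P : probability T R) (X : G -> {RV P >-> R}) : Prop :=
  forall s : G, eq_fdd (fun t => X (s * t)%g) X.

Definition cvg_probability {d} {T : measurableType d} (P : probability T R)
    (Y : nat -> T -> R) (Z : T -> R) : Prop :=
  forall eps : R, 0 < eps ->
    P [set w | eps <= `|Y n w - Z w|] @[n --> \oo] --> 0%E.

Definition cvg_distribution {d d'} {T : measurableType d}
    {T' : measurableType d'} (P : probability T R) (P' : probability T' R)
    (Y : nat -> T -> R) (Z : T' -> R) : Prop :=
  forall x : R,
    {for x, continuous (fun y => P' [set w | Z w <= y])} ->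
    P [set w | Y n w <= x] @[n --> \oo] --> P' [set w | Z w <= x].

End Probability.

Section StableRandomMeasure.
Import HBSimple.
Context {R : realType} {d : measure_display} {S : measurableType d}.
Variables (m : {measure set S -> \bar R}) (alpha : R).
Context {dT : measure_display} {T : measurableType dT} {P : probability T R}.

(* A random measure is only meaningful on measurable sets of finite measure; its
   values elsewhere are irrelevant.  In [simple_integral] the value at the
   possibly infinite set [h @^-1` [set 0]] is multiplied by 0. *)
Variable M : set S -> {RV P >-> R}.

Definition simple_integral (h : {sfun S >-> R}) (w : T) : R :=
  \sum_(x \in range h) x * M (h @^-1` [set x]) w.

Definition stochastic_integral (f : S -> R) (Y : {RV P >-> R}) : Prop :=
  exists h : nat -> {sfun S >-> R},
    [/\ forall k, Lalpha m alpha (h k),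
        (\int[m]_s (`|h k s - f s| `^ alpha)%:E)%E @[k --> \oo] --> 0%E
      & cvg_probability P (fun k => simple_integral (h k)) Y].

Definition random_measure : Prop :=
  forall A : nat -> set S, (forall k, measurable (A k)) ->
    trivIset [set: nat] A -> (m (\bigcup_k A k) < +oo)%E ->
    {ae P, forall w, series (fun k => M (A k) w) @ \oo -->
                     M (\bigcup_k A k) w}.

Definition independently_scattered : Prop :=
  forall (n : nat) (A : 'I_n -> set S) (B : 'I_n -> set (measurableTypeR R)),
    (forall i, measurable (A i) /\ (m (A i) < +oo)%E) ->
    trivIset [set: 'I_n] A -> (forall i, measurable (B i)) ->
    P (\bigcap_(i in [set: 'I_n]) (M (A i) @^-1` B i)) =
    (\prod_(i < n) P (M (A i) @^-1` B i))%E.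

Definition SaS_random_measure : Prop :=
  [/\ random_measure, independently_scattered
    & forall h Y theta, Lalpha m alpha h -> stochastic_integral h Y ->
        charfun Y theta =
        (expR (- (`|theta| `^ alpha *
                  fine (\int[m]_s (`|h s| `^ alpha)%:E)%E)))%:C%C].

End StableRandomMeasure.

Definition max_field {R : realType} {r : nat} {G : groupType} (a : 'I_r -> G)
    {T : Type} (X : G -> T -> R) (n : nat) (w : T) : R :=
  \big[Num.max/0]_(t <- word_ball a n) `|X t w|.

Definition frechet {R : realType} {d} {T : measurableType d}
    (P : probability T R) (alpha : R) (Z : {RV P >-> R}) : Prop :=
  forall x : R, 0 < x -> P [set w | Z w <= x] = (expR (- (x `^ (- alpha))))%:E.

(* Main.v *)
(* The ball E_(n+k) is covered by |E_k| left translates of E_n, and the cocycle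
   identity of the densities makes the integral B_n = b_n(f)^alpha invariant
   under left translation of the ball; so B_(n+k) <= |E_k| B_n.  As |E_n| |E_k| is
   at most a constant times |E_(n+k)| in a free group, the liminf of B_n / |E_n|
   is at least a fixed fraction of its limsup.

   For the maxima, the stochastic integrals are approximated by those of simple
   functions, which over a common refinement are sums of a_(t,i) V_i with
   independent stable V_i.  Write L = |E_n|^(1/alpha).  Up to a probability of
   order 1/|E_n|, each sum has at most one term above e L and the other terms sum
   to at most e' L by a Chernoff bound, so the maximum of the sums is close to
   that of the terms, and P(max <= x L) is close to
   exp (- C x^(-alpha) B_n / |E_n|).  The tails P(|V| > u) ~ C s / u^alpha come
   from the characteristic function, by writing a C^2 spline approximation of an
   indicator as an integral of cosines against an explicit kernel.  Finally
   B_n / |E_n| stays between two positive constants, and Bolzano-Weierstrass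
   provides the subsequence. *)
Require Import Defs.
From HB Require Import structures.
From mathcomp Require Import all_boot all_order all_algebra.
From mathcomp Require Import finmap complex.
From mathcomp Require Import all_classical all_reals all_analysis.
From mathcomp Require Import measurable_realfun.
From mathcomp Require Import ring lra zify.
Set Implicit Arguments.
Unset Strict Implicit.
Unset Printing Implicit Defensive.
Import Order.TTheory GRing.Theory Num.Theory.
Import numFieldNormedType.Exports.
Local Open Scope classical_set_scope.
Local Open Scope ring_scope.

(** Two obstacles shape the proof. Only characteristic functions are given, so tails must be read
    off cosines: scaling expresses [|y| ^+ 3] as an integral of cosines up to a quadratic, which
    makes even cubic splines the natural test functions, and their kernels decay like t^-4, fast
    enough for every [alpha < 2]. The tail constant is obtained as a supremum of first-order
    coefficients instead of being computed, so its positivity is a separate matter; it comes from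
    the strict inequality [2 ^ alpha < 4]. The approximation by simple functions has to be made
    after the radius of the ball is fixed, because the errors of all fields in the ball add up, and
    the number of cells of the refinement is then uncontrolled. Hence the estimates for arrays
    depend only on the number of rows and on a bound for the row sums, and tail bounds are uniform
    over all stable laws. The same uniformity lets B_n / |E_n| enter as a parameter that need not
    converge. The rank enters through exponential growth: for rank 1 balls grow linearly and |E_n|
    |E_k| is not bounded by a multiple of |E_(n+k)|. *)

Section ElementaryInequalities.
Context {R : realType}.
Implicit Types x y z t : R.

Lemma expRN_ge1B y : 1 - y <= expR (- y).
Proof. exact: expR_ge1Dx. Qed.

(** Squaring [1 + y / 2 <= expR (y / 2)] reduces this to [1 <= (1 - y + y ^+ 2) * (1 + y / 2) ^+ 2],
    where the linear terms cancel and the remaining coefficients are nonnegative. *)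
Lemma expRN_le_quadratic y : 0 <= y -> expR (- y) <= 1 - y + y ^+ 2.
Proof.
move=> y0; have h : 1 + y / 2 <= expR (y / 2) by exact: expR_ge1Dx.
have e2 : expR (- y) = (expR (y / 2))^-1 * (expR (y / 2))^-1.
  by rewrite -expRN -expRD; congr expR; lra.
rewrite {}e2.
have p : 0 < 1 + y / 2 by lra.
have hi : (expR (y / 2))^-1 <= (1 + y / 2)^-1.
  by rewrite lef_pV2 ?posrE ?expR_gt0.
have i0 : 0 <= (expR (y / 2))^-1 by rewrite invr_ge0 expR_ge0.
apply: (@le_trans _ _ ((1 + y / 2)^-1 * (1 + y / 2)^-1)).
  exact: ler_pM.
rewrite -invfM -[X in X <= _]mul1r ler_pdivrMr ?mulr_gt0//.
have y2 : 0 <= y ^+ 2 by exact: exprn_ge0.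
have y3 : 0 <= y ^+ 3 by exact: exprn_ge0.
have y4 : 0 <= y ^+ 4 by exact: exprn_ge0.
have -> : (1 - y + y ^+ 2) * ((1 + y / 2) * (1 + y / 2)) =
  1 + y ^+ 2 / 4 + 3 * y ^+ 3 / 4 + y ^+ 4 / 4 by field.
lra.
Qed.

(** For [0 <= y], [1 - y <= expR (- y)] gives [expR y - 1 <= y * expR y]; using this twice bounds
    the second-order remainder by [y ^+ 2 * expR y]. *)
Lemma expR_le_quadratic t y : 0 <= t -> y <= t ->
  expR y <= 1 + y + y ^+ 2 * expR t.
Proof.
move=> t0 yt; have et : 1 <= expR t by rewrite -expR0 ler_expR.
have y2 : 0 <= y ^+ 2 by exact: sqr_ge0.
have [y0|/ltW y0] := leP y 0.
  have := @expRN_le_quadratic (- y); rewrite opprK sqrrN oppr_ge0 => /(_ y0).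
  move=> h; apply: (le_trans h); nra.
have a : 1 - y <= (expR y)^-1 by rewrite -expRN; exact: expR_ge1Dx.
have e0 : 0 < expR y by exact: expR_gt0.
have b : expR y * (1 - y) <= 1.
  by have := ler_wpM2l (ltW e0) a; rewrite divff// gt_eqF.
have eyt : expR y <= expR t by rewrite ler_expR.
have c : expR y - 1 <= y * expR y by lra.
have d : y * (expR y - 1) <= y * (y * expR y) by rewrite ler_wpM2l.
have e : y * (y * expR y) <= y ^+ 2 * expR t.
  by rewrite mulrA -expr2 ler_wpM2l.
lra.
Qed.

Lemma le_from_derive (f df : R -> R) x : (forall y, is_derive y (1 : R) f (df y)) ->
  (forall y, 0 <= y -> 0 <= df y) -> 0 <= x -> f 0 <= f x.
Proof.
move=> dfE df0 x0.
have cf : {within `[0, x], continuous f}.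
  apply: continuous_subspaceT => y; apply: differentiable_continuous.
  by apply/derivable1_diffP; exact: ex_derive.
have [c cin e] := MVT_segment x0 (fun y _ => dfE y) cf.
rewrite -subr_ge0 e subr0 mulr_ge0// df0//.
by move: cin; rewrite in_itv/= => /andP[].
Qed.

Lemma sin_le x : 0 <= x -> sin x <= x.
Proof.
move=> x0; have := @le_from_derive (fun y => y - sin y) (fun y => 1 - cos y) x.
rewrite sin0 subr0 => h; rewrite -subr_ge0; by apply: h => // y _; rewrite subr_ge0 cos_le1.
Qed.

Lemma normr_sin_le x : `|sin x| <= `|x|.
Proof.
wlog x0 : x / 0 <= x => [H|].
  have [/H//|/ltW x0] := leP 0 x.
  by rewrite -normrN -sinN -(normrN x); apply: H; rewrite oppr_ge0.
rewrite (ger0_norm x0) ler_norml sin_le// andbT.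
have := @le_from_derive (fun y => y + sin y) (fun y => 1 + cos y) x.
rewrite sin0 addr0 => h.
suff : 0 <= x + sin x by lra.
by apply: h => // y; have := cos_geN1 y; lra.
Qed.

Lemma cos_ge x : 1 - x ^+ 2 / 2 <= cos x.
Proof.
have -> : cos x = 1 - sin (x / 2) ^+ 2 *+ 2.
  have -> : x = (x / 2) *+ 2 by rewrite -mulr_natr; field.
  rewrite cos_mulr2n cos2sin2.
  have -> : x / 2 *+ 2 / 2 = x / 2 by rewrite -mulr_natr; field.
  by rewrite mulrnBl mulr2n; ring.
have : sin (x / 2) ^+ 2 <= (x / 2) ^+ 2.
  by rewrite -[X in X <= _]real_normK ?num_real// -[leRHS]real_normK ?num_real//
     ler_pXn2r ?nnegrE// normr_sin_le.
rewrite -(mulr_natl (sin (x / 2) ^+ 2) 2).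
rewrite (_ : (x / 2) ^+ 2 = x ^+ 2 / 4); last by field.
by move: (x ^+ 2) (sin _ ^+ 2) => u v uv; lra.
Qed.

Lemma sin_ge x : 0 <= x -> x - x ^+ 3 / 6 <= sin x.
Proof.
move=> x0.
have := @le_from_derive (fun y => sin y - y + y ^+ 3 / 6)
  (fun y => cos y - 1 + y ^+ 2 / 2) x.
rewrite sin0 expr0n/= mul0r subr0 addr0 => h.
suff : 0 <= sin x - x + x ^+ 3 / 6 by lra.
apply: h => // y; last by have := cos_ge y; lra.
apply: is_derive_eq.
by rewrite /GRing.scale/=; field.
Qed.

(** The second-order Taylor remainder of the cosine. It is at most [x ^+ 4 / 24] and at most
    [x ^+ 2 / 2], so its quotient by the fourth power is integrable both at 0 and at infinity. *)
Definition cos_remainder x := cos x - 1 + x ^+ 2 / 2.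

Lemma cos_remainder_ge0 x : 0 <= cos_remainder x.
Proof. by rewrite /cos_remainder; have := cos_ge x; lra. Qed.

Lemma cos_remainder_le2 x : cos_remainder x <= x ^+ 2 / 2.
Proof. by rewrite /cos_remainder; have := cos_le1 x; lra. Qed.

Lemma cos_remainderN x : cos_remainder (- x) = cos_remainder x.
Proof. by rewrite /cos_remainder cosN sqrrN. Qed.

Lemma cos_remainder_le4 x : cos_remainder x <= x ^+ 4 / 24.
Proof.
wlog x0 : x / 0 <= x => [H|].
  have [/H//|/ltW x0] := leP 0 x.
  rewrite -cos_remainderN (_ : x ^+ 4 = (- x) ^+ 4); last by ring.
  by apply: H; rewrite oppr_ge0.
have := @le_from_derive (fun y => y ^+ 4 / 24 - y ^+ 2 / 2 - cos y)
  (fun y => sin y - y + y ^+ 3 / 6) x.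
rewrite cos0 !expr0n/= !mul0r => h.
rewrite /cos_remainder; suff : -1 <= x ^+ 4 / 24 - x ^+ 2 / 2 - cos x by lra.
have -> : -1 = 0 - 0 - 1 :> R by lra.
apply: h => //; last by move=> y y0; have := sin_ge y0; lra.
move=> y.
apply: is_derive_eq.
by rewrite /GRing.scale/=; field.
Qed.

(** The quartic Taylor bound leaves the factor 1/2 - 1/24, which exceeds 1/4. *)
Lemma sqr_le_1Bcos x : `|x| <= 1 -> x ^+ 2 <= 4 * (1 - cos x).
Proof.
move=> x1; have := cos_remainder_le4 x; rewrite /cos_remainder.
have : x ^+ 2 <= 1 by rewrite -real_normK ?num_real// expr_le1.
have := sqr_ge0 x; rewrite (_ : x ^+ 4 = x ^+ 2 * x ^+ 2); last by ring.
nra.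
Qed.

Lemma le_sinD_sqr x : `|x| <= 1 -> x <= sin x + x ^+ 2.
Proof.
have [x0|/ltW x0] := leP 0 x.
  rewrite ger0_norm// => x1; have := sin_ge x0.
  have : x ^+ 3 <= x ^+ 2 by rewrite exprS ler_piMl// sqr_ge0.
  have := sqr_ge0 x; lra.
move=> _; have := @sin_le (- x); rewrite oppr_ge0 sinN lerN2 => /(_ x0).
have := sqr_ge0 x; lra.
Qed.

(* The right-hand side has an explicit expectation under a stable law; the
   linear term of the exponential is traded for a sine because the law is not
   known to be symmetric beforehand. *)
Lemma expR_truncated_le t z : 0 <= t ->
  expR (t * (if `|z| <= 1 then z else 0)) <=
  1 + t * sin z + 4 * (t + t ^+ 2 * expR t) * (1 - cos z) +
  t * (~~ (`|z| <= 1))%:R.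
Proof.
move=> t0; case: (leP `|z| 1) => /= z1.
- have := sqr_le_1Bcos z1; have := le_sinD_sqr z1 => h1 h2.
  have tz : t * z <= t.
    by rewrite ler_piMr// (le_trans (ler_norm _)).
  have := expR_le_quadratic t0 tz.
  have a : t * z <= t * (sin z + z ^+ 2) by rewrite ler_wpM2l.
  have e0 : 0 <= expR t by exact: expR_ge0.
  set e := expR t in e0 *; set c := cos z in h2 *; set s := sin z in a *.
  have b : (t + t ^+ 2 * e) * z ^+ 2 <= (t + t ^+ 2 * e) * (4 * (1 - c)).
    by rewrite ler_wpM2l// addr_ge0// mulr_ge0// sqr_ge0.
  rewrite exprMn; lra.
- rewrite mulr0 expR0.
  have : 0 <= 4 * (t + t ^+ 2 * expR t) * (1 - cos z).
    rewrite mulr_ge0// ?subr_ge0 ?cos_le1// mulr_ge0// addr_ge0//.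
    by rewrite mulr_ge0// ?expR_ge0// sqr_ge0.
  have : 0 <= t * (1 + sin z) by rewrite mulr_ge0//; have := sin_geN1 z; lra.
  lra.
Qed.

End ElementaryInequalities.

(** * A smoothed indicator as an integral of cosines *)

Lemma integrable_mull d (T : measurableType d) (R : realType)
    (nu : {measure set T -> \bar R}) (c : R) (f : T -> R) :
  nu.-integrable setT (EFin \o f) -> nu.-integrable setT (EFin \o (fun x => c * f x)).
Proof.
move=> fi; have := integrableZl measurableT c fi.
by apply: eq_integrable => // x _ /=; rewrite EFinM.
Qed.

Section LebesgueLine.
Context {R : realType}.
Implicit Types x y z t b : R.
Local Notation mu := (@lebesgue_measure R).

Lemma integrable_oneDsqrV : mu.-integrable setT (fun x => ((1 + x ^+ 2)^-1)%:E).
Proof.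
have c1 : continuous (fun x : R => (1 + x ^+ 2)^-1).
  exact: (@continuous_oneDsqrV R).
have m1 := continuous_measurable_fun c1.
have p0 x : 0 <= (1 + x ^+ 2)^-1 by rewrite invr_ge0 addr_ge0// sqr_ge0.
apply/integrableP; split; first exact/measurable_EFinP.
under eq_integral do rewrite abse_EFin ger0_norm//.
rewrite ge0_symfun_integralT//; last by move=> x /=; rewrite sqrrN.
rewrite -set_itvcy integral0y_oneDsqr.
by rewrite -EFinM ltry.
Qed.

Lemma integrable_dominated (f g : R -> R) (c : R) : measurable_fun setT f ->
  mu.-integrable setT (EFin \o g) -> (forall x, `|f x| <= c * g x) ->
  mu.-integrable setT (EFin \o f).
Proof.
move=> mf ig fg.
have := @integrableZl _ _ _ mu setT measurableT c _ ig.
apply: le_integrable => //.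
- exact/measurable_EFinP.
- move=> x _ /=; rewrite lee_fin.
  by rewrite (le_trans (fg x))// ler_norm.
Qed.

Lemma lebesgue_measure_scale (c : R) (A : set (measurableTypeR R)) (c0 : 0 < c) :
  measurable A ->
  mu A = (c%:E * pushforward mu ( *%R c : _ -> measurableTypeR R) A)%E.
Proof.
move=> mA.
pose nu := @pushforward _ _ _ (measurableTypeR R) R mu ( *%R c : _ -> measurableTypeR R).
apply: (@lebesgue_measure_unique _ (mscale (NngNum (ltW c0)) nu)) => // _ [[a b]] _ <-.
rewrite /= /mscale /= /nu /pushforward.
have -> : ( *%R c : _ -> measurableTypeR R) @^-1` `]a, b]%classic = `]a / c, b / c]%classic.
  by apply/seteqP; split => x /=; rewrite !in_itv/= ltr_pdivrMr// ler_pdivlMr// mulrC.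
rewrite !lebesgue_measure_itv/= !lte_fin ltr_pM2r ?invr_gt0//.
case: ifPn => _; last by rewrite mule0.
by rewrite -!EFinD -EFinM -mulrBl mulrCA divff ?gt_eqF// mulr1.
Qed.

Lemma ge0_integral_scale (c : R) (f : R -> R) : 0 < c ->
  measurable_fun setT f -> (forall x, 0 <= f x) ->
  (\int[mu]_x (f x)%:E = c%:E * \int[mu]_x (f (c * x))%:E)%E.
Proof.
move=> c0 mf f0.
pose nu := @pushforward _ _ _ (measurableTypeR R) R mu ( *%R c : _ -> measurableTypeR R).
rewrite (eq_measure_integral (mscale (NngNum (ltW c0)) nu)); last first.
  by move=> A mA _; exact: lebesgue_measure_scale.
rewrite ge0_integral_mscale//;
  [|exact/measurable_EFinP|by move=> x _; rewrite lee_fin].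
congr (_ * _)%E; rewrite ge0_integral_pushforward//; first exact/measurable_EFinP.
by move=> x _; rewrite lee_fin.
Qed.

Lemma measurable_cos : measurable_fun setT (@cos R).
Proof. exact: continuous_measurable_fun (@continuous_cos R). Qed.

Lemma measurable_sin : measurable_fun setT (@sin R).
Proof. exact: continuous_measurable_fun (@continuous_sin R). Qed.

Lemma measurable_quarticV : measurable_fun setT (fun x : R => (x ^+ 4)^-1).
Proof.
rewrite (_ : (fun x : R => _) = (@powR R ^~ (-1)) \o (fun x => x ^+ 4)); last first.
  by apply/funext => x /=; rewrite powR_inv1// exprn_even_ge0.
apply: measurableT_comp; first exact: measurable_powR.
exact: exprn_measurable.
Qed.

(* At [t = 0] the quotient below is [0 / 0 = 0]. *)
Lemma integrable_cos_remainder y :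
  mu.-integrable setT (fun t => (cos_remainder (t * y) / t ^+ 4)%:E).
Proof.
have my : measurable_fun setT (fun t : R => t * y) by exact: mulrr_measurable.
apply: (@integrable_dominated _ _ (y ^+ 2 + y ^+ 4) _ integrable_oneDsqrV).
  apply: measurable_funM; last exact: measurable_quarticV.
  apply: measurable_funD.
    apply: measurable_funB => //; apply: measurableT_comp my; exact: measurable_cos.
  by apply: measurable_funM => //; exact: measurable_funX.
move=> t; rewrite ger0_norm; last first.
  by rewrite divr_ge0 ?cos_remainder_ge0// exprn_even_ge0.
have [->|t0] := eqVneq t 0.
  by rewrite expr0n/= invr0 mulr0 mulr_ge0// ?addr_ge0// ?sqr_ge0 ?exprn_even_ge0.
have p0 : 0 < 1 + t ^+ 2 by have := sqr_ge0 t; lra.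
have t2 : 0 < t ^+ 2 by rewrite exprn_even_gt0.
have t4 : 0 < t ^+ 4 by rewrite exprn_even_gt0.
rewrite ler_pdivrMr// mulrAC ler_pdivlMr//.
have := @cos_remainder_le2 _ (t * y); have := @cos_remainder_le4 _ (t * y).
have := @cos_remainder_ge0 _ (t * y).
move: (cos_remainder _) => c c0 c4 c2.
have y2 : 0 <= y ^+ 2 by exact: sqr_ge0.
have y4 : 0 <= y ^+ 4 by rewrite exprn_even_ge0.
rewrite exprMn in c4; rewrite exprMn in c2.
have a : c * t ^+ 2 <= t ^+ 4 * y ^+ 2 / 2.
  have := ler_wpM2r (ltW t2) c2.
  by rewrite (_ : t ^+ 2 * y ^+ 2 / 2 * t ^+ 2 = t ^+ 4 * y ^+ 2 / 2)//; ring.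
have b1 : 0 <= y ^+ 2 * t ^+ 4 by rewrite mulr_ge0// ltW.
have b2 : 0 <= y ^+ 4 * t ^+ 4 by rewrite mulr_ge0// ltW.
rewrite mulrDr mulr1 mulrDl; lra.
Qed.

(** The value is pi / 6: two integrations by parts reduce it to one sixth of the integral of (1 -
    cos t) / t^2. *)
Definition cube_const : R := \int[mu]_t (cos_remainder t / t ^+ 4).

(** Substitute [t * |y|] for [t]. Cubes of absolute values are thus integrals of cosines up to
    quadratic polynomials, so a linear combination of such cubes in which the quadratics cancel is
    an integral of cosines alone. *)
Lemma Rintegral_cos_remainder y :
  \int[mu]_t (cos_remainder (t * y) / t ^+ 4) = cube_const * `|y| ^+ 3.
Proof.
have pos z t : 0 <= cos_remainder (t * z) / t ^+ 4.
  by rewrite divr_ge0 ?cos_remainder_ge0// exprn_even_ge0.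
have [->|y0] := eqVneq y 0.
  rewrite normr0 expr0n/= mulr0.
  under eq_Rintegral do rewrite mulr0 /cos_remainder cos0 subrr expr0n/= mul0r addr0 mul0r.
  by rewrite Rintegral_cst// mul0r.
have ny0 : 0 < `|y| by rewrite normr_gt0.
have i1 := integrable_cos_remainder 1.
have i2 := integrable_cos_remainder y.
have e : (\int[mu]_t (cos_remainder (t * 1) / t ^+ 4)%:E =
   `|y|%:E * \int[mu]_t (cos_remainder (t * y) / t ^+ 4 / `|y| ^+ 4)%:E)%E.
  rewrite (ge0_integral_scale ny0)//.
  - congr (_ * _)%E; apply: eq_integral => t _; congr EFin.
    rewrite mulr1 exprMn invfM mulrA [RHS]mulrAC; congr (_ * _ / _).
    rewrite mulrC; case: (ger0P y) => _ //.
    by rewrite mulrN cos_remainderN.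
  - by have /integrableP[/measurable_EFinP] := i1.
have i3 : mu.-integrable setT
    (EFin \o (fun t => cos_remainder (t * y) / t ^+ 4 * (`|y| ^+ 4)^-1)).
  by apply: (integrable_dominated (c := (`|y| ^+ 4)^-1) _ i2);
    [apply: measurable_funM => //; have /integrableP[/measurable_EFinP] := i2|
     move=> t; rewrite mulrC ger0_norm// mulr_ge0// invr_ge0 exprn_ge0].
have : cube_const = `|y| * \int[mu]_t (cos_remainder (t * y) / t ^+ 4 * (`|y| ^+ 4)^-1).
  rewrite /cube_const /Rintegral.
  under eq_integral do rewrite -[X in cos_remainder X]mulr1.
  rewrite e fineM//; exact: integrable_fin_num i3.
rewrite RintegralZr// => ->; field; exact: lt0r_neq0.
Qed.

Lemma cube_const_gt0 : 0 < cube_const.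
Proof.
(* On [3, 4] the numerator is at least 9 / 2 - 2 = 5 / 2 and the denominator is at most 256. *)
pose c : R := 5 / 2 / 256.
have c0 : 0 < c by rewrite /c; lra.
have i1 := integrable_cos_remainder 1.
have ind : mu.-integrable setT (EFin \o (fun t => c * \1_(`[3, 4] : set R) t)).
  apply: integrable_mull; exact: integrable_indic_itv.
suff : c <= cube_const by exact: lt_le_trans.
have -> : c = \int[mu]_t (c * \1_(`[3, 4] : set R) t).
  rewrite RintegralZl//; last exact: integrable_indic_itv.
  rewrite /Rintegral integral_indic//= setIT lebesgue_measure_itv/= lte_fin.
  by rewrite ifT ?ltr_nat//= (_ : 4 - 3 = 1) ?mulr1//; lra.
apply: le_Rintegral => //.
  by under eq_fun do rewrite -[X in cos_remainder X]mulr1.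
move=> t _; rewrite indicE; case: (boolP (t \in _)) => /= [|_]; last first.
  by rewrite mulr0 divr_ge0 ?cos_remainder_ge0// exprn_even_ge0.
rewrite inE/= in_itv/= => /andP[t3 t4].
have tt : 9 <= t ^+ 2 by nra.
have tt' : t ^+ 2 <= 16 by nra.
have q : t ^+ 4 = t ^+ 2 * t ^+ 2 by ring.
have q0 : 0 < t ^+ 4 by rewrite q; nra.
rewrite mulr1 ler_pdivlMr// /cos_remainder /c.
have := cos_geN1 t; rewrite q; nra.
Qed.

End LebesgueLine.

Section SplineKernel.
Context {R : realType}.
Implicit Types x y z t b : R.
Local Notation mu := (@lebesgue_measure R).
Variable delta : R.
Hypothesis delta_gt0 : 0 < delta.

Let b1 := 1 + delta.
Let b2 := 1 + 2 * delta.
Let b3 := 1 + 3 * delta.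

(** An even C^2 cubic spline: for [0 <= x] it is the distribution function of the sum of three
    uniform variables, rescaled to the window from 1 to [1 + 3 * delta]. Writing it with cubes of
    absolute values makes it an integral of cosines. *)
Definition spline_step x : R :=
  1 + (12 * delta ^+ 3)^-1 *
    ((`|x - 1| ^+ 3 + `|x + 1| ^+ 3) - 3 * (`|x - b1| ^+ 3 + `|x + b1| ^+ 3) +
     3 * (`|x - b2| ^+ 3 + `|x + b2| ^+ 3) - (`|x - b3| ^+ 3 + `|x + b3| ^+ 3)).

Lemma spline_stepN x : spline_step (- x) = spline_step x.
Proof.
have e b : `|- x - b| ^+ 3 + `|- x + b| ^+ 3 = `|x - b| ^+ 3 + `|x + b| ^+ 3.
  have -> : - x + b = - (x - b) by ring.
  by rewrite -opprD !normrN addrC.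
by rewrite /spline_step !e.
Qed.

(** For [0 <= x] the cubes of [x + b] are polynomials with constant third difference
    [- 6 * delta ^+ 3]; this turns the leading 1 into 1/2. *)
Lemma spline_step_ge0E x : 0 <= x -> let y := (x - 1) / delta in
  spline_step x = 2^-1 + 12^-1 *
    (`|y| ^+ 3 - 3 * `|y - 1| ^+ 3 + 3 * `|y - 2| ^+ 3 - `|y - 3| ^+ 3).
Proof.
move=> x0 y; have d0 : delta != 0 by rewrite gt_eqF.
have xE : x = 1 + delta * y by rewrite /y; field.
have n (k : R) : `|x - (1 + k * delta)| = delta * `|y - k|.
  by rewrite -[in RHS](gtr0_norm delta_gt0) -normrM xE; congr `|_|; ring.
have p (k : R) : 0 <= k -> `|x + (1 + k * delta)| = x + (1 + k * delta).
  by move=> k0; rewrite ger0_norm// addr_ge0// addr_ge0// mulr_ge0// ltW.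
have n0 := n 0; have n1 := n 1; have n2 := n 2; have n3 := n 3.
rewrite !mul0r !addr0 subr0 in n0; rewrite mul1r in n1.
have p0 := p 0 (lexx _); have p1 := p 1 ler01.
have p2 := p 2 ltac:(by []); have p3 := p 3 ltac:(by []).
rewrite mul0r addr0 in p0; rewrite mul1r in p1.
rewrite /spline_step /b1 /b2 /b3 n0 n1 n2 n3 p0 p1 p2 p3.
move: `|y| `|y - 1| `|y - 2| `|y - 3| => u0 u1 u2 u3.
field; exact: d0.
Qed.

Let cubeN z : z <= 0 -> `|z| ^+ 3 = - z ^+ 3.
Proof. by move=> z0; rewrite ler0_norm//; ring. Qed.

Let cubeP z : 0 <= z -> `|z| ^+ 3 = z ^+ 3.
Proof. by move=> z0; rewrite ger0_norm. Qed.

Lemma spline_step_eq0 x : `|x| <= 1 -> spline_step x = 0.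
Proof.
wlog x0 : x / 0 <= x => [H|].
  have [/H//|/ltW x0] := leP 0 x.
  by rewrite -spline_stepN -normrN; apply: H; rewrite oppr_ge0.
rewrite ger0_norm// => x1; rewrite spline_step_ge0E//=; set y := _ / _.
have y0 : y <= 0 by rewrite /y ler_pdivrMr// mul0r subr_le0.
rewrite !cubeN; [by field | lra..].
Qed.

Lemma spline_step_eq1 x : 1 + 3 * delta <= `|x| -> spline_step x = 1.
Proof.
wlog x0 : x / 0 <= x => [H|].
  have [/H//|/ltW x0] := leP 0 x.
  by rewrite -spline_stepN -normrN; apply: H; rewrite oppr_ge0.
rewrite ger0_norm// => x1; rewrite spline_step_ge0E//=; set y := _ / _.
have y0 : 3 <= y by rewrite /y ler_pdivlMr//; lra.
rewrite !cubeP; [by field | lra..].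
Qed.

Lemma spline_step_itv x : 0 <= spline_step x <= 1.
Proof.
wlog x0 : x / 0 <= x => [H|].
  have [/H//|/ltW x0] := leP 0 x.
  by rewrite -spline_stepN; apply: H; rewrite oppr_ge0.
have [x1|/ltW x1] := leP x 1.
  by rewrite spline_step_eq0 ?lexx ?ler01// ger0_norm.
have [x3|/ltW x3] := leP (1 + 3 * delta) x.
  by rewrite spline_step_eq1 ?lexx ?ler01// ger0_norm.
rewrite spline_step_ge0E//=; set y := _ / _.
have y0 : 0 <= y by rewrite /y divr_ge0 ?subr_ge0// ltW.
have y3 : y <= 3 by rewrite /y ler_pdivrMr//; lra.
have [y1|/ltW y1] := leP y 1; [|have [y2|/ltW y2] := leP y 2].
- rewrite (cubeP y0) !cubeN; [|lra..].
  rewrite (_ : 2^-1 + _ = y ^+ 3 / 6); last by field.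
  have : 0 <= y ^+ 3 by exact: exprn_ge0.
  have : y ^+ 3 <= 1 by rewrite exprn_ile1.
  lra.
- rewrite (cubeP y0) (@cubeP (y - 1)); last lra.
  rewrite !cubeN; [|lra..].
  rewrite (_ : 2^-1 + _ = (1 + 3 * (y - 1) + 3 * (y - 1) ^+ 2 - 2 * (y - 1) ^+ 3) / 6);
    last by field.
  have [v0 v1] : 0 <= y - 1 /\ y - 1 <= 1 by lra.
  move: (y - 1) v0 v1 => v v0 v1.
  have : v ^+ 3 <= v ^+ 2 by rewrite exprS ler_piMl// sqr_ge0.
  have : v ^+ 2 <= v by rewrite expr2 ler_piMl.
  (* This says [3 * v - 2 <= v ^+ 3], the tangent of the cube at 1; with [v ^+ 2 <= v] it keeps the
     middle piece below 1. *)
  have : 0 <= (v - 1) ^+ 2 * (v + 2) by rewrite mulr_ge0 ?sqr_ge0//; lra.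
  rewrite (_ : (v - 1) ^+ 2 * (v + 2) = v ^+ 3 - 3 * v + 2); last by ring.
  have : 0 <= v ^+ 2 by exact: sqr_ge0.
  lra.
- rewrite (@cubeN (y - 3)); last lra.
  rewrite !cubeP; [|lra..].
  rewrite (_ : 2^-1 + _ = 1 - (3 - y) ^+ 3 / 6); last by field.
  have : 0 <= (3 - y) ^+ 3 by rewrite exprn_ge0//; lra.
  have : (3 - y) ^+ 3 <= 1 by rewrite exprn_ile1//; lra.
  lra.
Qed.

(** The third difference in [b] of [cos (t * b)] over the nodes of [spline_step]. The product
    formula for cosines carries it to the third difference of the cubes of [x - b] and [x + b]. *)
Definition spline_kernel t : R :=
  (cos t - 3 * cos (t * b1) + 3 * cos (t * b2) - cos (t * b3)) / t ^+ 4.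

Lemma measurable_spline_kernel : measurable_fun setT spline_kernel.
Proof.
have m b : measurable_fun setT (fun t : R => cos (t * b)).
  by apply: measurableT_comp; [exact: measurable_cos|exact: mulrr_measurable].
apply: measurable_funM; last exact: measurable_quarticV.
apply: measurable_funB => //; apply: measurable_funD; last exact: measurable_funM.
apply: measurable_funB; first exact: measurable_cos.
exact: measurable_funM.
Qed.

Let kernel_bound : R := 4 * ((1 + 3 * b1 ^+ 4 + 3 * b2 ^+ 4 + b3 ^+ 4) / 24 + 8).

(* The third difference with nodes [1], [b1], [b2], [b3] annihilates quadratic
   polynomials, which makes the numerator O(t^4) near 0. *)
Lemma spline_kernel_le t :
  `|spline_kernel t| <= kernel_bound * ((1 + t ^+ 2) ^+ 2)^-1.
Proof.
have t2 : 0 <= t ^+ 2 by exact: sqr_ge0.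
have bb (b : R) : 0 <= b ^+ 4 by rewrite exprn_even_ge0.
have kb : 32 <= kernel_bound.
  by have := bb b1; have := bb b2; have := bb b3; rewrite /kernel_bound; lra.
have p0 : 0 < (1 + t ^+ 2) ^+ 2 by apply: exprn_gt0; lra.
have [->|t0] := eqVneq t 0.
  rewrite /spline_kernel [0 ^+ 4]expr0n/= invr0 mulr0 normr0 expr0n/= addr0.
  by rewrite expr1n invr1 mulr1; lra.
have t2p : 0 < t ^+ 2 by rewrite exprn_even_gt0.
have t4p : 0 < t ^+ 4 by rewrite exprn_even_gt0.
have t4E : t ^+ 4 = t ^+ 2 * t ^+ 2 by ring.
rewrite /spline_kernel normrM normfV (gtr0_norm t4p) ler_pdivrMr//.
rewrite mulrAC ler_pdivlMr//.
set D := _ - _.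
have D8 : `|D| <= 8.
  have c z : -1 <= cos z <= 1 by rewrite cos_geN1 cos_le1.
  have := c t; have := c (t * b1); have := c (t * b2); have := c (t * b3).
  by rewrite /D ler_norml; lra.
have Dt : `|D| <= t ^+ 4 * ((1 + 3 * b1 ^+ 4 + 3 * b2 ^+ 4 + b3 ^+ 4) / 24).
  have DE : D = cos_remainder t - 3 * cos_remainder (t * b1) +
      3 * cos_remainder (t * b2) - cos_remainder (t * b3).
    by rewrite /D /cos_remainder /b1 /b2 /b3; field.
  have c z : 0 <= cos_remainder z <= z ^+ 4 / 24.
    by rewrite cos_remainder_ge0 cos_remainder_le4.
  have := c t; have := c (t * b1); have := c (t * b2); have := c (t * b3).
  rewrite !exprMn DE.
  move: (cos_remainder _) (cos_remainder _) (cos_remainder _) (cos_remainder _).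
  move=> r3 r2 r1 r0 c3 c2 c1 c0.
  have -> : t ^+ 4 * ((1 + 3 * b1 ^+ 4 + 3 * b2 ^+ 4 + b3 ^+ 4) / 24) =
    t ^+ 4 / 24 + 3 * (t ^+ 4 * b1 ^+ 4 / 24) + 3 * (t ^+ 4 * b2 ^+ 4 / 24) +
      t ^+ 4 * b3 ^+ 4 / 24 by field.
  move: (t ^+ 4 / 24) (t ^+ 4 * b1 ^+ 4 / 24) (t ^+ 4 * b2 ^+ 4 / 24)
    (t ^+ 4 * b3 ^+ 4 / 24) c0 c1 c2 c3 => u0 u1 u2 u3 c0 c1 c2 c3.
  by rewrite ler_norml; lra.
have D0 : 0 <= `|D| by [].
rewrite /kernel_bound; move: ((1 + 3 * b1 ^+ 4 + 3 * b2 ^+ 4 + b3 ^+ 4) / 24) Dt => B.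
rewrite t4E; move: `|D| D0 D8 (t ^+ 2) t2p => w w0 w8 v v0 wB.
have B0 : 0 <= B by rewrite -(pmulr_rge0 B (mulr_gt0 v0 v0)) (le_trans w0).
have [v1|/ltW v1] := leP v 1.
  have a : (1 + v) ^+ 2 <= 4 by nra.
  have : w * (1 + v) ^+ 2 <= w * 4 by rewrite ler_wpM2l.
  have : 0 <= v * v by nra.
  nra.
have a : (1 + v) ^+ 2 <= 4 * (v * v) by nra.
have c : w * (1 + v) ^+ 2 <= 8 * (4 * (v * v)).
  by apply: ler_pM => //; apply: sqr_ge0.
have : 0 <= B * (v * v) by rewrite !mulr_ge0// ltW.
lra.
Qed.

Let Phi y t : R := cos_remainder (t * y) / t ^+ 4.

Lemma Rintegral_spline_kernel x :
  \int[mu]_t ((cos (t * x) - 1) * spline_kernel t) =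
  6 * delta ^+ 3 * cube_const * spline_step x.
Proof.
have p0 : 0 < b1 by rewrite addr_gt0.
have p1 : 0 < b2 by rewrite addr_gt0// mulr_gt0.
have p2 : 0 < b3 by rewrite addr_gt0// mulr_gt0.
(* Pairs of a coefficient and an argument. The product formula splits [cos (t * x) * cos (t * b)]
   into halves at [x - b] and [x + b]; the last four pairs come from the [- 1]. The quadratic
   polynomials cancel in the total, so every cosine may be traded for [cos_remainder]. *)
pose s : seq (R * R) := [:: (2^-1, x - 1); (2^-1, x + 1);
  (- 3 / 2, x - b1); (- 3 / 2, x + b1); (3 / 2, x - b2); (3 / 2, x + b2);
  (- 2^-1, x - b3); (- 2^-1, x + b3); (-1, 1); (3, b1); (- 3, b2); (1, b3)].
have iPhi (a y : R) : mu.-integrable setT (EFin \o (fun t => a * Phi y t)).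
  apply: integrable_mull; exact: integrable_cos_remainder.
have H (r : seq (R * R)) :
  mu.-integrable setT (EFin \o (fun t => \sum_(p <- r) p.1 * Phi p.2 t)) /\
  \int[mu]_t (\sum_(p <- r) p.1 * Phi p.2 t) =
  \sum_(p <- r) p.1 * (cube_const * `|p.2| ^+ 3).
  elim: r => [|p r [IH1 IH2]].
    under eq_fun do rewrite big_nil.
    rewrite big_nil Rintegral_cst// mul0r; split => //.
    exact: integrable0.
  split.
    under eq_fun do rewrite big_cons.
    by have := integrableD measurableT (iPhi p.1 p.2) IH1.
  have -> : (fun t => \sum_(p0 <- p :: r) p0.1 * Phi p0.2 t) =
     (fun t => p.1 * Phi p.2 t + \sum_(p0 <- r) p0.1 * Phi p0.2 t).
    by apply/funext => t; rewrite big_cons.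
  rewrite RintegralD// IH2 big_cons RintegralZl//; last exact: integrable_cos_remainder.
  by rewrite Rintegral_cos_remainder.
transitivity (\int[mu]_t (\sum_(p <- s) p.1 * Phi p.2 t)).
  apply: eq_Rintegral => t _; rewrite /s !big_cons big_nil /= /Phi /spline_kernel.
  have em b : cos (t * (x - b)) = cos (t * x) * cos (t * b) + sin (t * x) * sin (t * b).
    by rewrite mulrBr cosB.
  have ep b : cos (t * (x + b)) = cos (t * x) * cos (t * b) - sin (t * x) * sin (t * b).
    by rewrite mulrDr cosD.
  rewrite /cos_remainder (em 1) (em b1) (em b2) (em b3) (ep 1) (ep b1) (ep b2) (ep b3).
  rewrite !(mulr1 t).
  move: (cos (t * x)) (sin (t * x)) (cos t) (sin t) (cos (t * b1)) (sin (t * b1))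
    (cos (t * b2)) (sin (t * b2)) (cos (t * b3)) (sin (t * b3)) (t ^+ 4)^-1.
  by rewrite /b1 /b2 /b3 => c e c0 e0 c1 e1 c2 e2 c3 e3 v; field.
rewrite (H s).2 /s !big_cons big_nil /= normr1.
rewrite (gtr0_norm p0) (gtr0_norm p1) (gtr0_norm p2) /spline_step.
move: `|x - 1| `|x + 1| `|x - b1| `|x + b1| `|x - b2| `|x + b2| `|x - b3| `|x + b3|.
move=> u0 v0 u1 v1 u2 v2 u3 v3; rewrite /b1 /b2 /b3; field.
by rewrite gt_eqF.
Qed.

End SplineKernel.

(** * Tails of stable laws *)

(* [3 - 4 x + (2 x^2 - 1) = 2 (1 - x)^2], used with [x] a cosine. *)
Lemma cos_mixture_le8 {R : realFieldType} (q x : R) : 0 <= q -> -1 <= x -> x <= 1 ->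
  3 + -4 * x + (2 * x ^+ 2 - 1) <= 8 * 1 + q * (1 - x).
Proof. by move=> q0 x0 x1; have : 0 <= q * (1 - x) by [rewrite mulr_ge0// subr_ge0]; nra. Qed.

Lemma cos_mixture_le {R : realFieldType} (q x y : R) : x <= 1 -> 1 - y / 2 <= x -> y <= q ->
  3 + -4 * x + (2 * x ^+ 2 - 1) <= q * (1 - x).
Proof. by move=> x1 yx yq; nra. Qed.

(** [E] and [E'] stand for a characteristic function at [1 / u] and [2 / u], and [t] for a tail. In
    the last hypothesis the left side is at least [3 / 4 * g * y], the right side at most
    [g / 2 * y]. *)
Lemma laplace_gap_contra {R : realFieldType} (g y t E E' : R) : 0 < g -> 0 < y ->
  y <= g / 16 -> t <= g / 32 * y -> 1 - (4 - g) * y <= E' -> 1 - y <= E ->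
  E <= 1 - y + y ^+ 2 -> 3 + -4 * E + E' <= 8 * t + g / 4 * (1 - E) -> False.
Proof.
move=> g0 y0 yg ty E'1 E1 E2 h.
have : g / 4 * (1 - E) <= g / 4 * y by rewrite ler_wpM2l//; lra.
have : y ^+ 2 <= g / 16 * y by rewrite expr2 ler_wpM2r// ltW.
have : 0 < g * y by rewrite mulr_gt0.
lra.
Qed.

Section BoundedExpectation.
Context {R : realType} {d : measure_display} {T : measurableType d}.
Variable P : probability T R.
Implicit Types (f g : T -> R) (A : set T).

Lemma bounded_integrable f (c : R) : measurable_fun setT f ->
  (forall w, `|f w| <= c) -> P.-integrable setT (EFin \o f).
Proof.
move=> mf fc; apply: measurable_bounded_integrable => //.
  by rewrite (le_lt_trans (probability_le1 P measurableT))// ltry.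
exists c; split; first exact: num_real.
by move=> y cy w _; rewrite /= (le_trans (fc w))// ltW.
Qed.

Lemma Rintegral_indic A : measurable A -> \int[P]_w \1_A w = fine (P A).
Proof. by move=> mA; rewrite /Rintegral integral_indic// setIT. Qed.

Lemma indic_integrable A : measurable A -> P.-integrable setT (EFin \o (\1_A : T -> R)).
Proof.
move=> mA; apply: (@bounded_integrable _ 1) => // w.
by rewrite indicE; case: (_ \in _); rewrite ?normr1 ?normr0.
Qed.

Lemma Rintegral_one (c : R) : \int[P]_w c = c.
Proof.
rewrite Rintegral_cst//; have -> : fine (P setT) = 1.
  by rewrite -[RHS]/(fine 1%:E); congr fine; exact: probability_setT.
by rewrite mulr1.
Qed.

Lemma fine_probability_ge0 A : 0 <= fine (P A).
Proof. by rewrite fine_ge0. Qed.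

Lemma fine_probability_le A B : measurable A -> measurable B -> A `<=` B ->
  fine (P A) <= fine (P B).
Proof.
by move=> mA mB AB; apply: fine_le; rewrite ?fin_num_measure// le_measure// inE.
Qed.

Lemma fine_probability_le1 A : measurable A -> fine (P A) <= 1.
Proof.
move=> mA; rewrite -[leRHS]/(fine 1%:E); apply: fine_le => //.
  exact: fin_num_measure.
exact: probability_le1.
Qed.

Lemma EFin_fine_probability A : measurable A -> (fine (P A))%:E = P A.
Proof. by move=> mA; rewrite fineK// fin_num_measure. Qed.

End BoundedExpectation.

Section RealFubini.
Context {R : realType} {d1 d2 : measure_display}.
Context {T1 : measurableType d1} {T2 : measurableType d2}.
Variables (m1 : {sigma_finite_measure set T1 -> \bar R}).
Variables (m2 : {sigma_finite_measure set T2 -> \bar R}).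
Local Open Scope ereal_scope.

Lemma Rintegral_Fubini (f : T1 * T2 -> R) :
  (m1 \x m2).-integrable setT (EFin \o f) ->
  (forall x, m2.-integrable setT (fun y => (f (x, y))%:E)) ->
  (forall y, m1.-integrable setT (fun x => (f (x, y))%:E)) ->
  (\int[m1]_x \int[m2]_y f (x, y) = \int[m2]_y \int[m1]_x f (x, y))%R.
Proof.
move=> fi f1 f2; congr fine.
transitivity (\int[m1]_x \int[m2]_y (f (x, y))%:E).
  apply: eq_integral => x _; rewrite fineK//; exact: integrable_fin_num (f1 x).
transitivity (\int[m2]_y \int[m1]_x (f (x, y))%:E); first exact: (Fubini fi).
by apply: eq_integral => y _; rewrite fineK//; exact: integrable_fin_num (f2 y).
Qed.

End RealFubini.

Section StableTail.
Context {R : realType} (alpha : R) {d : measure_display} {T : measurableType d}.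
Variable P : probability T R.
Hypothesis halpha : 0 < alpha < 2.
Implicit Types (V : T -> R) (s u t x y delta : R).
Local Notation mu := (@lebesgue_measure R).

(** The parameter [s] is the alpha-th power of the usual scale, so that it is additive like the
    control measure. [s = 0] is allowed and means that [V] vanishes almost surely. *)
Definition stable_law V s : Prop :=
  [/\ measurable_fun setT V, 0 <= s,
      forall t, \int[P]_w cos (t * V w) = expR (- (`|t| `^ alpha * s))
    & forall t, \int[P]_w sin (t * V w) = 0].

Definition tail V u : R := fine (P [set w | u < `|V w|]).

Lemma measurable_tail V u : measurable_fun setT V -> measurable [set w | u < `|V w|].
Proof.
move=> mV; rewrite -[X in measurable X]setTI.
have mn : measurable_fun setT (fun w => `|V w|).
  by apply: measurableT_comp.
rewrite (_ : [set w | _] = (fun w => `|V w|) @^-1` `]u, +oo[%classic); first exact: mn.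
by apply/seteqP; split => w /=; rewrite in_itv/= andbT.
Qed.

Let alpha0 : 0 < alpha. Proof. by case/andP: halpha. Qed.
Let alpha2 : alpha < 2. Proof. by case/andP: halpha. Qed.

Let cos_V V u : measurable_fun setT V -> measurable_fun setT (fun w => cos (u * V w)).
Proof.
move=> mV; apply: measurableT_comp; first exact: measurable_cos.
exact: measurable_funM.
Qed.

Let cos_int V u : measurable_fun setT V -> P.-integrable setT (EFin \o (fun w => cos (u * V w))).
Proof.
move=> mV; apply: (@bounded_integrable _ _ _ P _ 1); first exact: cos_V.
by move=> w; exact: cos_max.
Qed.

Definition spline_symbol delta (s : R) : R :=
  \int[mu]_t ((expR (- (`|t| `^ alpha * s)) - 1) * spline_kernel delta t).

Lemma measurable_spline_step delta : measurable_fun setT (spline_step delta : R -> R).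
Proof.
have m b : measurable_fun setT (fun x : R => `|x + b| ^+ 3).
  apply: measurable_funX; apply: measurableT_comp => //.
  exact: measurable_funD.
apply: measurable_funD => //; apply: measurable_funM => //.
apply: measurable_funB; last by apply: measurable_funD; exact: m.
apply: measurable_funD; last by apply: measurable_funM => //; apply: measurable_funD; exact: m.
apply: measurable_funB; first by apply: measurable_funD; exact: m.
by apply: measurable_funM => //; apply: measurable_funD; exact: m.
Qed.

Lemma spline_kernel_bound delta : 0 < delta ->
  exists2 B, 0 <= B & forall t, `|spline_kernel delta t| <= B * ((1 + t ^+ 2) ^+ 2)^-1.
Proof.
move=> d0; eexists; last by move=> t; exact: spline_kernel_le.
have q (b : R) : 0 <= b ^+ 4 by rewrite exprn_even_ge0.
have := q (1 + delta); have := q (1 + 2 * delta); have := q (1 + 3 * delta).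
lra.
Qed.

Let oneDsqr_inv_le t : ((1 + t ^+ 2) ^+ 2)^-1 <= (1 + t ^+ 2)^-1.
Proof.
have t2 := sqr_ge0 t; rewrite lef_pV2 ?posrE ?exprn_gt0//; [|lra..].
nra.
Qed.

Lemma spline_kernel_integrable delta : 0 < delta ->
  mu.-integrable setT (EFin \o spline_kernel delta).
Proof.
move=> d0; have [B B0 KB] := spline_kernel_bound d0.
apply: (@integrable_dominated _ _ _ B _ integrable_oneDsqrV).
  exact: measurable_spline_kernel.
by move=> t; rewrite (le_trans (KB t))// ler_wpM2l.
Qed.

(** By Fubini in the cosine representation of the step, only the characteristic function of [V]
    enters, and it depends on [s] and [u] through [s / u ^ alpha]. *)
Lemma expectation_spline_step delta V s u : 0 < delta -> stable_law V s -> 0 < u ->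
  6 * delta ^+ 3 * cube_const * \int[P]_w spline_step delta (V w / u) =
  spline_symbol delta (s / u `^ alpha).
Proof.
move=> d0 [mV s0 Vcos Vsin] u0.
have K1 := spline_kernel_integrable d0.
have mK : measurable_fun setT (spline_kernel delta : R -> R).
  by have /integrableP[/measurable_EFinP] := K1.
have mh : measurable_fun setT (fun w => spline_step delta (V w / u)).
  apply: measurableT_comp; first exact: measurable_spline_step.
  exact: measurable_funM.
have ih : P.-integrable setT (EFin \o (fun w => spline_step delta (V w / u))).
  apply: (@bounded_integrable _ _ _ P _ 1) => // w.
  by have /andP[h0 h1] := spline_step_itv d0 (V w / u); rewrite ger0_norm.
rewrite -RintegralZl//.
pose f (z : T * R) := (cos (z.2 * (V z.1 / u)) - 1) * spline_kernel delta z.2.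
have c2 z : `|cos z - 1| <= 2 :> R.
  by have := cos_geN1 z; have := cos_le1 z; rewrite ler_norml; lra.
have fle z : `|f z| <= 2 * `|spline_kernel delta z.2|.
  by rewrite /f normrM ler_wpM2r.
have mf : measurable_fun setT f.
  apply: measurable_funM; last by apply: measurableT_comp => //; exact: measurable_snd.
  apply: measurable_funB => //; apply: measurableT_comp; first exact: measurable_cos.
  apply: measurable_funM; first exact: measurable_snd.
  apply: measurable_funM => //.
  by apply: measurableT_comp => //; exact: measurable_fst.
have nK : mu.-integrable setT (EFin \o (fun t => 2 * `|spline_kernel delta t|)).
  by apply: integrable_mull; exact: integrable_norm K1.
have f1 w : mu.-integrable setT (fun y => (f (w, y))%:E).
  apply: le_integrable nK => //.
    by apply/measurable_EFinP; apply: measurableT_comp => //; exact: pair1_measurable.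
  move=> t _; rewrite !abse_EFin lee_fin (le_trans (fle _))//= ler_norm//.
have f2 y : P.-integrable setT (fun w => (f (w, y))%:E).
  apply: (@bounded_integrable _ _ _ P _ (2 * `|spline_kernel delta y|)).
    by apply: measurableT_comp => //; exact: pair2_measurable.
  by move=> w; exact: (fle (w, y)).
have fi : ((P \x mu)%E).-integrable setT (EFin \o f).
  apply/integrable12ltyP; first exact/measurable_EFinP.
  apply: (@le_lt_trans _ _ (\int[P]_w (\int[mu]_y (2 * `|spline_kernel delta y|))%:E)%E).
    apply: ge0_le_integral => //.
    - by move=> x _; exact: integral_ge0.
    - have := @measurable_fun_fubini_tonelli_F _ _ _ _ _ mu (abse \o (EFin \o f)).
      apply; last by move=> z; exact: abse_ge0.
      by apply: measurableT_comp => //; exact/measurable_EFinP.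
    - move=> x _; rewrite /Rintegral fineK; last exact: integrable_fin_num nK.
      apply: ge0_le_integral => //.
      + apply: measurableT_comp => //.
        by have /integrableP[] := f1 x.
      + by have /integrableP[] := nK.
      + by move=> y _; rewrite abse_EFin lee_fin; exact: (fle (x, y)).
  rewrite integral_cst// lte_mul_pinfty//.
    by rewrite lee_fin; apply: Rintegral_ge0 => t _; rewrite mulr_ge0.
  by rewrite (le_lt_trans (probability_le1 P measurableT))// ltry.
under eq_Rintegral do rewrite -Rintegral_spline_kernel//.
rewrite (Rintegral_Fubini fi f1 f2); apply: eq_Rintegral => t _.
have mVu : measurable_fun setT (fun w => cos (t * (V w / u))).
  rewrite (_ : (fun w => _) = (fun w => cos (t / u * V w))); first exact: cos_V.
  by apply/funext => w; congr cos; rewrite mulrA mulrAC.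
have ci : P.-integrable setT (EFin \o (fun w => cos (t * (V w / u)))).
  by apply: (@bounded_integrable _ _ _ P _ 1) => // w; exact: cos_max.
rewrite /f /= RintegralZr//; last first.
  apply: (@bounded_integrable _ _ _ P _ 2); last by move=> w; exact: c2.
  exact: measurable_funB.
congr (_ * _).
rewrite RintegralB//; last by apply: (@bounded_integrable _ _ _ P _ 1) => // w; rewrite normr1.
rewrite Rintegral_one; congr (_ - _).
transitivity (\int[P]_w cos (t / u * V w)).
  by apply: eq_Rintegral => w _; rewrite mulrA mulrAC.
rewrite Vcos; congr (expR (- _)).
rewrite normrM normfV (gtr0_norm u0) powRM// ?invr_ge0 ?ltW//.
by rewrite -[u^-1]powR_inv1 ?ltW// -powRrM mulN1r powRN mulrAC mulrA.
Qed.

(** The linearization error of the exponential must be o(y), but a plain square would bring in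
    [|t| ^ (2 * alpha)], which is not integrable against a t^-4 kernel once [alpha >= 3 / 2]. An
    exponent [1 < p <= 2] with [alpha * p <= 2] exists because [alpha < 2]. *)
Let p : R := Num.min (2 / alpha) 2.

Let p_gt1 : 1 < p.
Proof. by rewrite /p lt_min ltr_pdivlMr//; move: alpha2 => a2; apply/andP; split; lra. Qed.

Let p_le2 : p <= 2. Proof. by rewrite /p ge_min lexx orbT. Qed.

Let alpha_p : alpha * p <= 2.
Proof. by rewrite mulrC -ler_pdivlMr// /p ge_min lexx. Qed.

Let expR_linearization y : 0 <= y -> `|expR (- y) - 1 + y| <= y `^ p.
Proof.
move=> y0; have h1 := expRN_ge1B y; have h2 := expRN_le_quadratic y0.
rewrite ger0_norm; last lra.
have e1 : expR (- y) <= 1 by rewrite -expR0 ler_expR; lra.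
have [y1|/ltW y1] := leP 1 y.
  apply: (@le_trans _ _ y); first lra.
  by apply: le1r_powR => //; exact: ltW p_gt1.
have [->|yn0] := eqVneq y 0; first by rewrite oppr0 expR0 subrr addr0 powR_ge0.
apply: (@le_trans _ _ (y ^+ 2)); first lra.
rewrite -powR_mulrn//; apply: ger_powR => //.
by rewrite y1 andbT lt_neqAle eq_sym yn0.
Qed.

Let powR_le_oneDsqr t : `|t| `^ (alpha * p) <= 1 + t ^+ 2.
Proof.
have t2 := sqr_ge0 t.
have ap0 : 0 <= alpha * p.
  by rewrite mulr_ge0//; [exact: ltW|exact: ltW (lt_trans ltr01 p_gt1)].
have [t1|/ltW t1] := leP 1 `|t|.
  apply: (@le_trans _ _ (`|t| `^ 2%:R)); first by apply: ler_powR.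
  by rewrite powR_mulrn// real_normK ?num_real//; lra.
apply: (@le_trans _ _ (1 `^ (alpha * p))).
  by apply: ge0_ler_powR; rewrite ?nnegrE.
by rewrite powR1; lra.
Qed.

(** First-order coefficient in [s] of the smoothed tail. It turns out to bound the tail constant
    from below, and from above up to the factor [(1 + 3 * delta) ^ alpha]. *)
Definition spline_slope delta : R :=
  - (6 * delta ^+ 3 * cube_const)^-1 *
    \int[mu]_t (`|t| `^ alpha * spline_kernel delta t).

Let measurable_normpow : measurable_fun setT (fun t : R => `|t| `^ alpha).
Proof.
apply: (measurableT_comp (measurable_powR alpha)); exact: normr_measurable.
Qed.

Let kernel_powR_integrable delta : 0 < delta ->
  mu.-integrable setT (EFin \o (fun t => `|t| `^ alpha * spline_kernel delta t)).
Proof.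
move=> d0; have [B B0 KB] := spline_kernel_bound d0.
apply: (@integrable_dominated _ _ _ (B * 2) _ integrable_oneDsqrV).
  by apply: measurable_funM => //; exact: measurable_spline_kernel.
move=> t; have t2 := sqr_ge0 t.
have ta : `|t| `^ alpha <= 2 * (1 + t ^+ 2).
  have := powR_le_oneDsqr t; rewrite powRrM.
  have a0 : 0 <= `|t| `^ alpha by exact: powR_ge0.
  have [a1|/ltW a1] := leP (`|t| `^ alpha) 1; first lra.
  have := le1r_powR a1 (ltW p_gt1); lra.
rewrite normrM ger0_norm ?powR_ge0//.
apply: (@le_trans _ _ (2 * (1 + t ^+ 2) * (B * ((1 + t ^+ 2) ^+ 2)^-1))).
  by apply: ler_pM => //; exact: powR_ge0.
rewrite le_eqVlt; apply/orP; left; apply/eqP; field.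
by apply: lt0r_neq0; lra.
Qed.

Lemma spline_symbol_asymptotics delta : 0 < delta ->
  exists2 c, 0 <= c & forall s, 0 <= s ->
    `|(6 * delta ^+ 3 * cube_const)^-1 * spline_symbol delta s - spline_slope delta * s|
       <= c * s `^ p.
Proof.
move=> d0; have [B B0 KB] := spline_kernel_bound d0.
set D := 6 * delta ^+ 3 * cube_const.
have D0 : 0 < D by rewrite !mulr_gt0// ?exprn_gt0// cube_const_gt0.
pose I0 := \int[mu]_t ((1 + t ^+ 2)^-1 : R).
have I00 : 0 <= I0.
  by apply: Rintegral_ge0 => t _; rewrite invr_ge0; have := sqr_ge0 t; lra.
exists (D^-1 * (B * I0)).
  by rewrite !mulr_ge0// invr_ge0 ltW.
move=> s s0; rewrite /spline_slope -/D.
have mK : measurable_fun setT (spline_kernel delta : R -> R).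
  exact: measurable_spline_kernel.
have i1 : mu.-integrable setT
    (EFin \o (fun t => (expR (- (`|t| `^ alpha * s)) - 1) * spline_kernel delta t)).
  apply: (@integrable_dominated _ _ _ 1 _ (integrable_norm (spline_kernel_integrable d0))).
    apply: measurable_funM => //; apply: measurable_funB => //.
    apply: measurableT_comp => //; apply: measurableT_comp => //.
    exact: measurable_funM.
  move=> t; rewrite normrM ler_wpM2r//.
  have e0 := expR_ge0 (- (`|t| `^ alpha * s)).
  have : expR (- (`|t| `^ alpha * s)) <= 1.
    by rewrite -expR0 ler_expR oppr_le0 mulr_ge0// powR_ge0.
  by rewrite ler_norml; lra.
have i2 := kernel_powR_integrable d0.
have i2s : mu.-integrable setT
   (EFin \o (fun t => s * (`|t| `^ alpha * spline_kernel delta t))).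
  exact: integrable_mull.
have -> : D^-1 * spline_symbol delta s -
    - D^-1 * \int[mu]_t (`|t| `^ alpha * spline_kernel delta t) * s =
    D^-1 * \int[mu]_t ((expR (- (`|t| `^ alpha * s)) - 1) * spline_kernel delta t +
       s * (`|t| `^ alpha * spline_kernel delta t)).
  by rewrite RintegralD// RintegralZl// /spline_symbol; ring.
rewrite normrM gtr0_norm ?invr_gt0// -mulrA ler_wpM2l//.
  by rewrite invr_ge0 ltW.
have i3 : mu.-integrable setT (EFin \o (fun t =>
    (expR (- (`|t| `^ alpha * s)) - 1) * spline_kernel delta t +
    s * (`|t| `^ alpha * spline_kernel delta t))).
  exact: integrableD i1 i2s.
have i4 : mu.-integrable setT (EFin \o (fun t : R => B * s `^ p * (1 + t ^+ 2)^-1)).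
  apply: integrable_mull; exact: integrable_oneDsqrV.
apply: (le_trans (le_normr_Rintegral measurableT i3)).
rewrite mulrAC -RintegralZl//; last exact: integrable_oneDsqrV.
apply: le_Rintegral => //; first exact: integrable_norm i3.
move=> t _; have t2 := sqr_ge0 t.
have -> : (expR (- (`|t| `^ alpha * s)) - 1) * spline_kernel delta t +
  s * (`|t| `^ alpha * spline_kernel delta t) =
  (expR (- (`|t| `^ alpha * s)) - 1 + `|t| `^ alpha * s) * spline_kernel delta t by ring.
have y0 : 0 <= `|t| `^ alpha * s by rewrite mulr_ge0// powR_ge0.
rewrite normrM; apply: (@le_trans _ _ ((1 + t ^+ 2) * s `^ p * (B * ((1 + t ^+ 2) ^+ 2)^-1))).
  apply: ler_pM => //; apply: (le_trans (expR_linearization y0)).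
  by rewrite powRM ?powR_ge0// -powRrM ler_wpM2r ?powR_ge0.
rewrite le_eqVlt; apply/orP; left; apply/eqP; field.
by apply: lt0r_neq0; lra.
Qed.

(** The step vanishes on [-1, 1] and equals 1 beyond [1 + 3 * delta], so it lies between the
    indicators of the two thresholds. *)
Lemma tail_spline delta V s u : 0 < delta -> stable_law V s -> 0 < u ->
  tail V (u * (1 + 3 * delta)) <=
    (6 * delta ^+ 3 * cube_const)^-1 * spline_symbol delta (s / u `^ alpha) <= tail V u.
Proof.
move=> d0 VS u0; have [mV s0 _ _] := VS.
set D := 6 * delta ^+ 3 * cube_const.
have D0 : 0 < D by rewrite !mulr_gt0// ?exprn_gt0// cube_const_gt0.
rewrite -(expectation_spline_step d0 VS u0) -/D mulKf ?gt_eqF//.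
have mh : measurable_fun setT (fun w => spline_step delta (V w / u)).
  apply: measurableT_comp; first exact: measurable_spline_step.
  exact: measurable_funM.
have ih : P.-integrable setT (EFin \o (fun w => spline_step delta (V w / u))).
  apply: (@bounded_integrable _ _ _ P _ 1) => // w.
  by have /andP[h0 h1] := spline_step_itv d0 (V w / u); rewrite ger0_norm.
have mt v := measurable_tail v mV.
rewrite /tail -!(Rintegral_indic P)//.
have nVu w : `|V w / u| = `|V w| / u by rewrite normrM normfV (gtr0_norm u0).
apply/andP; split; apply: le_Rintegral => //; try exact: indic_integrable.
- move=> w _; rewrite indicE; have /andP[h0 h1] := spline_step_itv d0 (V w / u).
  case: (boolP (w \in _)) => //=; rewrite inE/= => uV.
  by rewrite spline_step_eq1// nVu ler_pdivlMr// mulrC ltW.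
- move=> w _; rewrite indicE; have /andP[h0 h1] := spline_step_itv d0 (V w / u).
  case: (boolP (w \in _)) => //=; rewrite notin_setE/= => /negP; rewrite -leNgt => uV.
  by rewrite spline_step_eq0// nVu ler_pdivrMr// mul1r.
Qed.

Lemma tail_le1 V u : measurable_fun setT V -> tail V u <= 1.
Proof. by move=> mV; apply: fine_probability_le1; exact: measurable_tail. Qed.

Lemma tail_ge0 V u : 0 <= tail V u.
Proof. exact: fine_probability_ge0. Qed.

Lemma tail_bounds delta : 0 < delta -> exists2 c, 0 <= c &
  forall V s u, stable_law V s -> 0 < u -> let y := s / u `^ alpha in
    tail V (u * (1 + 3 * delta)) <= spline_slope delta * y + c * y `^ p /\
    spline_slope delta * y - c * y `^ p <= tail V u.
Proof.
move=> d0; have [c c0 Hc] := spline_symbol_asymptotics d0.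
exists c => // V s u VS u0 y; have [mV s0 _ _] := VS.
have y0 : 0 <= y by rewrite divr_ge0// powR_ge0.
have := tail_spline d0 VS u0; rewrite -/y.
have := Hc y y0; rewrite ler_norml; lra.
Qed.

Lemma tail_upper : exists2 C, 0 < C & forall V s u,
  stable_law V s -> 0 < u -> tail V u <= C * (s / u `^ alpha).
Proof.
have [c c0 Hc] := tail_bounds (ltr01 : 0 < 1 :> R).
(* For [delta = 1] the two thresholds differ by the factor 4, so the bound is taken at [u / 4].
   Where [1 <= y] the bound exceeds 1 and is trivial; elsewhere [y ^ p <= y]. *)
exists ((`|spline_slope 1| + c + 1) * 4 `^ alpha).
  by rewrite mulr_gt0 ?powR_gt0//; have := normr_ge0 (spline_slope 1); lra.
move=> V s u VS u0; have [mV s0 _ _] := VS.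
have v0 : 0 < u / 4 by rewrite divr_gt0.
have := (Hc V s _ VS v0).1; rewrite (_ : u / 4 * (1 + 3 * 1) = u); last by field.
have -> : s / (u / 4) `^ alpha = 4 `^ alpha * (s / u `^ alpha).
  rewrite (powRM _ (ltW u0)) ?invr_ge0// -[4^-1]powR_inv1// -powRrM mulN1r powRN.
  by field; rewrite !gt_eqF ?powR_gt0.
set y := 4 `^ alpha * _; set L := spline_slope 1 => ty.
rewrite -[leRHS]mulrA -/y.
have y0 : 0 <= y by rewrite mulr_ge0 ?powR_ge0// divr_ge0// powR_ge0.
have [y1|/ltW y1] := leP 1 y.
  apply: (le_trans (tail_le1 _ mV)).
  have : 0 <= (`|L| + c) * y by rewrite mulr_ge0// addr_ge0.
  by clearbody y; move: `|L| => l h; lra.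
have yp : y `^ p <= y.
  have [->|yn0] := eqVneq y 0.
    by rewrite powR0// gt_eqF// (lt_trans ltr01 p_gt1).
  by apply: ge1r_powR; [rewrite y1 andbT lt_neqAle eq_sym yn0|exact: ltW p_gt1].
apply: (le_trans ty); have cyp : c * y `^ p <= c * y by rewrite ler_wpM2l.
have ny : L * y <= `|L| * y by rewrite ler_wpM2r// ler_norm.
clearbody y L; move: `|L| ny (y `^ p) yp cyp ty => l ny z yp cyp ty; lra.
Qed.

Let q : R := p - 1.

Let q_gt0 : 0 < q. Proof. by rewrite subr_gt0 p_gt1. Qed.

Let powR_p y : 0 <= y -> y `^ p = y * y `^ q.
Proof. by move=> y0; rewrite mulr_powRB1// (lt_trans ltr01 p_gt1). Qed.

Let small_pow e c : 0 < e -> 0 <= c -> exists2 y0, 0 < y0 &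
  forall y, 0 <= y -> y <= y0 -> c * y `^ q <= e.
Proof.
move=> e0 c0; have c1 : 0 < c + 1 by lra.
exists ((e / (c + 1)) `^ q^-1); first by rewrite powR_gt0// divr_gt0.
move=> y y0 yy; have : y `^ q <= ((e / (c + 1)) `^ q^-1) `^ q.
  by apply: ge0_ler_powR; rewrite ?nnegrE ?powR_ge0//; exact: ltW.
rewrite -powRrM mulVf ?gt_eqF ?q_gt0// powRr1; last by rewrite ltW// divr_gt0.
move=> h; apply: (le_trans (ler_wpM2l c0 h)).
rewrite mulrA ler_pdivrMr// mulrC ler_wpM2l//; first exact: ltW.
lra.
Qed.

Let scale_surj s y : 0 < s -> 0 < y -> exists2 u, 0 < u & s / u `^ alpha = y.
Proof.
move=> s0 y0; exists ((s / y) `^ alpha^-1); first by rewrite powR_gt0// divr_gt0.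
rewrite -powRrM mulVf ?gt_eqF ?alpha0// powRr1; last by rewrite ltW// divr_gt0.
by field; rewrite !gt_eqF.
Qed.

Let scale_mul s u k : 0 < u -> 0 < k -> 
  s / u `^ alpha = k `^ alpha * (s / (u * k) `^ alpha).
Proof.
move=> u0 k0; rewrite (powRM _ (ltW u0) (ltW k0)).
by field; rewrite !gt_eqF ?powR_gt0.
Qed.

Section Reference.
Variables (V0 : T -> R) (s0 : R).
Hypotheses (V0S : stable_law V0 s0) (s0_gt0 : 0 < s0).

(** An inequality between integrals of kernels, proved through a random variable: the lower bound
    for [d1] and the upper bound for [d2] concern the same tail of [V0], and since [0 < s0] the
    ratio [s0 / u ^ alpha] takes arbitrarily small positive values, at which the error terms are
    negligible. *)
Let slope_le d1 d2 : 0 < d1 -> 0 < d2 ->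
  spline_slope d1 <= (1 + 3 * d2) `^ alpha * spline_slope d2.
Proof.
move=> d10 d20.
have [c1 c10 H1] := tail_bounds d10; have [c2 c20 H2] := tail_bounds d20.
have k0 : 0 < 1 + 3 * d2 by lra.
set k := (1 + 3 * d2) `^ alpha; have kp : 0 < k by rewrite powR_gt0.
rewrite leNgt; apply/negP => lt12.
set A := spline_slope d1 in lt12; set B := spline_slope d2 in lt12.
have c0 : 0 <= c2 * k `^ p + c1 by rewrite addr_ge0// mulr_ge0// powR_ge0.
have e0 : 0 < (A - k * B) / 2 by rewrite divr_gt0// subr_gt0.
have [y y0 Hy] := small_pow e0 c0.
have {}Hy := Hy y (ltW y0) (lexx _).
have ky0 : 0 < k * y by rewrite mulr_gt0.
have [u u0 uE] := scale_surj s0_gt0 ky0.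
have uk0 : 0 < u * (1 + 3 * d2) by rewrite mulr_gt0.
have := (H2 _ _ _ V0S u0).1; have := (H1 _ _ _ V0S uk0).2.
have -> : s0 / (u * (1 + 3 * d2)) `^ alpha = y.
  by have := scale_mul s0 u0 k0; rewrite uE -/k => /(mulfI (lt0r_neq0 kp)).
rewrite uE -/A -/B (powRM _ (ltW kp) (ltW y0)) (powR_p (ltW y0)) => h1 h2.
have : A * y - c1 * (y * y `^ q) <= B * (k * y) + c2 * (k `^ p * (y * y `^ q)).
  exact: le_trans h1 h2.
move: Hy; set z := y `^ q; set kk := k `^ p => Hy h.
have := ler_wpM2l (ltW y0) Hy.
have : 0 < y * ((A - k * B) / 2) by rewrite mulr_gt0.
move: h; lra.
Qed.

(** The constant is the supremum of the slopes. The threshold [y0] depends on [e] alone: the later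
    arrays involve stable variables of arbitrary number and scales, to which the estimate applies
    simultaneously. *)
Lemma tail_asymptotics : exists2 C, 0 < C & forall e, 0 < e ->
  exists2 y0, 0 < y0 & forall V s u, stable_law V s -> 0 < u ->
    s / u `^ alpha <= y0 ->
    `|tail V u - C * (s / u `^ alpha)| <= e * (s / u `^ alpha).
Proof.
pose S := [set spline_slope delta | delta in [set delta | 0 < delta]].
have S1 : S (spline_slope 1) by exists 1 => //=; exact: ltr01.
have ubS : ubound S ((1 + 3 * 1) `^ alpha * spline_slope 1).
  by move=> _ [delta /= d0 <-]; exact: slope_le.
have hS : has_sup S by split; [exists (spline_slope 1)|exists ((1 + 3 * 1) `^ alpha * spline_slope 1)].
pose C := sup S.
have lbC delta : 0 < delta -> spline_slope delta <= C.
  by move=> d0; apply: (ub_le_sup hS.2); exists delta.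
have ubC delta : 0 < delta -> C <= (1 + 3 * delta) `^ alpha * spline_slope delta.
  by move=> d0; apply: ge_sup; [exists (spline_slope 1)|move=> _ [d' /= d'0 <-]; exact: slope_le].
have C_ge0 : 0 <= C.
  have [c c0 Hc] := tail_bounds (ltr01 : 0 < 1 :> R).
  rewrite leNgt; apply/negP => Cn.
  have e0 : 0 < - C / 2 by rewrite divr_gt0// oppr_gt0.
  have [y y0 Hy] := small_pow e0 c0; have {}Hy := Hy y (ltW y0) (lexx _).
  have [u u0 uE] := scale_surj s0_gt0 y0.
  have := (Hc _ _ _ V0S u0).1; rewrite uE.
  have := tail_ge0 V0 (u * (1 + 3 * 1)).
  have := lbC 1 ltr01; have := ler_wpM2l (ltW y0) Hy.
  have : 0 < y * (- C / 2) by rewrite mulr_gt0.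
  rewrite (powR_p (ltW y0)) => a b c' d' f'.
  have := ler_wpM2r (ltW y0) c'.
  lra.
have asym e : 0 < e -> exists2 y0, 0 < y0 & forall V s u, stable_law V s -> 0 < u ->
    s / u `^ alpha <= y0 ->
    `|tail V u - C * (s / u `^ alpha)| <= e * (s / u `^ alpha).
  (* As [alpha < 2] and [delta <= 1], [(1 + 3 * delta) ^ alpha <= 1 + 15 * delta]; the 30 then makes
     [(k - 1) * C] at most [e / 2]. *)
  move=> e0; pose delta := Num.min 1 (e / (30 * (C + 1))).
  have d0 : 0 < delta by rewrite /delta lt_min ltr01/= divr_gt0//; lra.
  have d1 : delta <= 1 by rewrite /delta ge_min lexx.
  have de : delta * (30 * (C + 1)) <= e.
    by rewrite -ler_pdivlMr; [rewrite /delta ge_min lexx orbT|lra].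
  pose k := (1 + 3 * delta) `^ alpha.
  have k1 : 1 <= k.
    rewrite -[1](powRr0 (1 + 3 * delta)); apply: ler_powR; [lra|exact: ltW alpha0].
  have k2 : k <= 1 + 15 * delta.
    apply: (@le_trans _ _ ((1 + 3 * delta) `^ 2%:R)).
      by apply: ler_powR; [lra|exact: ltW alpha2].
    rewrite powR_mulrn; last lra.
    have : delta ^+ 2 <= delta by rewrite expr2 ler_piMl// ltW.
    lra.
  have kC : (k - 1) * C <= e / 2.
    have : (k - 1) * C <= 15 * delta * C by rewrite ler_wpM2r//; lra.
    lra.
  have [c c0 Hc] := tail_bounds d0.
  have ck0 : 0 <= c * k `^ p + c by rewrite addr_ge0// mulr_ge0// powR_ge0.
  have e20 : 0 < e / 2 by rewrite divr_gt0.
  have [y1 y10 Hy] := small_pow e20 ck0; exists y1 => // V s u VS u0 yy.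
  have [mV sge0 _ _] := VS.
  set y := s / u `^ alpha in yy *.
  have y0 : 0 <= y by rewrite divr_ge0// powR_ge0.
  have {}Hy := Hy y y0 yy.
  have kd0 : 0 < 1 + 3 * delta by lra.
  have v0 : 0 < u / (1 + 3 * delta) by rewrite divr_gt0.
  have := (Hc _ _ _ VS v0).1; have := (Hc _ _ _ VS u0).2; rewrite -/y.
  rewrite (scale_mul s v0 kd0) divfK ?gt_eqF// -/y -/k.
  rewrite (powRM _ (le_trans ler01 k1) y0) !(powR_p y0).
  set L := spline_slope delta; set t := tail V u.
  have L1 : L <= C := lbC _ d0; have L2 : C <= k * L := ubC _ d0.
  move: Hy; set z := y `^ q; have z0 : 0 <= z by exact: powR_ge0.
  have kp0 : 0 <= k `^ p by exact: powR_ge0.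
  set kp := k `^ p in ck0 kp0 *.
  move=> Hy hl hu.
  have Hy2 := ler_wpM2l y0 Hy.
  have a1 : 0 <= c * kp * (y * z) by apply: mulr_ge0; exact: mulr_ge0.
  have a2 : 0 <= c * (y * z) by do 2 (apply: mulr_ge0 => //).
  have b1 : (k - 1) * C * y <= e / 2 * y by rewrite ler_wpM2r.
  have b2 : k * L * y <= k * C * y.
    by rewrite ler_wpM2r// ler_wpM2l//; lra.
  have b3 : (C - L) * y <= (k - 1) * C * y.
    rewrite ler_wpM2r//; have : (k - 1) * L <= (k - 1) * C by rewrite ler_wpM2l//; lra.
    lra.
  by rewrite ler_norml; apply/andP; split; lra.
(* If the constant were 0, tails would be o(y). But the mean of 3 - 4 cos x + cos 2x at x = V0 / u
   is about [(4 - 2 ^ alpha) * y], positive since [alpha < 2]. This function is O(x^4), hence small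
   against 1 - cos x near 0, so the mean can only come from the tail. *)
exists C => //; rewrite lt_neqAle C_ge0 andbT; apply/negP => /eqP C0.
pose g : R := 4 - 2 `^ alpha.
have two2 : 2 `^ alpha < 4.
  rewrite (_ : 4 = 2 `^ 2%:R); last by rewrite powR_mulrn//; lra.
  rewrite !/powR ifF ?gt_eqF// ltr_expR ltr_pM2r ?alpha2// ln_gt0//; lra.
have two1 : 1 <= 2 `^ alpha.
  by rewrite -[leLHS](powRr0 2); apply: ler_powR; [lra|exact: ltW alpha0].
have g0 : 0 < g by rewrite /g; lra.
have g3 : g <= 3 by rewrite /g; lra.
(* Where [|x| <= rho], the mixture is at most [rho ^+ 2 * (1 - cos x)], whose mean is at most
   [g / 4 * y]. *)
pose rho := Num.sqrt (g / 4).
have rho2 : rho ^+ 2 = g / 4 by rewrite sqr_sqrtr// divr_ge0// ltW.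
have rho0 : 0 < rho by rewrite sqrtr_gt0 divr_gt0.
have rho1 : rho <= 1.
  by rewrite -(@ler_pXn2r _ 2)// ?nnegrE//; [rewrite rho2 expr1n; lra|exact: ltW].
pose r := rho `^ alpha; have r0 : 0 < r by rewrite powR_gt0.
have e0 : 0 < g * r / 32 by rewrite divr_gt0// mulr_gt0.
have [y1 y10 Hy] := asym _ e0.
pose y := Num.min (y1 * r) (g / 16).
have y0 : 0 < y by rewrite /y lt_min !(mulr_gt0, divr_gt0).
have [u u0 uE] := scale_surj s0_gt0 y0.
have [mV0 _ V0cos _] := V0S.
have ur0 : 0 < u * rho by rewrite mulr_gt0.
have yr : s0 / (u * rho) `^ alpha = y / r.
  have := scale_mul s0 u0 rho0; rewrite uE -/r => ->.
  by rewrite mulrAC divff ?mul1r// gt_eqF.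
have := Hy _ _ _ V0S ur0; rewrite yr -C0 mul0r subr0.
rewrite ler_pdivrMr// {1}/y ge_min lexx => /(_ isT).
rewrite ger0_norm ?tail_ge0// (_ : g * r / 32 * (y / r) = g / 32 * y); last first.
  by field; rewrite gt_eqF.
move=> tle.
have c1 : \int[P]_w cos (u^-1 * V0 w) = expR (- y).
  rewrite V0cos normfV (gtr0_norm u0) -[u^-1]powR_inv1 ?ltW// -powRrM mulN1r powRN.
  by rewrite mulrC uE.
have c2 : \int[P]_w cos (2 * u^-1 * V0 w) = expR (- (2 `^ alpha * y)).
  rewrite V0cos normrM normfV (gtr0_norm u0) ger0_norm// powRM ?invr_ge0 ?ltW//.
  by rewrite -[u^-1]powR_inv1 ?ltW// -powRrM mulN1r powRN -mulrA [_^-1 * _]mulrC uE.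
have i1 := cos_int u^-1 mV0; have i2 := cos_int (2 * u^-1) mV0.
have mt := measurable_tail (u * rho) mV0.
pose A := [set w | u * rho < `|V0 w|].
have iA := @indic_integrable _ _ _ P A mt.
have i1b : P.-integrable setT (EFin \o (fun=> 1 : R)).
  by apply: (@bounded_integrable _ _ _ P _ 1) => // w; rewrite normr1.
have i3b : P.-integrable setT (EFin \o (fun=> 3 : R)).
  by apply: (@bounded_integrable _ _ _ P _ 3) => // w; rewrite ger0_norm.
have i4 := integrable_mull (-4) i1.
have i8 := integrable_mull 8 iA.
have ib : P.-integrable setT (EFin \o (fun w => 1 - cos (u^-1 * V0 w))).
  exact: integrableB i1b i1.
have ir := integrable_mull (rho ^+ 2) ib.
have i34 : P.-integrable setT (EFin \o (fun w => 3 + -4 * cos (u^-1 * V0 w))).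
  exact: integrableD i3b i4.
have ile : P.-integrable setT (EFin \o (fun w =>
    3 + -4 * cos (u^-1 * V0 w) + cos (2 * u^-1 * V0 w))).
  exact: integrableD i34 i2.
have ire : P.-integrable setT (EFin \o (fun w =>
    8 * \1_A w + rho ^+ 2 * (1 - cos (u^-1 * V0 w)))).
  exact: integrableD i8 ir.
have : \int[P]_w (3 + -4 * cos (u^-1 * V0 w) + cos (2 * u^-1 * V0 w)) <=
    \int[P]_w (8 * \1_A w + rho ^+ 2 * (1 - cos (u^-1 * V0 w))).
  apply: le_Rintegral => // w _; set x := u^-1 * V0 w.
  have -> : 2 * u^-1 * V0 w = x *+ 2 by rewrite -mulrA -/x mulr_natl.
  rewrite cos_mulr2n -[_ ^+ 2 *+ 2]mulr_natl.
  have := cos_geN1 x; have := cos_le1 x; have := cos_ge x.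
  rewrite indicE; case: (boolP (w \in A)) => /= [_|].
    move: (cos x) => cx a b c.
    by apply: cos_mixture_le8 => //; exact: sqr_ge0.
  rewrite notin_setE/= => /negP; rewrite -leNgt => Vu.
  have xr : x ^+ 2 <= rho ^+ 2.
    rewrite -real_normK ?num_real// ler_pXn2r ?nnegrE//; last exact: ltW.
    by rewrite /x normrM normfV (gtr0_norm u0) [leLHS]mulrC ler_pdivrMr// mulrC.
  move: (cos x) (x ^+ 2) xr => cx x2 xr a b c.
  by rewrite mulr0 add0r; exact: cos_mixture_le b a xr.
rewrite RintegralD// RintegralD// RintegralZl// c1 c2 Rintegral_one.
rewrite RintegralD// !RintegralZl// RintegralB// c1 Rintegral_one Rintegral_indic//.
rewrite -/(tail V0 (u * rho)) rho2.
have := expRN_le_quadratic (ltW y0); have := expRN_ge1B y.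
have := expRN_ge1B (2 `^ alpha * y).
have yg : y <= g / 16 by rewrite /y ge_min lexx orbT.
move: tle; set t := tail _ _; set b := 2 `^ alpha in two1 two2 *.
move=> tle h1 h2 h3 h4.
have gE : b = 4 - g by rewrite /g -/b opprB addrC subrK.
clearbody b g t; subst b.
by apply: (@laplace_gap_contra _ g y t (expR (- y)) (expR (- ((4 - g) * y)))) => //; lra.
Qed.

End Reference.
End StableTail.

(** * Maxima of sums of independent stable variables *)

(* Layer-cake: [g (X w)] is the length of the section at [w] of the region
   [0 <= t < g (X w)], so Tonelli reduces integrals of [g \o X] to integrals of
   indicators of [X]. *)
Lemma layer_cake d1 d2 (T1 : measurableType d1) (T2 : measurableType d2) (R : realType)
    (m : {sigma_finite_measure set T1 -> \bar R}) (U : T1 -> R) (X : T1 -> T2) (g : T2 -> R) :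
  measurable_fun setT U -> measurable_fun setT X -> measurable_fun setT g ->
  (forall w, 0 <= U w) -> (forall x, 0 <= g x) ->
  (\int[m]_w (U w * g (X w))%:E = \int[@lebesgue_measure R]_t
     \int[m]_w (U w * \1_[set x | (0 <= t < g x)%R] (X w))%:E)%E.
Proof.
move=> mU mX mg U0 g0.
pose D := [set z : T1 * R | 0 <= z.2 < g (X z.1)].
have mfst : measurable_fun setT (fst : T1 * R -> T1) := measurable_fst.
have msnd : measurable_fun setT (snd : T1 * R -> R) := measurable_snd.
have mgX : measurable_fun setT (fun z : T1 * R => g (X z.1)).
  by apply: (measurableT_comp mg); apply: (measurableT_comp mX).
have mD : measurable D.
  have m1 : measurable_fun setT (fun z : T1 * R => 0 <= z.2).
    exact: measurable_fun_ler.
  have m2 : measurable_fun setT (fun z : T1 * R => z.2 < g (X z.1)).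
    exact: measurable_fun_ltr.
  have := measurable_and m1 m2 => /(_ measurableT [set true]).
  rewrite setTI => h; rewrite (_ : D = (fun x : T1 * R => (0 <= x.2) && (x.2 < g (X x.1))) @^-1` [set true]).
    exact: h.
  by apply/seteqP; split.
have mI : measurable_fun setT (\1_D : T1 * R -> R) by exact: measurable_indic.
have mF : measurable_fun setT (fun z : T1 * R => (U z.1 * \1_D z)%:E).
  by apply/measurable_EFinP; apply: measurable_funM => //; exact: measurableT_comp.
transitivity (\int[@lebesgue_measure R]_t \int[m]_w (U w * \1_D (w, t))%:E)%E; last first.
  by apply: eq_integral => t _; apply: eq_integral => w _; congr (_ * _)%:E.
rewrite -(fubini_tonelli (m1 := m) (m2 := @lebesgue_measure R) _ mF); last first.
  by move=> z; rewrite lee_fin mulr_ge0.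
apply: eq_integral => w _ /=.
have mIw : measurable_fun setT (fun t => \1_D (w, t) : R).
  by apply: (measurableT_comp mI); exact: pair1_measurable.
under eq_integral do rewrite EFinM.
rewrite ge0_integralZl//; [|exact/measurable_EFinP|by rewrite lee_fin].
rewrite EFinM; congr (_ * _)%E.
rewrite (_ : (fun t => (\1_D (w, t))%:E) = (fun t => (\1_(`[0, g (X w)[ : set R) t)%:E)).
  rewrite integral_indic//= setIT lebesgue_measure_itv/= lte_fin.
  case: ifPn => [_|]; first by rewrite -EFinD subr0.
  by rewrite -leNgt => h; congr EFin; apply/le_anti; rewrite h g0.
by apply/funext => t; congr EFin; rewrite !indicE; congr (nat_of_bool _)%:R.
Qed.

Lemma measurable_layer d (T : measurableType d) (R : realType) (g : T -> R) (t : R) :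
  measurable_fun setT g -> measurable [set x | 0 <= t < g x].
Proof.
move=> mg; have : measurable_fun setT (fun x => t < g x) by exact: measurable_fun_ltr.
move=> /(_ measurableT [set true]); rewrite setTI => /(_ _) h.
case: (leP 0 t) => t0; last first.
  by rewrite (_ : [set _ | _] = set0)//; apply/seteqP; split.
rewrite (_ : [set _ | _] = (fun x => t < g x) @^-1` [set true]); first exact: h.
by apply/seteqP; split.
Qed.

(** Agreement on indicators passes to nonnegative functions through their level sets. It is applied
    twice: to replace an indicator by a function in a product of independent factors, and to change
    variables along the action. *)
Lemma eq_weighted_integral d1 d2 d3 (T1 : measurableType d1) (T2 : measurableType d2)
    (T3 : measurableType d3) (R : realType) (m1 : {sigma_finite_measure set T1 -> \bar R})
    (m2 : {sigma_finite_measure set T2 -> \bar R}) (U1 : T1 -> R) (U2 : T2 -> R)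
    (X1 : T1 -> T3) (X2 : T2 -> T3) (g : T3 -> R) :
  measurable_fun setT U1 -> measurable_fun setT U2 -> measurable_fun setT X1 ->
  measurable_fun setT X2 -> measurable_fun setT g -> (forall w, 0 <= U1 w) ->
  (forall w, 0 <= U2 w) -> (forall x, 0 <= g x) ->
  (forall B : set T3, measurable B -> (\int[m1]_w (U1 w * \1_B (X1 w))%:E =
     \int[m2]_w (U2 w * \1_B (X2 w))%:E)%E) ->
  (\int[m1]_w (U1 w * g (X1 w))%:E = \int[m2]_w (U2 w * g (X2 w))%:E)%E.
Proof.
move=> mU1 mU2 mX1 mX2 mg U10 U20 g0 H.
rewrite !layer_cake//; apply: eq_integral => t _.
by apply: H; exact: measurable_layer.
Qed.

(** * Expectations of products of independent variables *)

Section Independence.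
Context {R : realType} {d : measure_display} {T : measurableType d}.
Variable P : probability T R.
Local Notation mu := (@lebesgue_measure R).

Lemma Rintegral_EFin (f : T -> R) : P.-integrable setT (EFin \o f) ->
  (\int[P]_w f w)%:E = (\int[P]_w (f w)%:E)%E.
Proof. by move=> fi; rewrite fineK//; exact: integrable_fin_num fi. Qed.

Definition mutually_independent (k : nat) (V : 'I_k -> T -> R) : Prop :=
  forall B : 'I_k -> set R, (forall i, measurable (B i)) ->
  P (\bigcap_(i in [set: 'I_k]) (V i @^-1` B i)) =
  (\prod_(i < k) P (V i @^-1` B i))%E.

Lemma measurable_prod_fun (I : Type) (r : seq I) (Q : pred I) (f : I -> T -> R) :
  (forall i, measurable_fun setT (f i)) ->
  measurable_fun setT (fun w => \prod_(i <- r | Q i) f i w).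
Proof.
move=> mf; elim: r => [|i r IH].
  under eq_fun do rewrite big_nil; exact: measurable_cst.
under eq_fun do rewrite big_cons.
by case: (Q i) => //; exact: measurable_funM.
Qed.

Variables (k : nat) (V : 'I_k -> T -> R).
Hypothesis mV : forall i, measurable_fun setT (V i).
Hypothesis Vind : mutually_independent V.

Let mpre i (B : set R) : measurable B -> measurable (V i @^-1` B).
Proof. by move=> mB; rewrite -[X in measurable X]setTI; exact: mV. Qed.

Lemma mutually_independent_fine (B : 'I_k -> set R) : (forall i, measurable (B i)) ->
  fine (P (\bigcap_(i in [set: 'I_k]) (V i @^-1` B i))) =
  \prod_(i < k) fine (P (V i @^-1` B i)).
Proof.
move=> mB; rewrite Vind//.
rewrite -[RHS]/(fine (\prod_(i < k) fine (P (V i @^-1` B i)))%:E); congr fine.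
rewrite (big_morph EFin EFinM erefl); apply: eq_bigr => i _.
by rewrite EFin_fine_probability//; exact: mpre.
Qed.

Section ProductExpectation.
Variables (g : 'I_k -> R -> R) (b : R).
Hypotheses (mg : forall i, measurable_fun setT (g i)) (b1 : 1 <= b).
Hypothesis gb : forall i x, 0 <= g i x <= b.

(** A hybrid between the definition of independence and the product formula: the first [j] factors
    are already functions, the others are still indicators. *)
Let h (B : 'I_k -> set R) (j : nat) (i : 'I_k) (x : R) : R :=
  if (i < j)%N then g i x else \1_(B i) x.

Let hb B j i x : 0 <= h B j i x <= b.
Proof.
rewrite /h; case: ifP => // _; rewrite indicE.
by case: (_ \in _); rewrite ?ler01 ?lexx//= (le_trans ler01).
Qed.

Let mh B j i : measurable (B i) -> measurable_fun setT (h B j i).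
Proof.
move=> mB; rewrite /h; case: (i < j)%N; first exact: mg.
exact: measurable_indic.
Qed.

Let hV_int B j i : measurable (B i) ->
  P.-integrable setT (EFin \o (fun w => h B j i (V i w))).
Proof.
move=> mB; apply: (@bounded_integrable _ _ _ P _ b).
  by apply: (measurableT_comp (mh j mB)).
by move=> w; have /andP[h0 h1] := hb B j i (V i w); rewrite ger0_norm.
Qed.

Let prod_int B j (Q : pred 'I_k) : (forall i, measurable (B i)) ->
  P.-integrable setT (EFin \o (fun w => \prod_(i < k | Q i) h B j i (V i w))).
Proof.
move=> mB; apply: (@bounded_integrable _ _ _ P _ (\prod_(i < k | Q i) b)).
  by apply: measurable_prod_fun => i; apply: (measurableT_comp (mh j (mB i))).
move=> w; rewrite ger0_norm; last first.
  by apply: prodr_ge0 => i _; case/andP: (hb B j i (V i w)).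
by apply: ler_prod => i _; exact: hb.
Qed.

(** Induction on the number of indicators already replaced. [B] stays quantified inside, because the
    step lets the set at coordinate [oj] vary in order to compare two weighted laws of [V oj]. *)
Let Rintegral_prod_hyb j : (j <= k)%N -> forall B, (forall i, measurable (B i)) ->
  \int[P]_w \prod_(i < k) h B j i (V i w) =
  \prod_(i < k) \int[P]_w h B j i (V i w).
Proof.
elim: j => [_ B mB|j IH jk B mB].
  rewrite /h/=.
  rewrite (@eq_Rintegral _ _ _ _ _ (\1_(\bigcap_(i in [set: 'I_k]) (V i @^-1` B i)))); last first.
    move=> w _; rewrite indicE; case: (boolP (w \in _)) => [|].
      rewrite inE => wB; rewrite big1// => i _; rewrite indicE mem_set//.
      exact: wB.
    rewrite notin_setE => /existsNP[i /not_implyP[_ wB]].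
    by rewrite (bigD1 i)//= indicE memNset// mul0r.
  rewrite Rintegral_indic; last first.
    rewrite bigcap_mkcond; apply: fin_bigcap_measurable => // i _.
    by rewrite mem_set//; exact: mpre.
  rewrite mutually_independent_fine//; apply: eq_bigr => i _.
  rewrite -Rintegral_indic; last exact: mpre.
  by apply: eq_Rintegral => w _; rewrite !indicE.
pose oj := Ordinal jk.
have jE i : i != oj -> h B j.+1 i =1 h B j i.
  move=> ij x; rewrite /h ltnS leq_eqVlt; case: eqP => //= e.
  by case/eqP: ij; apply: val_inj.
pose U w := \prod_(i < k | i != oj) h B j i (V i w).
pose c := \prod_(i < k | i != oj) \int[P]_w h B j i (V i w).
have U0 w : 0 <= U w.
  by apply: prodr_ge0 => i _; case/andP: (hb B j i (V i w)).
have c0 : 0 <= c.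
  apply: prodr_ge0 => i _; apply: Rintegral_ge0 => w _.
  by case/andP: (hb B j i (V i w)).
have mU : measurable_fun setT U.
  by apply: measurable_prod_fun => i; apply: (measurableT_comp (mh j (mB i))).
have gVint : P.-integrable setT (EFin \o (fun w => g oj (V oj w))).
  apply: (@bounded_integrable _ _ _ P _ b); first exact: (measurableT_comp (mg oj)).
  by move=> w; have /andP[h0 h1] := gb oj (V oj w); rewrite ger0_norm.
have H (C : set R) : measurable C -> (\int[P]_w (U w * \1_C (V oj w))%:E =
     \int[P]_w (cst c w * \1_C (V oj w))%:E)%E.
  move=> mC; pose B' i := if i == oj then C else B i.
  have mB' i : measurable (B' i) by rewrite /B'; case: ifP.
  have hE i x : i != oj -> h B' j i x = h B j i x.
    by move=> ij; rewrite /h /B' (negbTE ij).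
  have hoj x : h B' j oj x = \1_C x by rewrite /h /B' eqxx ltnn.
  have := IH (ltnW jk) B' mB'.
  rewrite [RHS](bigD1 oj)//=.
  under [X in _ = _ * X]eq_bigr => i ij.
    under eq_Rintegral do rewrite hE//.
    over.
  rewrite -/c.
  under [X in _ = X * _]eq_Rintegral do rewrite hoj.
  have e1 : (fun w => \prod_(i < k) h B' j i (V i w)) = (fun w => U w * \1_C (V oj w)).
    apply/funext => w; rewrite (bigD1 oj)//= hoj mulrC; congr (_ * _).
    by apply: eq_bigr => i ij; exact: hE.
  have iC : P.-integrable setT (EFin \o (fun w => \1_C (V oj w) : R)).
    have := hV_int j (mB' oj); congr (P.-integrable _ (EFin \o _)).
    by apply/funext => w; exact: hoj.
  have iU : P.-integrable setT (EFin \o (fun w => U w * \1_C (V oj w))).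
    by rewrite -e1; exact: prod_int.
  rewrite e1 mulrC -RintegralZl// => e.
  have := congr1 EFin e; rewrite !Rintegral_EFin//.
  exact: integrable_mull.
have := eq_weighted_integral (m1 := P) (m2 := P) mU (measurable_cst c) (mV oj) (mV oj) (mg oj) U0 (fun=> c0)
  (fun x => proj1 (andP (gb oj x))) H.
have iUg : P.-integrable setT (EFin \o (fun w => U w * g oj (V oj w))).
  have := prod_int j.+1 xpredT mB; congr (P.-integrable _ (EFin \o _)).
  apply/funext => w; rewrite (bigD1 oj)//= {1}/h /= ltnSn mulrC; congr (_ * _).
  by apply: eq_bigr => i ij; exact: jE.
have icg := integrable_mull c gVint.
rewrite -(Rintegral_EFin iUg) -(Rintegral_EFin icg) => -[].
rewrite RintegralZl// => e.
transitivity (\int[P]_w (U w * g oj (V oj w))).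
  apply: eq_Rintegral => w _; rewrite (bigD1 oj)//= {1}/h /= ltnSn mulrC; congr (_ * _).
  by apply: eq_bigr => i ij; exact: jE.
rewrite e [RHS](bigD1 oj)//= mulrC; congr (_ * _).
  by apply: eq_Rintegral => w _; rewrite /h/= ltnSn.
by apply: eq_bigr => i ij; apply: eq_Rintegral => w _; rewrite jE.
Qed.

Lemma Rintegral_prod_independent :
  \int[P]_w \prod_(i < k) g i (V i w) = \prod_(i < k) \int[P]_w g i (V i w).
Proof.
have hg i x : h (fun=> setT) k i x = g i x by rewrite /h ltn_ord.
have := Rintegral_prod_hyb (leqnn k) (fun=> measurableT).
under eq_Rintegral do under eq_bigr do rewrite hg.
by under [X in _ = X]eq_bigr do under eq_Rintegral do rewrite hg.
Qed.

End ProductExpectation.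

End Independence.

Section UnionBound.
Context {R : realType} {d : measure_display} {T : measurableType d}.
Variable P : probability T R.

Lemma union_bound (I : finType) (A : I -> set T) : (forall i, measurable (A i)) ->
  fine (P (\bigcup_(i in [set: I]) A i)) <= \sum_i fine (P (A i)).
Proof.
move=> mA.
have mU (s : seq I) : measurable (\bigcup_(i in [set` s]) A i).
  by apply: fin_bigcup_measurable => // i _.
have H (s : seq I) : fine (P (\bigcup_(i in [set` s]) A i)) <= \sum_(i <- s) fine (P (A i)).
  elim: s => [|i s IH].
    by rewrite big_nil (_ : [set` [::]] = set0) ?bigcup_set0 ?measure0//; apply/seteqP; split.
  rewrite big_cons (_ : \bigcup_(i0 in _) _ = A i `|` \bigcup_(i0 in [set` s]) A i0); last first.
    apply/seteqP; split => w /=.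
      move=> [j /=]; rewrite inE => /predU1P[->|js] wA; [by left|by right; exists j].
    move=> [wA|[j js wA]]; [by exists i => //=; rewrite mem_head|].
    by exists j => //=; rewrite inE (js : j \in s) orbT.
  apply: (@le_trans _ _ (fine (P (A i)) + fine (P (\bigcup_(i0 in [set` s]) A i0)))).
    rewrite -fineD ?fin_num_measure//; apply: fine_le.
    - by apply: fin_num_measure; exact: measurableU.
    - by rewrite fin_numD !fin_num_measure.
    - exact: measureU2.
  by rewrite lerD2l.
rewrite (_ : [set: I] = [set` enum I]); last first.
  by apply/seteqP; split => i //= _; rewrite mem_enum.
by rewrite (le_trans (H _))// big_enum.
Qed.

End UnionBound.

Section MeasurabilityTools.
Context {R : realType} {d : measure_display} {T : measurableType d}.

Lemma measurable_sum_fun (I : Type) (r : seq I) (f : I -> T -> R) :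
  (forall i, measurable_fun setT (f i)) ->
  measurable_fun setT (fun w => \sum_(i <- r) f i w).
Proof.
move=> mf; elim: r => [|i r IH].
  under eq_fun do rewrite big_nil; exact: measurable_cst.
under eq_fun do rewrite big_cons.
exact: measurable_funD.
Qed.

Lemma measurable_lt_set (f : T -> R) x : measurable_fun setT f ->
  measurable [set w | x < f w].
Proof.
move=> mf; have /(_ measurableT [set true] I) :
  measurable_fun setT (fun w => x < f w) by exact: measurable_fun_ltr.
by rewrite setTI; congr measurable; apply/seteqP; split.
Qed.

End MeasurabilityTools.

Section MoreIndependence.
Context {R : realType} {d : measure_display} {T : measurableType d}.
Variables (P : probability T R) (k : nat) (V : 'I_k -> T -> R).
Hypothesis mV : forall i, measurable_fun setT (V i).
Hypothesis Vind : mutually_independent P V.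

Let mpre i (B : set R) : measurable B -> measurable (V i @^-1` B).
Proof. by move=> mB; rewrite -[X in measurable X]setTI; exact: mV. Qed.

Lemma mutually_independent_comp (g : 'I_k -> R -> R) :
  (forall i, measurable_fun setT (g i)) ->
  mutually_independent P (fun i w => g i (V i w)).
Proof.
move=> mg B mB; have := Vind (B := fun i => g i @^-1` B i); apply => i.
by rewrite -[X in measurable X]setTI; exact: mg.
Qed.

Lemma independent_pair (i j : 'I_k) (B C : set R) : i != j ->
  measurable B -> measurable C ->
  fine (P (V i @^-1` B `&` V j @^-1` C)) =
  fine (P (V i @^-1` B)) * fine (P (V j @^-1` C)).
Proof.
move=> ij mB mC.
pose D l := if l == i then B else if l == j then C else setT.
have mD l : measurable (D l) by rewrite /D; case: ifP => // _; case: ifP.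
have Di : D i = B by rewrite /D eqxx.
have Dj : D j = C by rewrite /D eq_sym (negbTE ij) eqxx.
have -> : V i @^-1` B `&` V j @^-1` C = \bigcap_(l in [set: 'I_k]) (V l @^-1` D l).
  apply/seteqP; split => w.
    move=> [wi wj] l _; rewrite /preimage/= /D; case: ifP => [/eqP -> //|_].
    by case: ifP => [/eqP -> //|].
  by move=> wD; split; [have := wD i I; rewrite Di|have := wD j I; rewrite Dj].
rewrite (mutually_independent_fine mV Vind mD) (bigD1 i)//= (bigD1 j)/=; last by rewrite eq_sym.
rewrite Di Dj big1 ?mulr1// => l /andP[li lj].
rewrite /D (negbTE li) (negbTE lj) preimage_setT.
by rewrite -[RHS]/(fine 1%:E); congr fine; exact: probability_setT.
Qed.

End MoreIndependence.

(** * Exponential moments of truncated stable variables *)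

Section TruncatedSum.
Context {R : realType} (alpha : R) {d : measure_display} {T : measurableType d}.
Variable P : probability T R.
Hypothesis halpha : 0 < alpha < 2.
Variable C1 : R.
Hypothesis C1_gt0 : 0 < C1.
Hypothesis tailC : forall V s u, stable_law alpha P V s -> 0 < u ->
  tail P V u <= C1 * (s / u `^ alpha).

Lemma stable_lawZ a V s : stable_law alpha P V s ->
  stable_law alpha P (fun w => a * V w) (s * `|a| `^ alpha).
Proof.
move=> [mV s0 Vc Vs]; split.
- exact: measurable_funM.
- by rewrite mulr_ge0// powR_ge0.
- move=> t; transitivity (\int[P]_w cos (t * a * V w)).
    by apply: eq_Rintegral => w _; rewrite mulrA.
  by rewrite Vc normrM powRM//; congr (expR (- _)); ring.
- move=> t; rewrite -[RHS](Vs (t * a)).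
  by apply: eq_Rintegral => w _; rewrite mulrA.
Qed.

(** Large values are set to 0, not capped at [u], so that a truncated sum is exactly the sum of the
    small terms. *)
Definition truncate (u z : R) : R := if `|z| <= u then z else 0.

Lemma measurable_truncate u : measurable_fun setT (truncate u).
Proof.
apply: measurable_fun_ifT => //; apply: measurable_fun_ler => //.
Qed.

Lemma truncate_scale u z : 0 < u -> truncate u z = u * truncate 1 (z / u).
Proof.
move=> u0; rewrite /truncate normrM normfV (gtr0_norm u0) ler_pdivrMr// mul1r.
by case: ifP => _; rewrite ?mulr0// mulrCA divff ?gt_eqF// mulr1.
Qed.

(** The sine has mean 0, 1 - cos has mean at most [tau], and the tail is at most [C1 * tau]. The
    exponential moment is thus 1 + O(tau) even when [V] has no mean. *)
Lemma expectation_truncated (V : T -> R) (s u t : R) :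
  stable_law alpha P V s -> 0 < u -> 0 <= t ->
  \int[P]_w expR (t * truncate 1 (V w / u)) <=
  expR ((4 * (t + t ^+ 2 * expR t) + t * C1) * (s / u `^ alpha)).
Proof.
move=> VS u0 t0; have [mV s0 Vc Vs] := VS.
set tau := s / u `^ alpha.
have tau0 : 0 <= tau by rewrite divr_ge0// powR_ge0.
set kap := 4 * (t + t ^+ 2 * expR t).
have kap0 : 0 <= kap.
  by rewrite mulr_ge0// addr_ge0// mulr_ge0// ?expR_ge0// exprn_ge0.
have mu_ : measurable_fun setT (fun w => V w / u) by exact: measurable_funM.
pose A := [set w | u < `|V w|].
have mA : measurable A by exact: measurable_tail.
pose c w := cos (u^-1 * V w); pose e w := sin (u^-1 * V w).
have muV : measurable_fun setT (fun w => u^-1 * V w) by exact: measurable_funM.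
have ic : P.-integrable setT (EFin \o c).
  apply: (@bounded_integrable _ _ _ P _ 1) => [|w]; last exact: cos_max.
  exact: (measurableT_comp (measurable_cos (R := R))).
have ie : P.-integrable setT (EFin \o e).
  apply: (@bounded_integrable _ _ _ P _ 1) => [|w]; last exact: sin_max.
  exact: (measurableT_comp (measurable_sin (R := R))).
have i1 : P.-integrable setT (EFin \o (fun=> 1 : R)).
  by apply: (@bounded_integrable _ _ _ P _ 1) => // w; rewrite normr1.
have iA := indic_integrable P mA.
have i1c : P.-integrable setT (EFin \o (fun w => 1 - c w)) by exact: integrableB i1 ic.
have j1 := integrable_mull t ie; have j2 := integrable_mull kap i1c.
have j3 := integrable_mull t iA.
have j4 : P.-integrable setT (EFin \o (fun w => 1 + t * e w)) by exact: integrableD i1 j1.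
have j5 : P.-integrable setT (EFin \o (fun w => 1 + t * e w + kap * (1 - c w))).
  exact: integrableD j4 j2.
have j6 : P.-integrable setT (EFin \o (fun w => 1 + t * e w + kap * (1 - c w) + t * \1_A w)).
  exact: integrableD j5 j3.
have iexp : P.-integrable setT (EFin \o (fun w => expR (t * truncate 1 (V w / u)))).
  apply: (@bounded_integrable _ _ _ P _ (expR t)).
    apply: measurableT_comp => //; apply: measurable_funM => //.
    by apply: (measurableT_comp (measurable_truncate 1)).
  move=> w; rewrite ger0_norm ?expR_ge0// ler_expR ler_piMr// /truncate.
  by case: ifP => // h; rewrite (le_trans (ler_norm _)).
apply: (@le_trans _ _ (\int[P]_w (1 + t * e w + kap * (1 - c w) + t * \1_A w))).
  apply: le_Rintegral => // w _.
  have := expR_truncated_le (V w / u) t0; rewrite -/(truncate 1 _) => h.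
  apply: (le_trans h); rewrite /e /c [V w / u]mulrC -/kap.
  rewrite lerD2l le_eqVlt; apply/orP; left; apply/eqP; congr (_ * _).
  rewrite indicE; congr (nat_of_bool _)%:R.
  rewrite normrM normfV (gtr0_norm u0) mulrC ler_pdivrMr// mul1r -ltNge.
  by apply/idP/idP; rewrite inE.
rewrite RintegralD// RintegralD// RintegralD// !RintegralZl// RintegralB// Rintegral_one.
rewrite Rintegral_indic// Vc Vs mulr0 addr0.
rewrite normfV (gtr0_norm u0) -[u^-1]powR_inv1; last exact: ltW.
rewrite -powRrM mulN1r powRN [_^-1 * s]mulrC -/tau -/(tail P V u).
have h1 := expRN_ge1B tau.
have h2 : tail P V u <= C1 * tau := tailC VS u0.
apply: (@le_trans _ _ (1 + (kap + t * C1) * tau)); last exact: expR_ge1Dx.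
have : kap * (1 - expR (- tau)) <= kap * tau by rewrite ler_wpM2l//; lra.
have : t * tail P V u <= t * (C1 * tau) by rewrite ler_wpM2l.
lra.
Qed.

Section Chernoff.
Variables (k : nat) (Z : 'I_k -> T -> R) (s : 'I_k -> R) (K u t : R).
Hypotheses (ZS : forall i, stable_law alpha P (Z i) (s i))
  (Zind : mutually_independent P Z) (sK : \sum_i s i <= K)
  (u0 : 0 < u) (t0 : 0 <= t).

Let mZ i : measurable_fun setT (Z i). Proof. by case: (ZS i). Qed.

Definition truncated_sum w := \sum_i truncate u (Z i w).

Lemma measurable_truncated_sum : measurable_fun setT truncated_sum.
Proof.
apply: measurable_sum_fun => i; exact: (measurableT_comp (measurable_truncate u)).
Qed.

Lemma chernoff_truncated_sum x :
  fine (P [set w | x < truncated_sum w]) <=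
  expR (- (t * x / u)) *
  expR ((4 * (t + t ^+ 2 * expR t) + t * C1) * (K / u `^ alpha)).
Proof.
set kap := 4 * (t + t ^+ 2 * expR t) + t * C1.
have kap0 : 0 <= kap.
  rewrite addr_ge0//; last by rewrite mulr_ge0// ltW.
  by rewrite mulr_ge0// addr_ge0// mulr_ge0// ?expR_ge0// exprn_ge0.
have mA := measurable_lt_set x measurable_truncated_sum.
rewrite -Rintegral_indic//.
pose g (i : 'I_k) z := expR (t * truncate 1 (z / u)).
have mg i : measurable_fun setT (g i).
  apply: measurableT_comp => //; apply: measurable_funM => //.
  by apply: (measurableT_comp (measurable_truncate 1)); exact: measurable_funM.
have gb i z : 0 <= g i z <= expR t.
  rewrite expR_ge0 ler_expR ler_piMr// /truncate.
  by case: ifP => // h; rewrite (le_trans (ler_norm _)).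
have iprod : P.-integrable setT (EFin \o (fun w => \prod_i g i (Z i w))).
  apply: (@bounded_integrable _ _ _ P _ (\prod_(i < k) expR t)).
    by apply: measurable_prod_fun => i; exact: (measurableT_comp (mg i)).
  move=> w; rewrite ger0_norm; last by apply: prodr_ge0 => i _; exact: expR_ge0.
  by apply: ler_prod => i _; exact: gb.
apply: (@le_trans _ _ (\int[P]_w (expR (- (t * x / u)) * \prod_i g i (Z i w)))).
  apply: le_Rintegral => //; [exact: indic_integrable|exact: integrable_mull|].
  move=> w _; rewrite indicE.
  have p0 : 0 <= \prod_i g i (Z i w) by apply: prodr_ge0 => i _; exact: expR_ge0.
  case: (boolP (w \in _)) => /= [|_]; last by rewrite mulr_ge0// expR_ge0.
  rewrite inE/= => xw; rewrite /g -expR_sum -expRD -[X in X <= _]expR0 ler_expR.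
  rewrite -mulr_sumr; have -> : \sum_i truncate 1 (Z i w / u) = truncated_sum w / u.
    rewrite /truncated_sum mulr_suml; apply: eq_bigr => i _.
    by rewrite (truncate_scale _ u0) mulrAC divff ?mul1r// gt_eqF.
  rewrite addrC mulrA -mulrBl; apply: mulr_ge0; last by rewrite invr_ge0 ltW.
  by rewrite -mulrBr mulr_ge0// subr_ge0 ltW.
rewrite RintegralZl// ler_wpM2l ?expR_ge0//.
rewrite (Rintegral_prod_independent mZ Zind mg _ gb); last by rewrite -expR0 ler_expR.
apply: (@le_trans _ _ (\prod_i expR (kap * (s i / u `^ alpha)))).
  apply: ler_prod => i _; rewrite (expectation_truncated (ZS i) u0 t0) andbT.
  by apply: Rintegral_ge0 => w _; exact: expR_ge0.
rewrite -expR_sum ler_expR -mulr_sumr ler_wpM2l// -mulr_suml ler_wpM2r//.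
by rewrite invr_ge0 powR_ge0.
Qed.

End Chernoff.

Lemma chernoff_abs_truncated_sum (k : nat) (Z : 'I_k -> T -> R) (s : 'I_k -> R) (K u t x : R) :
  (forall i, stable_law alpha P (Z i) (s i)) -> mutually_independent P Z ->
  \sum_i s i <= K -> 0 < u -> 0 <= t ->
  fine (P [set w | x < `|truncated_sum Z u w|]) <=
  2 * (expR (- (t * x / u)) *
  expR ((4 * (t + t ^+ 2 * expR t) + t * C1) * (K / u `^ alpha))).
Proof.
move=> ZS Zind sK u0 t0.
have mZ i : measurable_fun setT (Z i) by case: (ZS i).
pose Z' i w := -1 * Z i w.
have ZS' i : stable_law alpha P (Z' i) (s i).
  by have := stable_lawZ (-1) (ZS i); rewrite normrN1 powR1 mulr1.
have Zind' : mutually_independent P Z'.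
  by apply: (mutually_independent_comp Zind (g := fun _ x => -1 * x)) => i; exact: measurable_funM.
have h1 := chernoff_truncated_sum ZS Zind sK u0 t0 x.
have h2 := chernoff_truncated_sum ZS' Zind' sK u0 t0 x.
have tN w : truncated_sum Z' u w = - truncated_sum Z u w.
  rewrite /truncated_sum -sumrN; apply: eq_bigr => i _.
  by rewrite /truncate /Z' mulN1r normrN; case: ifP; rewrite ?oppr0.
have m1 := measurable_lt_set x (measurable_truncated_sum u ZS).
have m2 := measurable_lt_set x (measurable_truncated_sum u ZS').
have m3 : measurable [set w | x < `|truncated_sum Z u w|].
  by apply: measurable_lt_set; apply: measurableT_comp => //; exact: (measurable_truncated_sum u ZS).
apply: (@le_trans _ _ (fine (P [set w | x < truncated_sum Z u w]) +
   fine (P [set w | x < truncated_sum Z' u w]))); last first.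
  by rewrite mulr_natl mulr2n lerD.
rewrite -fineD ?fin_num_measure//; apply: fine_le.
- exact: fin_num_measure.
- by rewrite fin_numD !fin_num_measure.
- apply: (le_trans _ (measureU2 _ m1 m2)); apply: le_measure; rewrite ?inE//.
    exact: measurableU.
  by move=> w /=; rewrite tN ltr_normr => /orP.
Qed.

(** * Rows of linear combinations: sums against their largest terms *)

Section Array.
Variables (k N : nat) (V : 'I_k -> T -> R) (s : 'I_k -> R) (a : 'I_N -> 'I_k -> R).
Variables (K L : R).
Hypotheses (VS : forall i, stable_law alpha P (V i) (s i))
  (Vind : mutually_independent P V) (K0 : 0 <= K)
  (sK : forall j, \sum_i s i * `|a j i| `^ alpha <= K)
  (N0 : (0 < N)%N) (L0 : 0 < L) (LN : L `^ alpha = N%:R).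

Let mV i : measurable_fun setT (V i). Proof. by case: (VS i). Qed.
Let mZ j i : measurable_fun setT (fun w => a j i * V i w).
Proof. exact: measurable_funM. Qed.
Let ZS j i := stable_lawZ (a j i) (VS i).
Let Zind j : mutually_independent P (fun i w => a j i * V i w).
Proof.
by apply: (mutually_independent_comp Vind (g := fun i x => a j i * x)) => i; exact: measurable_funM.
Qed.

Definition terms_le y := [set w | forall j i, `|a j i * V i w| <= y].
Definition sums_le y := [set w | forall j, `|\sum_i a j i * V i w| <= y].

Lemma measurable_sums_le y : measurable (sums_le y).
Proof.
rewrite (_ : sums_le y = \bigcap_(j in [set` enum 'I_N]) ~` [set w | y < `|\sum_i a j i * V i w|]).
  apply: fin_bigcap_measurable => // j _; apply: measurableC; apply: measurable_lt_set.
  by apply: measurableT_comp => //; exact: measurable_sum_fun.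
apply/seteqP; split => w /= H j; first by move=> _; apply/negP; rewrite -leNgt.
by rewrite leNgt; apply/negP; apply: (H j); rewrite /= mem_enum.
Qed.

Lemma measurable_terms_le y : measurable (terms_le y).
Proof.
rewrite (_ : terms_le y = \bigcap_(z in [set` enum ('I_N * 'I_k : finType)%type])
    ~` [set w | y < `|a z.1 z.2 * V z.2 w|]).
  apply: fin_bigcap_measurable => // z _; apply: measurableC; apply: measurable_lt_set.
  by apply: measurableT_comp.
apply/seteqP; split => w /= H; first by move=> z _; apply/negP; rewrite -leNgt.
by move=> j i; rewrite leNgt; apply/negP; apply: (H (j, i)); rewrite /= mem_enum.
Qed.

(** Equal indices give the empty set, so that the union can range over a plain finite product. *)
Let big u (z : 'I_N * 'I_k * 'I_k) : set T :=
  if z.1.2 == z.2 then set0 else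
  [set w | u < `|a z.1.1 z.1.2 * V z.1.2 w|] `&` [set w | u < `|a z.1.1 z.2 * V z.2 w|].

Let measurable_big u z : measurable (big u z).
Proof.
rewrite /big; case: ifP => // _; apply: measurableI; apply: measurable_lt_set;
  by apply: measurableT_comp.
Qed.

Let bad_pairs u := \bigcup_(z in [set: 'I_N * 'I_k * 'I_k]) big u z.

(** Independence factors the probability of each pair, and the double sum over a row is at most the
    square of the sum of the tails. This is bounded through [K], whatever the number [k] of
    columns. *)
Lemma bad_pairs_le u : 0 < u -> fine (P (bad_pairs u)) <= N%:R * (C1 * (K / u `^ alpha)) ^+ 2.
Proof.
move=> u0; have ua0 : 0 < u `^ alpha by rewrite powR_gt0.
apply: (le_trans (union_bound P (measurable_big u))).
pose p j i := tail P (fun w => a j i * V i w) u.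
have p0 j i : 0 <= p j i by exact: tail_ge0.
have sp j : \sum_i p j i <= C1 * (K / u `^ alpha).
  apply: (@le_trans _ _ (\sum_i C1 * (s i * `|a j i| `^ alpha / u `^ alpha))).
    by apply: ler_sum => i _; exact: tailC.
  rewrite -mulr_sumr -mulr_suml ler_wpM2l ?(ltW C1_gt0)//.
  by rewrite ler_wpM2r// invr_ge0 ltW.
apply: (@le_trans _ _ (\sum_(z : 'I_N * 'I_k * 'I_k) p z.1.1 z.1.2 * p z.1.1 z.2)).
  apply: ler_sum => -[[j i] i'] _ /=; rewrite /big/=; case: eqP => [_|/eqP ii].
    by rewrite measure0 mulr_ge0.
  have mB : measurable [set x : R | u < `|x|].
    by apply: measurable_lt_set; exact: normr_measurable.
  have := independent_pair (mZ j) (@Zind j) ii mB mB.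
  by rewrite /p /tail => <-.
rewrite -(pair_big xpredT xpredT (fun z i' => p z.1 z.2 * p z.1 i'))/=.
rewrite -(pair_big xpredT xpredT (fun j i => \sum_i' p j i * p j i'))/=.
apply: (@le_trans _ _ (\sum_(j < N) (C1 * (K / u `^ alpha)) ^+ 2)); last first.
  by rewrite sumr_const card_ord -[leLHS]mulr_natl.
apply: ler_sum => j _.
under eq_bigr do rewrite -mulr_sumr.
by rewrite -mulr_suml -expr2 ler_pXn2r ?nnegrE ?sp// ?sumr_ge0// (le_trans _ (sp j))// sumr_ge0.
Qed.

Let S j u w := truncated_sum (fun i w => a j i * V i w) u w.

Let bad_sums u x := \bigcup_(j in [set: 'I_N]) [set w | x < `|S j u w|].

Let measurable_bad_sum u x j : measurable [set w | x < `|S j u w|].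
Proof.
apply: measurable_lt_set; apply: measurableT_comp => //.
exact: (measurable_truncated_sum u (ZS j)).
Qed.

Let bad e := bad_pairs (e / 4 * L) `|` bad_sums (e / 4 * L) (e * L).

Let measurable_bad_pairs u : measurable (bad_pairs u).
Proof.
rewrite /bad_pairs (_ : [set: _] = [set` enum ('I_N * 'I_k * 'I_k : finType)%type]).
  by apply: fin_bigcup_measurable.
by apply/seteqP; split => i //= _; rewrite mem_enum.
Qed.

Let measurable_bad_sums u x : measurable (bad_sums u x).
Proof.
rewrite /bad_sums (_ : [set: _] = [set` enum 'I_N]).
  by apply: fin_bigcup_measurable.
by apply/seteqP; split => i //= _; rewrite mem_enum.
Qed.

Let measurable_bad e : measurable (bad e).
Proof. exact: measurableU. Qed.

(** The first summand accounts for two large terms in a row, the second for a large truncated sum.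
    Neither [k] nor [N] occurs; the probability of the bad event is at most this constant divided by
    [N]. *)
Definition array_error K' e : R :=
  (C1 * (K' / (e / 4) `^ alpha)) ^+ 2 +
  2 * expR ((20 + C1) * (K' / (e / 4) `^ alpha)).

Let bad_le e : 0 < e -> fine (P (bad e)) <= array_error K e / N%:R.
Proof.
move=> e0; set u := e / 4 * L.
have u0 : 0 < u by rewrite mulr_gt0// divr_gt0.
have Nr1 : 1 <= N%:R :> R by rewrite ler1n.
have Nr0 : 0 < N%:R :> R by rewrite ltr0n.
have d0 : 0 < (e / 4) `^ alpha by rewrite powR_gt0// divr_gt0.
have ua : u `^ alpha = (e / 4) `^ alpha * N%:R.
  by rewrite powRM ?LN//; [rewrite ltW// divr_gt0|exact: ltW].
set Q := K / (e / 4) `^ alpha.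
have Q0 : 0 <= Q by rewrite divr_ge0// ltW.
have KQ : K / u `^ alpha = Q / N%:R by rewrite ua invfM mulrA.
apply: (@le_trans _ _ (fine (P (bad_pairs u)) + fine (P (bad_sums u (e * L))))).
  rewrite -fineD ?fin_num_measure//; apply: fine_le.
  - exact: fin_num_measure.
  - by rewrite fin_numD !fin_num_measure.
  - exact: measureU2.
rewrite /array_error -/Q mulrDl lerD//.
  apply: (le_trans (bad_pairs_le u0)); rewrite KQ le_eqVlt; apply/orP; left; apply/eqP.
  by field; exact: lt0r_neq0.
(* The ratio of the thresholds [e * L] and [e / 4 * L] is 4, so the Chernoff factor is
   [expR (- (4 * t))], that is N^-2: one power of [N] pays for the union over the rows, the other
   remains. As [expR t ^+ 2] is [N], it is compensated by [K / u ^ alpha], of order 1 / N, and the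
   second exponent stays bounded. *)
pose t := ln N%:R / 2 : R.
have t0 : 0 <= t by rewrite divr_ge0// ln_ge0.
have et2 : expR t ^+ 2 = N%:R.
  by rewrite -expRM_natl mulrC divfK// lnK// posrE.
have et1 : 1 <= expR t by rewrite -expR0 ler_expR.
have tet : t <= expR t by have := expR_ge1Dx t; lra.
have t2 : t ^+ 2 <= 4 * expR t.
  have h : t / 2 <= expR (t / 2) by have := expR_ge1Dx (t / 2); lra.
  have -> : expR t = expR (t / 2) ^+ 2 by rewrite -expRM_natl mulrC divfK.
  have : (t / 2) ^+ 2 <= expR (t / 2) ^+ 2.
    by rewrite ler_pXn2r ?nnegrE// ?expR_ge0// divr_ge0.
  by rewrite (_ : (t / 2) ^+ 2 = t ^+ 2 / 4); [lra|field].
apply: (le_trans (union_bound P (measurable_bad_sum u (e * L)))).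
pose r := expR (- (t * (e * L) / u)) *
  expR ((4 * (t + t ^+ 2 * expR t) + t * C1) * (K / u `^ alpha)).
apply: (@le_trans _ _ (\sum_(j < N) 2 * r)).
  by apply: ler_sum => j _; apply: chernoff_abs_truncated_sum (ZS j) (@Zind j) (sK j) u0 t0.
rewrite sumr_const card_ord -[leLHS]mulr_natl.
rewrite /r; have -> : t * (e * L) / u = 4 * t.
  by rewrite /u; field; rewrite !gt_eqF.
rewrite (_ : 4 * t = 2%:R * ln N%:R); last by rewrite /t; field.
rewrite expRN expRM_natl lnK ?posrE//.
(* 20 is 4 * (1 + 4), from [t <= expR t ^+ 2] and [t ^+ 2 <= 4 * expR t]. *)
set G := expR ((20 + C1) * Q).
have GE : expR ((4 * (t + t ^+ 2 * expR t) + t * C1) * (K / u `^ alpha)) <= G.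
  have key (x y z : R) : x <= z -> y <= 4 * z -> 4 * (x + y) + x * C1 <= (20 + C1) * z.
    by move=> xz yz; have := ler_wpM2r (ltW C1_gt0) xz; lra.
  have b1 : t <= expR t * expR t by rewrite (le_trans tet)// ler_peMr// expR_ge0.
  have b2 : t ^+ 2 * expR t <= 4 * (expR t * expR t) by rewrite mulrA ler_wpM2r// expR_ge0.
  rewrite ler_expR KQ.
  have := ler_wpM2r (_ : 0 <= Q / N%:R) (key _ _ _ b1 b2).
  rewrite -expr2 et2 (_ : (20 + C1) * N%:R * (Q / N%:R) = (20 + C1) * Q); last first.
    by field; exact: lt0r_neq0.
  by apply; rewrite divr_ge0.
move: (expR ((4 * (t + _) + _) * _)) GE => G' GE.
have -> : N%:R * (2 * ((N%:R ^+ 2)^-1 * G')) = 2 * G' / N%:R.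
  by field; exact: lt0r_neq0.
by rewrite ler_wpM2r ?invr_ge0 ?ler0n// ler_wpM2l.
Qed.

(* Off the bad event at most one term of each sum exceeds [u], and the other
   terms sum up to at most [x]. *)
Let split_sum u x w j : ~ bad_pairs u w -> ~ bad_sums u x w ->
  (forall i, `|a j i * V i w| <= u) /\ `|\sum_i a j i * V i w| <= x \/
  exists i, u < `|a j i * V i w| /\ `|\sum_i a j i * V i w - a j i * V i w| <= x.
Proof.
move=> nb1 nb2.
have Sx : `|S j u w| <= x.
  by rewrite leNgt; apply/negP => h; apply: nb2; exists j.
have [/existsP[i ui]|/existsPn ni] := boolP [exists i, u < `|a j i * V i w|].
  right; exists i; split=> //.
  suff -> : \sum_i a j i * V i w - a j i * V i w = S j u w by [].
  rewrite /S /truncated_sum (bigD1 i)//= [RHS](bigD1 i)//= addrAC subrr add0r.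
  rewrite {1}/truncate leNgt ui/= add0r; apply: eq_bigr => i' i'i.
  rewrite /truncate ifT// leNgt; apply/negP => ui'; apply: nb1.
  by exists (j, i, i') => //; rewrite /big/= eq_sym (negbTE i'i).
left; split=> [i|]; first by have := ni i; rewrite -leNgt.
suff -> : \sum_i a j i * V i w = S j u w by [].
by apply: eq_bigr => i _; rewrite /truncate ifT// leNgt; exact: ni.
Qed.

Lemma terms_le_sums e y : 0 < e -> 0 <= y ->
  fine (P (terms_le (y * L))) <= fine (P (sums_le ((y + e) * L))) + array_error K e / N%:R.
Proof.
move=> e0 y0; apply: (@le_trans _ _ (fine (P (sums_le ((y + e) * L))) + fine (P (bad e)))); last first.
  by rewrite lerD2l; exact: bad_le.
have m1 := measurable_sums_le ((y + e) * L); have m2 := measurable_terms_le (y * L).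
rewrite -fineD ?fin_num_measure//; apply: fine_le.
- exact: fin_num_measure.
- by rewrite fin_numD !fin_num_measure.
apply: (le_trans _ (measureU2 _ m1 (measurable_bad e))).
apply: le_measure; rewrite ?inE//; first exact: measurableU.
move=> w wt; have [wb|nb] := pselect (bad e w); [by right|left => j].
have [nb1 nb2] : ~ bad_pairs (e / 4 * L) w /\ ~ bad_sums (e / 4 * L) (e * L) w.
  by split => h; apply: nb; [left|right].
have yL0 : 0 <= y * L by rewrite mulr_ge0// ltW.
have [[_ h]|[i [_ h]]] := split_sum j nb1 nb2; first by rewrite mulrDl; lra.
rewrite mulrDl -(subrK (a j i * V i w) (\sum_i _)) addrC.
by rewrite (le_trans (ler_normD _ _))// lerD.
Qed.

Lemma sums_le_terms e x : 0 < e -> 0 <= x ->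
  fine (P (sums_le (x * L))) <= fine (P (terms_le ((x + e) * L))) + array_error K e / N%:R.
Proof.
move=> e0 x0; apply: (@le_trans _ _ (fine (P (terms_le ((x + e) * L))) + fine (P (bad e)))); last first.
  by rewrite lerD2l; exact: bad_le.
have m1 := measurable_terms_le ((x + e) * L); have m2 := measurable_sums_le (x * L).
rewrite -fineD ?fin_num_measure//; apply: fine_le.
- exact: fin_num_measure.
- by rewrite fin_numD !fin_num_measure.
apply: (le_trans _ (measureU2 _ m1 (measurable_bad e))).
apply: le_measure; rewrite ?inE//; first exact: measurableU.
move=> w ws; have [wb|nb] := pselect (bad e w); [by right|left => j i].
have [nb1 nb2] : ~ bad_pairs (e / 4 * L) w /\ ~ bad_sums (e / 4 * L) (e * L) w.
  by split => h; apply: nb; [left|right].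
have xL0 : 0 <= x * L by rewrite mulr_ge0// ltW.
have eL0 : 0 <= e * L by rewrite mulr_ge0// ltW.
have uL : e / 4 * L <= (x + e) * L by rewrite ler_wpM2r ?(ltW L0)//; lra.
have [[h _]|[i' [ui' h]]] := split_sum j nb1 nb2; first exact: le_trans uL.
have [ui|] := leP `|a j i * V i w| (e / 4 * L); first exact: le_trans uL.
move=> ui; have ii : i = i'.
  apply/eqP/negPn/negP => ii; apply: nb1.
  by exists (j, i, i') => //; rewrite /big/= (negbTE ii).
rewrite {}ii mulrDl -(subKr (\sum_i a j i * V i w) (a j i' * V i' w)).
by rewrite (le_trans (ler_normB _ _))// lerD//; exact: ws.
Qed.

End Array.

End TruncatedSum.

Section BigMax.
Context {R : realType} (I : Type).
Implicit Types (r : seq I) (F : I -> R).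

Lemma bigmax0_powR r F (alpha : R) : 0 < alpha -> (forall i, 0 <= F i) ->
  (\big[Num.max/0]_(i <- r) F i) `^ alpha = \big[Num.max/0]_(i <- r) (F i `^ alpha).
Proof.
move=> a0 F0; elim: r => [|i r IH]; first by rewrite !big_nil powR0// gt_eqF.
rewrite !big_cons -IH; set m := \big[_/_]_(j <- r) _.
have m0 : 0 <= m by rewrite /m; elim/big_ind: _ => // x y x0 y0; rewrite le_max x0.
have [h|/ltW h] := leP (F i) m; apply/esym.
  by apply/max_idPr; apply: ge0_ler_powR; rewrite ?nnegrE// ltW.
by apply/max_idPl; apply: ge0_ler_powR; rewrite ?nnegrE// ltW.
Qed.

Lemma bigmax0_ge0 r F : 0 <= \big[Num.max/0]_(i <- r) F i.
Proof.
by elim: r => [|i r IH]; rewrite ?big_nil ?big_cons// le_max IH orbT.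
Qed.

End BigMax.

Lemma bigmax0_leP (R : realType) (I : eqType) (r : seq I) (F : I -> R) (x : R) : 0 <= x ->
  (\big[Num.max/0]_(i <- r) F i <= x) <-> (forall i, i \in r -> F i <= x).
Proof.
move=> x0; elim: r => [|i r IH]; first by rewrite big_nil x0; split.
rewrite big_cons ge_max; split => [/andP[h1 /IH h2] j|h].
  by rewrite inE => /predU1P[->//|]; exact: h2.
rewrite h ?mem_head//=; apply/IH => j jr; apply: h; by rewrite inE jr orbT.
Qed.

Lemma bigmax0_ge (R : realType) (I : eqType) (r : seq I) (F : I -> R) i : i \in r ->
  F i <= \big[Num.max/0]_(i <- r) F i.
Proof. by move=> ir; have /bigmax0_leP := lexx (\big[Num.max/0]_(i <- r) F i); apply; rewrite ?bigmax0_ge0. Qed.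

(** * The law of the largest term *)

Section TermsLaw.
Context {R : realType} (alpha : R) {d : measure_display} {T : measurableType d}.
Variable P : probability T R.
Hypothesis halpha : 0 < alpha < 2.
Variable C1 : R.
Hypothesis C1_gt0 : 0 < C1.
Hypothesis tailC : forall V s u, stable_law alpha P V s -> 0 < u ->
  tail P V u <= C1 * (s / u `^ alpha).
Variables (C e t0 : R).
Hypothesis e0 : 0 < e.
Hypothesis tail_asym : forall V s u, stable_law alpha P V s -> 0 < u ->
    s / u `^ alpha <= t0 ->
    `|tail P V u - C * (s / u `^ alpha)| <= e * (s / u `^ alpha).
Variables (k N : nat) (V : 'I_k -> T -> R) (s : 'I_k -> R) (a : 'I_N -> 'I_k -> R).
Variables (K L : R).
Hypotheses (VS : forall i, stable_law alpha P (V i) (s i))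
  (Vind : mutually_independent P V) (K0 : 0 <= K)
  (sK : forall j, \sum_i s i * `|a j i| `^ alpha <= K)
  (N0 : (0 < N)%N) (L0 : 0 < L) (LN : L `^ alpha = N%:R).

Let mV i : measurable_fun setT (V i). Proof. by case: (VS i). Qed.
Let s0 i : 0 <= s i. Proof. by case: (VS i). Qed.
Let alpha0 : 0 < alpha. Proof. by case/andP: halpha. Qed.

(** The discrete form of the integral of a maximum: [s i] is the mass of a cell and [a j i] the
    value of the [j]-th function on it. *)
Definition array_size : R :=
  \sum_i s i * \big[Num.max/0]_(j < N) (`|a j i| `^ alpha).

Let amax i := \big[Num.max/0]_(j < N) `|a j i|.

Let amax0 i : 0 <= amax i. Proof. exact: bigmax0_ge0. Qed.

Let amaxE i : `|amax i| `^ alpha = \big[Num.max/0]_(j < N) (`|a j i| `^ alpha).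
Proof. by rewrite ger0_norm// /amax bigmax0_powR. Qed.

Let ZS i := stable_lawZ (amax i) (VS i).

(** Each single term of a row is at most the row sum, so the maximum over the rows obeys the same
    bound. This makes all the tails below uniformly small. *)
Let size_le i : s i * `|amax i| `^ alpha <= K.
Proof.
rewrite amaxE; have [si0|sin0] := eqVneq (s i) 0; first by rewrite si0 mul0r.
have sip : 0 < s i by rewrite lt_neqAle eq_sym sin0 s0.
rewrite mulrC -ler_pdivlMr//; apply/bigmax0_leP; first by rewrite divr_ge0.
move=> j _; rewrite ler_pdivlMr// mulrC (le_trans _ (sK j))// (bigD1 i)//= lerDl.
by apply: sumr_ge0 => l _; rewrite mulr_ge0// powR_ge0.
Qed.

(** Taking the maximum over the rows first leaves one condition on each [V i], so the probability is
    an exact product. *)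
Lemma terms_le_prod y : 0 <= y ->
  fine (P (terms_le V a y)) = \prod_i (1 - tail P (fun w => amax i * V i w) y).
Proof.
move=> y0.
have -> : terms_le V a y =
    \bigcap_(i in [set: 'I_k]) (V i @^-1` [set x | `|amax i * x| <= y]).
  apply/seteqP; split => w /= H.
    move=> i _ /=; rewrite normrM ger0_norm//.
    have [v0|vn0] := eqVneq `|V i w| 0; first by rewrite v0 mulr0.
    have vp : 0 < `|V i w| by rewrite lt_neqAle eq_sym vn0/=.
    rewrite -ler_pdivlMr//; apply/bigmax0_leP; first by rewrite divr_ge0.
    by move=> j _; rewrite ler_pdivlMr// -normrM; exact: H.
  move=> j i; have := H i I; rewrite /= !normrM => /(le_trans _); apply.
  by rewrite ler_wpM2r// (ger0_norm (amax0 i)); exact: (bigmax0_ge (fun j => `|a j i|)) (mem_index_enum j).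
have mB i : measurable [set x : R | `|amax i * x| <= y].
  have : measurable (~` [set x : R | y < `|amax i * x|]).
    by apply: measurableC; apply: measurable_lt_set; apply: measurableT_comp.
  congr measurable; apply/seteqP; split => x /=; first by move/negP; rewrite -leNgt.
  by move=> h; apply/negP; rewrite -leNgt.
rewrite (mutually_independent_fine mV Vind mB); apply: eq_bigr => i _.
have mt := measurable_tail y (measurable_funM (measurable_cst (amax i)) (mV i)).
rewrite (_ : V i @^-1` _ = ~` [set w | y < `|amax i * V i w|]); last first.
  apply/seteqP; split => w /=; first by move=> h; apply/negP; rewrite -leNgt.
  by move/negP; rewrite -leNgt.
rewrite probability_setC// fineB//; exact: fin_num_measure.
Qed.

(** Each factor 1 - p is at most exp (- p), and at least exp (- (1 + e) p) once [p <= e / (1 + e)].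
    The last hypothesis ensures the latter through the upper tail bound, the one before it puts the
    tails in the range of their asymptotics. *)
Lemma terms_le_law y b : b = array_size / (y `^ alpha * N%:R) ->
  0 < y -> K / (y `^ alpha * N%:R) <= t0 ->
  C1 * (K / (y `^ alpha * N%:R)) <= e / (1 + e) ->
  expR (- ((C + e) * (1 + e) * b)) <= fine (P (terms_le V a (y * L))) <=
  expR (- ((C - e) * b)).
Proof.
move=> bdef y0 Kt KC.
have yL0 : 0 < y * L by rewrite mulr_gt0.
have Nr0 : 0 < N%:R :> R by rewrite ltr0n.
have ya0 : 0 < y `^ alpha by rewrite powR_gt0.
have yN0 : 0 < y `^ alpha * N%:R by rewrite mulr_gt0.
have yLE : (y * L) `^ alpha = y `^ alpha * N%:R by rewrite powRM ?LN//; exact: ltW.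
rewrite terms_le_prod; last exact: ltW.
pose tau i := s i * `|amax i| `^ alpha / (y `^ alpha * N%:R).
pose p i := tail P (fun w => amax i * V i w) (y * L).
have tau0 i : 0 <= tau i.
  by rewrite divr_ge0 ?(ltW yN0)// mulr_ge0// powR_ge0.
have tauK i : tau i <= K / (y `^ alpha * N%:R).
  by rewrite ler_wpM2r ?size_le// invr_ge0 ltW.
have bE : b = \sum_i tau i.
  by rewrite bdef /array_size mulr_suml; apply: eq_bigr => i _; rewrite /tau amaxE.
have pa i : `|p i - C * tau i| <= e * tau i.
  by rewrite /p /tau -yLE; apply: tail_asym => //; rewrite yLE (le_trans (tauK i)).
have pC i : p i <= e / (1 + e).
  apply: (le_trans _ KC); apply: (@le_trans _ _ (C1 * tau i)).
    by rewrite /p /tau -yLE; exact: tailC.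
  by rewrite ler_wpM2l// ltW.
have p0 i : 0 <= p i by exact: tail_ge0.
have e1 : 0 < 1 + e by rewrite addr_gt0.
have p1 i : 0 < 1 - p i.
  have : e / (1 + e) < 1 by rewrite ltr_pdivrMr// mul1r ltrDr.
  by have := pC i; rewrite subr_gt0; exact: le_lt_trans.
apply/andP; split.
- apply: (@le_trans _ _ (\prod_i expR (- ((1 + e) * p i)))).
    rewrite -expR_sum ler_expR sumrN lerN2 -mulr_sumr bE.
    rewrite [(C + e) * _]mulrC -mulrA ler_wpM2l ?(ltW e1)// mulr_sumr.
    apply: ler_sum => i _; have := pa i; rewrite ler_norml => /andP[_].
    by rewrite lerBlDr mulrDl addrC.
  apply: ler_prod => i _; rewrite expR_ge0/= expRN.
  rewrite -/(p i) -[leRHS]invrK lef_pV2 ?posrE ?expR_gt0 ?invr_gt0//.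
  apply: (le_trans _ (expR_ge1Dx _)).
  rewrite -[leLHS]mul1r ler_pdivrMr//.
  have := pC i; rewrite ler_pdivlMr// => h.
  have := p0 i; move: (p i) h => q h q0.
  have : 0 <= q * (e - q * (1 + e)) by rewrite mulr_ge0// subr_ge0.
  lra.
- apply: (@le_trans _ _ (\prod_i expR (- p i))).
    by apply: ler_prod => i _; rewrite (ltW (p1 i))/=; exact: expR_ge1Dx.
  rewrite -expR_sum ler_expR sumrN lerN2 bE mulr_sumr.
  apply: ler_sum => i _; have := pa i; rewrite ler_norml => /andP[h _].
  by move: h; rewrite lerBrDr mulrBl addrC.
Qed.

End TermsLaw.

(** * Densities of a nonsingular action *)

Section Density.
Context {R : realType} {d : measure_display} {S : measurableType d}.
Variable m : {sigma_finite_measure set S -> \bar R}.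

Lemma sigma_finite_partition : exists F : (set S)^nat,
  [/\ forall k, measurable (F k), trivIset setT F, \bigcup_k F k = setT
    & forall k, (m (F k) < +oo)%E].
Proof.
have [F TF /all_and2[mF Foo]] := sigma_finiteT m.
have mD k : measurable (seqDU F k) by exact: seqDU_measurable.
exists (seqDU F); split; [by []|exact: trivIset_seqDU| |].
- by rewrite -seqDU_bigcup_eq.
- move=> k; apply: le_lt_trans (Foo k); apply: le_measure; rewrite ?inE//.
  exact: subset_seqDU.
Qed.

(* The library's Radon-Nikodym theorem asks for a finite [nu]; it is applied on
   each piece of a partition into sets of finite [nu]-measure. *)
Lemma density_exists (nu : {measure set S -> \bar R}) (F : (set S)^nat) :
  (forall k, measurable (F k)) -> trivIset setT F -> \bigcup_k F k = setT ->
  (forall k, (nu (F k) < +oo)%E) ->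
  (forall A, measurable A -> m A = 0%E -> nu A = 0%E) ->
  exists g, is_density m nu g.
Proof.
move=> mF tF UF Foo num.
have RN k : exists g : S -> R, [/\ measurable_fun setT g, forall s, 0 <= g s &
    forall A, measurable A -> A `<=` F k -> nu A = (\int[m]_(s in A) (g s)%:E)%E].
  pose nuk : {finite_measure set S -> \bar R} := mfrestr (mF k) (Foo k).
  have dom : nuk `<< m.
    apply/null_content_dominatesP => A mA mA0; apply: num; first exact: measurableI.
    apply/eqP; rewrite eq_le measure_ge0 andbT -mA0; apply: le_measure; rewrite ?inE//.
    exact: measurableI.
  have [g [g0 gfin gint gE]] := radon_nikodym_sigma_finite dom.
  exists (fine \o g); split.
  - by apply: measurableT_comp => //; exact: measurable_int gint.
  - by move=> s; rewrite fine_ge0.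
  - move=> A mA AF; transitivity (nuk A).
      by rewrite /nuk /= /mfrestr /mrestr setIidl.
    by rewrite gE//; apply: eq_integral => s _; rewrite /= fineK.
have /choice[g Hg] := RN.
have idx s : exists k, F k s.
  by have : (\bigcup_k F k) s; [rewrite UF|case=> k _; exists k].
have /choice[k Hk] := idx.
exists (fun s => g (k s) s).
have kE j s : F j s -> k s = j.
  by move=> Fj; apply: (tF (k s) j) => //; exists s; split.
have mg : measurable_fun setT (fun s => g (k s) s).
  rewrite -UF; apply/measurable_fun_bigcup => // j.
  have := measurable_funTS (D := F j) (proj1 (and3_rec (fun a b c => conj a (conj b c)) (Hg j))).
  by apply: eq_measurable_fun => s; rewrite inE => /kE ->.
split => //; first by move=> s; case: (Hg (k s)).
move=> A mA.
have tAF : trivIset setT (fun j => A `&` F j) by exact: trivIset_setIl.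
have mAF j : measurable (A `&` F j) by exact: measurableI.
have AE : A = \bigcup_j (A `&` F j) by rewrite -setI_bigcupr UF setIT.
transitivity (\sum_(0 <= j <oo) nu (A `&` F j))%E.
  rewrite [in LHS]AE; apply: measure_semi_bigcup => //.
  by rewrite -AE.
rewrite [in RHS]AE ge0_integral_bigcup//=; last 2 first.
- by apply: measurable_funTS; exact/measurable_EFinP.
- by move=> s _; rewrite lee_fin; case: (Hg (k s)).
apply: eq_eseriesr => j _; case: (Hg j) => _ _ ->//.
apply: eq_integral => s; rewrite inE => -[_ /kE ->] //.
Qed.

Lemma density_unique (nu : set S -> \bar R) (F : (set S)^nat) (g1 g2 : S -> R) :
  (forall k, measurable (F k)) -> \bigcup_k F k = setT ->
  (forall k, (nu (F k) < +oo)%E) ->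
  is_density m nu g1 -> is_density m nu g2 -> {ae m, forall s, g1 s = g2 s}.
Proof.
move=> mF UF Foo [mg1 g10 g1E] [mg2 g20 g2E].
have H k : ae_eq m (F k) (EFin \o g1) (EFin \o g2).
  apply: integral_ae_eq => //.
  - apply/integrableP; split; first by apply: measurable_funTS; exact/measurable_EFinP.
    under eq_integral do rewrite /= ger0_norm//.
    by rewrite -g1E.
  - by apply: measurable_funTS; exact/measurable_EFinP.
  - by move=> E _ mE; rewrite /= -g1E// -g2E.
have := ae_foralln H; apply: filterS => s Hs.
have [k _ Fk] : (\bigcup_k F k) s by rewrite UF.
by have [] := Hs k Fk.
Qed.

Lemma densityP (nu : set S -> \bar R) : (exists g, is_density m nu g) ->
  is_density m nu (density m nu).
Proof. by move=> [g Hg]; rewrite /density; apply: (xgetPex (cst 0)); exists g. Qed.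

End Density.

(** * Change of variables and translation invariance *)

Section Action.
Context {R : realType} {G : groupType} {d : measure_display} {S : measurableType d}.
Variables (m : {sigma_finite_measure set S -> \bar R}) (phi : G -> S -> S).
Hypotheses (hphi : group_action phi) (hns : nonsingular m phi).
Implicit Types (t u v : G) (s : S).

Lemma measurable_action t : measurable_fun setT (phi t).
Proof. by case: hphi. Qed.

Lemma actionM u v s : phi (u * v)%g s = phi v (phi u s).
Proof. by case: hphi => _ _ ->. Qed.

Lemma actionK u : cancel (phi u) (phi u^-1%g).
Proof. by move=> s; rewrite -actionM mulgV; case: hphi => _ ->. Qed.

Lemma actionVK u : cancel (phi u^-1%g) (phi u).
Proof. by move=> s; rewrite -actionM mulVg; case: hphi => _ ->. Qed.

Lemma image_action u (A : set S) : phi u @` A = phi u^-1%g @^-1` A.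
Proof.
apply/seteqP; split => s /=; first by move=> [s' As' <-]; rewrite actionK.
by move=> h; exists (phi u^-1%g s) => //; exact: actionVK.
Qed.

Lemma measurable_preimage_action u (A : set S) : measurable A -> measurable (phi u @^-1` A).
Proof. by move=> mA; rewrite -[X in measurable X]setTI; exact: measurable_action. Qed.

Lemma action_finite_partition t : exists F : (set S)^nat,
  [/\ forall k, measurable (F k), trivIset setT F, \bigcup_k F k = setT
    & forall k, (image_measure m phi t (F k) < +oo)%E].
Proof.
have [F [mF tF UF Foo]] := sigma_finite_partition m.
exists (fun k => phi t @^-1` F k); split.
- by move=> k; exact: measurable_preimage_action.
- by move=> i j _ _ [s [/= Fi Fj]]; apply: (tF i j) => //; exists (phi t s).
- by rewrite -preimage_bigcup UF preimage_setT.
- move=> k; rewrite /image_measure image_action.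
  have -> : phi t^-1%g @^-1` (phi t @^-1` F k) = F k; last exact: Foo.
  by apply/seteqP; split => s /=; rewrite actionVK.
Qed.

Lemma action_densityP t : is_density m (image_measure m phi t) (action_density m phi t).
Proof.
apply: densityP; have [F [mF tF UF Foo]] := action_finite_partition t.
(* As [phi t] is invertible, the image measure is the push-forward of [m] under the action of the
   inverse; this provides its measure structure. *)
pose mf : {mfun S >-> S} := HB.pack (phi t^-1%g) (isMeasurableFun.Build _ _ _ _ _ (measurable_action t^-1%g)).
have nuE A : image_measure m phi t A = pushforward m mf A.
  by rewrite /image_measure image_action.
have -> : image_measure m phi t = pushforward m mf by apply/funext => A; exact: nuE.
apply: density_exists mF tF UF _ _.
- by move=> k; have := Foo k; rewrite nuE.
- by move=> A mA /(hns t mA); rewrite nuE.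
Qed.

Lemma action_density_ge0 t s : 0 <= action_density m phi t s.
Proof. by case: (action_densityP t). Qed.

Lemma measurable_action_density t : measurable_fun setT (action_density m phi t).
Proof. by case: (action_densityP t). Qed.

Lemma image_measureE t A : measurable A ->
  image_measure m phi t A = (\int[m]_s (action_density m phi t s * \1_A s)%:E)%E.
Proof.
move=> mA; have [_ _ ->//] := action_densityP t.
rewrite integral_mkcond; apply: eq_integral => s _.
rewrite /patch indicE; case: ifP; rewrite ?mulr1 ?mulr0//.
Qed.

Lemma action_change_of_variable t (g : S -> R) : measurable_fun setT g ->
  (forall s, 0 <= g s) ->
  (\int[m]_s (action_density m phi t s * g (phi t s))%:E = \int[m]_s (g s)%:E)%E.
Proof.
(* The right side is read as an integral with weight 1 along the identity, so that only indicators
   have to be tested. *)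
move=> mg g0; transitivity (\int[m]_s (cst 1 s * g (idfun s))%:E)%E; last first.
  by apply: eq_integral => s _; rewrite mul1r.
apply: eq_weighted_integral => //.
- exact: measurable_action_density.
- exact: measurable_action.
- exact: measurable_id.
- exact: action_density_ge0.
- move=> B mB; rewrite (eq_integral (fun s => (action_density m phi t s * \1_(phi t @^-1` B) s)%:E))//.
  rewrite -image_measureE; last exact: measurable_preimage_action.
  under [RHS]eq_integral do rewrite mul1r.
  rewrite integral_indic// setIT /image_measure image_action.
  by congr (m _); apply/seteqP; split => s /=; rewrite actionVK.
Qed.

(** By uniqueness of densities: integrating the product over [A] and changing variables by [phi u]
    gives the measure of the image of [A] under [phi t \o phi u]. The identity is only almost sure
    because a density is chosen separately for each group element. *)
Lemma action_densityM u t :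
  {ae m, forall s, action_density m phi (u * t)%g s =
    action_density m phi u s * action_density m phi t (phi u s)}.
Proof.
have [F [mF _ UF Foo]] := action_finite_partition (u * t)%g.
apply: density_unique mF UF Foo (action_densityP _) _.
have mdt : measurable_fun setT (fun s => action_density m phi t (phi u s)).
  exact: (measurableT_comp (measurable_action_density t) (measurable_action u)).
have mdu := measurable_action_density u.
split.
- exact: measurable_funM.
- by move=> s; rewrite mulr_ge0// action_density_ge0.
- move=> A mA.
  pose B := phi u^-1%g @^-1` A.
  have mB : measurable B by exact: measurable_preimage_action.
  have -> : image_measure m phi (u * t)%g A = image_measure m phi t B.
    rewrite /image_measure /B -image_action image_comp; congr (m (_ @` _)).
    by apply/funext => s /=; rewrite actionM.
  rewrite image_measureE//.
  have mg : measurable_fun setT (fun s => action_density m phi t s * \1_B s).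
    by apply: measurable_funM => //; exact: measurable_action_density.
  rewrite -(action_change_of_variable u mg); last first.
    by move=> s; rewrite mulr_ge0// action_density_ge0.
  rewrite integral_mkcond; apply: eq_integral => s _.
  rewrite /patch; have -> : \1_B (phi u s) = \1_A s :> R.
    by rewrite !indicE; congr (nat_of_bool _)%:R; rewrite /B; apply/idP/idP; rewrite !inE/= actionK.
  by rewrite indicE; case: ifP; rewrite ?mulr1// !mulr0.
Qed.

Variables (alpha : R) (f : S -> R).
Hypotheses (alpha0 : 0 < alpha) (mf : measurable_fun setT f).

(** This is [|f_t| ^ alpha]; the signs of the cocycle have disappeared. *)
Definition translate_weight t s : R :=
  action_density m phi t s * `|f (phi t s)| `^ alpha.

Definition max_integral (E : seq G) : \bar R :=
  (\int[m]_s (\big[Num.max/0]_(t <- E) translate_weight t s)%:E)%E.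

Lemma translate_weight_ge0 t s : 0 <= translate_weight t s.
Proof. by rewrite mulr_ge0 ?action_density_ge0 ?powR_ge0. Qed.

Lemma measurable_translate_weight t : measurable_fun setT (translate_weight t).
Proof.
apply: measurable_funM; first exact: measurable_action_density.
apply: (measurableT_comp (measurable_powR alpha)).
apply: measurableT_comp => //; apply: measurableT_comp => //.
exact: measurable_action.
Qed.

Lemma measurable_bigmax (I : Type) (r : seq I) (F : I -> S -> R) :
  (forall i, measurable_fun setT (F i)) ->
  measurable_fun setT (fun s => \big[Num.max/0]_(i <- r) F i s).
Proof.
move=> mF; elim: r => [|i r IH].
  by under eq_fun do rewrite big_nil; exact: measurable_cst.
by under eq_fun do rewrite big_cons; exact: measurable_maxr.
Qed.

Lemma integral_translate_weight t :
  (\int[m]_s (translate_weight t s)%:E = \int[m]_s (`|f s| `^ alpha)%:E)%E.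
Proof.
rewrite (action_change_of_variable t (g := fun s => `|f s| `^ alpha))//.
- apply: (measurableT_comp (measurable_powR alpha)); exact: measurableT_comp.
Qed.

(** The density of [u] is a nonnegative factor common to all weights at [u * t], so it leaves the
    maximum; a change of variables by [phi u] then absorbs it. *)
Lemma max_integral_translate u (E : seq G) :
  max_integral [seq (u * t)%g | t <- E] = max_integral E.
Proof.
pose H s := \big[Num.max/0]_(t <- E) translate_weight t s.
have mH : measurable_fun setT H.
  by apply: measurable_bigmax => t; exact: measurable_translate_weight.
have H0 s : 0 <= H s.
  by rewrite /H; elim/big_ind: _ => // *; [rewrite le_max; apply/orP; left|exact: translate_weight_ge0].
rewrite /max_integral -/H -(action_change_of_variable u mH H0).
apply: ae_eq_integral => //.
- apply/measurable_EFinP; apply: measurable_bigmax => t; exact: measurable_translate_weight.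
- apply/measurable_EFinP; apply: measurable_funM; first exact: measurable_action_density.
  exact: (measurableT_comp mH (measurable_action u)).
have : {ae m, forall s, forall t, t \in E -> action_density m phi (u * t)%g s =
    action_density m phi u s * action_density m phi t (phi u s)}.
  (* The exceptional null set of the cocycle identity depends on [t]; the list being finite, one
     null set serves all its elements. *)
  elim: E {H mH H0} => [|t E IH]; first exact: aeW.
  have := action_densityM u t; move: IH; apply: filterS2 => s IH Ht v.
  by rewrite inE => /predU1P[->//|]; exact: IH.
apply: filterS => s Hs _; congr EFin; rewrite big_map /H.
rewrite big_seq [in RHS]big_seq.
have : forall r : seq G, {subset r <= E} ->
  \big[Num.max/0]_(t <- r) translate_weight (u * t)%g s =
  action_density m phi u s * \big[Num.max/0]_(t <- r) translate_weight t (phi u s).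
  elim => [|t r IH] rE; first by rewrite !big_nil mulr0.
  rewrite !big_cons maxr_pMr ?action_density_ge0// IH; last first.
    by move=> v vr; apply: rE; rewrite inE vr orbT.
  by congr (Num.max _ _); rewrite /translate_weight Hs ?rE ?mem_head// actionM mulrA.
by move=> /(_ E (fun=> id)); rewrite -!big_seq.
Qed.

End Action.

(** * Balls in a free group *)

Section WordBall.
Context {r : nat} {G : groupType}.
Variable a : 'I_r -> G.
Hypothesis hG : free_generators a.
Local Notation letter := ('I_r * bool)%type.

Lemma word_val_cat w1 w2 : word_val a (w1 ++ w2) = (word_val a w1 * word_val a w2)%g.
Proof. by rewrite /word_val big_cat. Qed.

Lemma word_val_cons x w : word_val a (x :: w) = (letter_val a x * word_val a w)%g.
Proof. by rewrite /word_val big_cons. Qed.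

Definition cancelling (x y : letter) : bool := (x.1 == y.1) && (x.2 != y.2).

Lemma letter_val_cancel x y : cancelling x y -> (letter_val a x * letter_val a y)%g = 1%g.
Proof.
case: x y => [i b] [j c] /andP[/= /eqP <-]; rewrite /letter_val/=.
by case: b c => -[]//= _; rewrite ?mulgV ?mulVg.
Qed.

Lemma exists_reduced w : exists w', [/\ reduced w', word_val a w' = word_val a w &
  (size w' <= size w)%N].
Proof.
elim: w => [|x w [w' [rw' vw' sw']]]; first by exists [::].
case: w' rw' vw' sw' => [|y w'] rw' vw' sw'.
  by exists [:: x]; split => //; rewrite !word_val_cons -vw'.
have [xy|nxy] := boolP (cancelling x y).
  exists w'; split.
  - by move: rw'; rewrite /reduced/=; exact: path_sorted.
  - by rewrite word_val_cons -vw' word_val_cons mulgA letter_val_cancel// mul1g.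
  - by apply: leq_trans (leqW sw') => /=; exact: leqnSn.
exists (x :: y :: w'); split => //.
- by rewrite /reduced/= nxy.
- by rewrite [LHS]word_val_cons vw' -word_val_cons.
Qed.

Lemma word_lengthP t : (exists2 w, size w = word_length a t & word_val a w = t) /\
  (forall w, word_val a w = t -> (word_length a t <= size w)%N).
Proof.
rewrite /word_length; apply: (xgetPex 0%N (P := [set n | (exists2 w, size w = n & word_val a w = t) /\
                    (forall w, word_val a w = t -> (n <= size w)%N)])).
have [w0 [[_ vw0] _]] := hG t.
have ex : exists n, `[< exists2 w, size w = n & word_val a w = t >].
  by exists (size w0); apply/asboolP; exists w0.
case: (ex_minnP ex) => n /asboolP nw nmin; exists n; split => // w vw.
by apply: nmin; apply/asboolP; exists w.
Qed.

Lemma word_length_leP t n : (word_length a t <= n)%N <->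
  exists w, [/\ reduced w, (size w <= n)%N & word_val a w = t].
Proof.
have [[w sw vw] lmin] := word_lengthP t; split.
  move=> tn; have [w' [rw' vw' sw']] := exists_reduced w.
  by exists w'; split => //; [rewrite (leq_trans sw')// sw|rewrite vw'].
by move=> [w' [_ sw' vw']]; rewrite (leq_trans (lmin _ vw')).
Qed.

Fixpoint reduced_words (n : nat) : seq (seq letter) :=
  if n is n'.+1 then
    [seq x :: w | w <- reduced_words n', x <- [seq x <- enum {: letter} | reduced (x :: w)]]
  else [:: [::]].

Lemma mem_reduced_words n w : (w \in reduced_words n) = (size w == n) && reduced w.
Proof.
elim: n w => [|n IH] w /=; first by case: w => [|x w]//=.
apply/allpairsPdep/idP => [[w' [x [w'n xin ->]]]|].
  move: w'n xin; rewrite IH mem_filter => /andP[/eqP <- _] /andP[rw _].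
  by rewrite /= eqxx rw.
case: w => [|x w]//=; rewrite eqSS => /andP[sw rw]; exists w, x; split => //.
- by rewrite IH sw/=; move: rw; rewrite /reduced/=; exact: path_sorted.
- by rewrite mem_filter rw mem_enum.
Qed.

Lemma reduced_words_uniq n : uniq (reduced_words n).
Proof.
elim: n => [//|n IH] /=; apply: allpairs_uniq_dep => //.
- by move=> w _; rewrite filter_uniq// enum_uniq.
- by move=> [w1 x1] [w2 x2] _ _ /= [-> ->].
Qed.

Lemma size_reduced_words1 : size (reduced_words 1) = (2 * r)%N.
Proof.
rewrite /= cats0 size_map (eq_in_filter (a2 := predT)) ?filter_predT; last by [].
by rewrite -cardE card_prod card_ord card_bool mulnC.
Qed.

(** Among the [2 * r] letters only the inverse of the head is excluded. The empty word excludes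
    none, hence the start at [n.+2]. *)
Lemma size_reduced_words_step n :
  size (reduced_words n.+2) = ((2 * r).-1 * size (reduced_words n.+1))%N.
Proof.
have -> : reduced_words n.+2 = [seq x :: w | w <- reduced_words n.+1,
    x <- [seq x <- enum {: letter} | reduced (x :: w)]] by [].
rewrite size_allpairs_dep; set s := reduced_words n.+1.
have : forall w, w \in s ->
  size [seq x <- enum {: letter} | reduced (x :: w)] = (2 * r).-1.
  move=> w; rewrite mem_reduced_words; case: w => [|y w]//= /andP[_ rw].
  rewrite size_filter (eq_count (a2 := predC (pred1 (y.1, ~~ y.2)))); last first.
    move=> x; rewrite /reduced/= in rw *; rewrite rw andbT.
    case: x y {rw} => [i b] [j c] /=; rewrite xpair_eqE.
    by case: eqP => //= _; case: b c => -[].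
  have := count_predC (pred1 (y.1, ~~ y.2)) (enum {: letter}).
  rewrite -cardE card_prod card_ord card_bool count_uniq_mem ?enum_uniq// mem_enum/=.
  by rewrite add1n mulnC => <-.
move: s => s H; have -> : [seq size [seq x <- enum {: letter} | reduced (x :: w)] | w <- s] =
   nseq (size s) (2 * r).-1.
  elim: s H => //= w s IH H; rewrite H ?mem_head//= IH// => v vs.
  by apply: H; rewrite inE vs orbT.
by rewrite sumn_nseq.
Qed.

Hypothesis hr : (2 <= r)%N.

Lemma size_reduced_words_ge n : ((2 * r).-1 ^ n <= size (reduced_words n))%N.
Proof.
case: n => [//|n]; elim: n => [|n IH]; first by rewrite size_reduced_words1 expn1 leq_pred.
by rewrite size_reduced_words_step expnS leq_mul2l IH orbT.
Qed.

(** With q = 2 r - 1 the induction step asks for 2 + (q + 1) <= 2 q, that is q >= 3, which is rank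
    at least 2. *)
Lemma size_reduced_words_sum n :
  (\sum_(j < n.+1) size (reduced_words j) <= 2 * (2 * r).-1 ^ n)%N.
Proof.
have step j : size (reduced_words j.+1) = (2 * r * (2 * r).-1 ^ j)%N.
  elim: j => [|j IH]; first by rewrite size_reduced_words1 expn0 muln1.
  by rewrite size_reduced_words_step IH expnS mulnCA.
have q3 : (3 <= (2 * r).-1)%N by move: hr; lia.
have qE : (2 * r = (2 * r).-1.+1)%N by move: hr; lia.
elim: n => [|n IH]; first by rewrite big_ord_recr big_ord0/= expn0.
rewrite big_ord_recr/= step (leq_trans (leq_add IH (leqnn _)))//.
rewrite -mulnDl expnS mulnA leq_mul2r; apply/orP; right.
rewrite {1}qE; lia.
Qed.

Lemma mem_word_ball n t : (t \in word_ball a n) = (word_length a t <= n)%N.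
Proof.
(* [fset_set] is empty on infinite sets, so the ball must first be shown finite. *)
have fin : finite_set [set t : G | (word_length a t <= n)%N].
  apply: (@sub_finite_set _ _ [set` [seq word_val a w | w <- flatten [seq reduced_words j | j <- iota 0 n.+1]]]).
    move=> s /word_length_leP[w [rw sw vw]].
    apply/mapP; exists w => //; apply/flattenP; exists (reduced_words (size w)).
      by apply: map_f; rewrite mem_iota.
    by rewrite mem_reduced_words eqxx.
  exact: finite_seq.
by rewrite /word_ball in_fset_set//; apply/idP/idP; rewrite inE.
Qed.

Lemma card_word_ball_ge n : ((2 * r).-1 ^ n <= #|` word_ball a n|)%N.
Proof.
apply: (leq_trans (size_reduced_words_ge n)).
rewrite -(size_map (word_val a)); apply: uniq_leq_size.
  rewrite map_inj_in_uniq ?reduced_words_uniq// => w1 w2.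
  rewrite !mem_reduced_words => /andP[_ rw1] /andP[_ rw2] e.
  have [w [_ wu]] := hG (word_val a w1).
  by rewrite -(wu w1)// -(wu w2)//; split => //; rewrite e.
move=> t /mapP[w]; rewrite mem_reduced_words => /andP[/eqP sw rw] ->.
rewrite -[_ \in _]/(_ \in word_ball a n) mem_word_ball.
by apply/word_length_leP; exists w; split => //; rewrite sw.
Qed.

Lemma card_word_ball_le n : (#|` word_ball a n| <= 2 * (2 * r).-1 ^ n)%N.
Proof.
apply: leq_trans (size_reduced_words_sum n).
pose s := flatten [seq [seq word_val a w | w <- reduced_words j] | j <- iota 0 n.+1].
have -> : (\sum_(j < n.+1) size (reduced_words j))%N = size s.
  rewrite /s size_flatten /shape -map_comp sumnE big_map.
  rewrite -[iota 0 n.+1]/(index_iota 0 n.+1) big_mkord.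
  by apply: eq_bigr => j _; rewrite /= size_map.
apply: uniq_leq_size; first exact: fset_uniq.
move=> t; rewrite -[_ \in _]/(_ \in word_ball a n) mem_word_ball => /word_length_leP[w [rw sw <-]].
apply/flattenP; exists [seq word_val a w | w <- reduced_words (size w)].
  by apply: (map_f (fun j => [seq word_val a w | w <- reduced_words j])); rewrite mem_iota.
by apply: map_f; rewrite mem_reduced_words eqxx.
Qed.

Lemma word_ball_cover n k t : t \in word_ball a (n + k) ->
  exists2 u, u \in word_ball a k & exists2 v, v \in word_ball a n & t = (u * v)%g.
Proof.
rewrite mem_word_ball => /word_length_leP[w [rw sw <-]].
exists (word_val a (take k w)).
  rewrite mem_word_ball; apply: (leq_trans ((word_lengthP _).2 _ erefl)).
  by rewrite size_take; case: ltnP.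
exists (word_val a (drop k w)); last by rewrite -word_val_cat cat_take_drop.
rewrite mem_word_ball; apply: (leq_trans ((word_lengthP _).2 _ erefl)).
by rewrite size_drop leq_subLR addnC.
Qed.

(** Cardinals of balls lie between q^n and 2 q^n with q = 2 r - 1; the constant 4 is the product of
    the two upper factors. *)
Lemma card_word_ball_mul n k :
  (#|` word_ball a k| * #|` word_ball a n| <= 4 * #|` word_ball a (n + k)|)%N.
Proof.
apply: (leq_trans (leq_mul (card_word_ball_le k) (card_word_ball_le n))).
rewrite mulnACA -expnD addnC (_ : 2 * 2 = 4)%N// leq_mul2l/=.
exact: card_word_ball_ge.
Qed.

Lemma card_word_ball_gt n : (n < #|` word_ball a n|)%N.
Proof.
apply: leq_trans (card_word_ball_ge n); apply: ltn_expl.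
by move: hr; lia.
Qed.

End WordBall.

(** * From a positive limsup to a lower bound for all averages *)

Section Liminf.
Context {R : realType} (alpha : R) (halpha : 0 < alpha < 2).
Context {r : nat} (hr : (2 <= r)%N) {G : groupType} (a : 'I_r -> G) (hG : free_generators a).
Context {d : measure_display} {S : measurableType d}.
Variables (m : {sigma_finite_measure set S -> \bar R}) (phi : G -> S -> S).
Hypotheses (hphi : group_action phi) (hns : nonsingular m phi).
Variable f : S -> R.
Hypothesis hf : Lalpha m alpha f.

Let mf : measurable_fun setT f. Proof. by case: hf. Qed.
Let alpha0 : 0 < alpha. Proof. by case/andP: halpha. Qed.
Let N n := #|` word_ball a n|.
Let w := translate_weight m phi alpha f.
Let mxi := max_integral m phi alpha f.

Let w0 t s : 0 <= w t s. Proof. exact: translate_weight_ge0. Qed.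
Let mw t : measurable_fun setT (w t). Proof. exact: measurable_translate_weight. Qed.

Lemma max_integral_le_sum (E : seq G) (F : seq (seq G)) :
  (forall t, t \in E -> exists2 F', F' \in F & t \in F') ->
  (mxi E <= \sum_(F' <- F) mxi F')%E.
Proof.
move=> EF; rewrite /mxi /max_integral -ge0_integral_sum//; last 2 first.
- by move=> F'; apply/measurable_EFinP; apply: measurable_bigmax.
- by move=> F' s _; rewrite lee_fin bigmax0_ge0.
apply: ge0_le_integral => //.
- by move=> s _; rewrite lee_fin bigmax0_ge0.
- by apply/measurable_EFinP; apply: measurable_bigmax.
- apply: emeasurable_sum => F'; apply/measurable_EFinP; exact: measurable_bigmax.
- move=> s _; rewrite sumEFin lee_fin; apply/bigmax0_leP.
    by apply: sumr_ge0 => F' _; exact: bigmax0_ge0.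
  move=> t tE; have [F' F'F tF'] := EF t tE.
  rewrite (le_trans (bigmax0_ge (fun t => w t s) tF'))//.
  rewrite (big_rem F')//= lerDl; apply: sumr_ge0 => ? _; exact: bigmax0_ge0.
Qed.

Lemma max_integral_ge0 E : (0 <= mxi E)%E.
Proof. by apply: integral_ge0 => s _; rewrite lee_fin bigmax0_ge0. Qed.

Definition Lalpha_norm : R := fine (\int[m]_s (`|f s| `^ alpha)%:E)%E.

Lemma Lalpha_normE : (\int[m]_s (`|f s| `^ alpha)%:E = Lalpha_norm%:E)%E.
Proof.
rewrite fineK// ge0_fin_numE; first by case: hf.
by apply: integral_ge0 => s _; rewrite lee_fin powR_ge0.
Qed.

Lemma Lalpha_norm_ge0 : 0 <= Lalpha_norm.
Proof. by rewrite fine_ge0// integral_ge0// => s _; rewrite lee_fin powR_ge0. Qed.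

Lemma max_integral_le (E : seq G) : (mxi E <= (Lalpha_norm *+ size E)%:E)%E.
Proof.
apply: (le_trans (max_integral_le_sum (F := [seq [:: t] | t <- E]) _)).
  by move=> t tE; exists [:: t]; [exact: map_f|rewrite mem_head].
rewrite big_map.
have -> : (Lalpha_norm *+ size E)%:E = (\sum_(t <- E) Lalpha_norm%:E)%E.
  by rewrite sumEFin big_const_seq count_predT iter_addr_0.
apply: lee_sum => t _; rewrite /mxi /max_integral.
under eq_integral do rewrite big_cons big_nil max_l//.
by rewrite integral_translate_weight// Lalpha_normE.
Qed.

Definition ball_integral n : R := fine (mxi (word_ball a n)).

Lemma ball_integralE n : mxi (word_ball a n) = (ball_integral n)%:E.
Proof.
rewrite fineK// ge0_fin_numE ?max_integral_ge0//.
exact: le_lt_trans (max_integral_le _) (ltry _).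
Qed.

Lemma ball_integral_ge0 n : 0 <= ball_integral n.
Proof. by rewrite fine_ge0// max_integral_ge0. Qed.

Lemma ball_integral_le n : ball_integral n <= Lalpha_norm * (N n)%:R.
Proof. by rewrite -lee_fin -ball_integralE mulr_natr max_integral_le. Qed.

(* Left translates of the ball of radius [n] by the ball of radius [k] cover the
   ball of radius [n + k], and left translation preserves the integrals. *)
Lemma ball_integral_submul n k : ball_integral (n + k) <= (N k)%:R * ball_integral n.
Proof.
rewrite -lee_fin -ball_integralE.
pose F := [seq [seq (u * v)%g | v <- word_ball a n] | u <- word_ball a k].
apply: (le_trans (max_integral_le_sum (F := F) _)).
  move=> t tnk; have [u uk [v vn ->]] := word_ball_cover hG tnk.
  exists [seq (u * v)%g | v <- word_ball a n]; first exact: (map_f (fun u => [seq (u * v)%g | v <- word_ball a n])).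
  exact: map_f.
rewrite /F big_map; under eq_bigr do rewrite /mxi max_integral_translate// -/mxi ball_integralE.
by rewrite sumEFin big_const_seq count_predT iter_addr_0 mulr_natl.
Qed.

Definition ball_average n : R := ball_integral n / (N n)%:R.

Lemma card_ball_gt0 n : (0 < N n)%N.
Proof. exact: leq_ltn_trans (card_word_ball_gt hG hr n). Qed.

Lemma ball_average_ge0 n : 0 <= ball_average n.
Proof. by rewrite divr_ge0// ball_integral_ge0. Qed.

Lemma ball_average_le n : ball_average n <= Lalpha_norm.
Proof. by rewrite ler_pdivrMr ?ltr0n ?card_ball_gt0// ball_integral_le. Qed.

(** Each average dominates all later ones up to the factor 4, so a positive limsup bounds every
    single average from below, not merely infinitely many. *)
Lemma ball_average_quasi_decreasing n k : ball_average (n + k) <= 4 * ball_average n.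
Proof.
have Np j : 0 < (N j)%:R :> R by rewrite ltr0n card_ball_gt0.
rewrite ler_pdivrMr//; apply: (le_trans (ball_integral_submul n k)).
have := card_word_ball_mul hG hr n k; rewrite -(ler_nat R) !natrM => h.
have := ler_wpM2r (ball_average_ge0 n) h.
rewrite /ball_average; set b := ball_integral n.
rewrite -/(N k) -/(N n) -/(N (n + k)).
have -> : (N k)%:R * (N n)%:R * (b / (N n)%:R) = (N k)%:R * b.
  by field; exact: lt0r_neq0.
by move=> h2; apply: (le_trans h2); rewrite mulrAC.
Qed.

Lemma b_ratioE n : b_ratio m a phi alpha f n = (ball_average n `^ alpha^-1)%:E.
Proof.
have Np : 0 < (N n)%:R :> R by rewrite ltr0n card_ball_gt0.
rewrite /b_ratio /b_seq -[X in (X `^ _)%E]/(mxi (word_ball a n)) ball_integralE.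
rewrite poweR_EFin -EFinM /ball_scale /ball_average.
rewrite powRM ?ball_integral_ge0 ?invr_ge0 ?ler0n//.
rewrite -[(N n)%:R^-1]powR_inv1; last exact: ltW.
by rewrite -powRrM mulN1r powRN.
Qed.

Lemma ball_average_bounded_below :
  (0 < limn_esup (b_ratio m a phi alpha f))%E ->
  exists2 c, 0 < c & forall n, c <= ball_average n.
Proof.
set b := b_ratio m a phi alpha f => lpos.
have ub n : (limn_esup b <= ((4 * ball_average n) `^ alpha^-1)%:E)%E.
  rewrite limn_esup_lim; apply: (@le_trans _ _ (esups b n)).
    rewrite (cvg_lim _ (@cvg_esups_inf _ b))//.
    by apply: ereal_inf_lbound; exists n.
  apply: ge_ereal_sup => _ [j /= nj <-].
  rewrite /b b_ratioE lee_fin; apply: ge0_ler_powR.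
  - by rewrite invr_ge0 ltW.
  - by rewrite nnegrE ball_average_ge0.
  - by rewrite nnegrE mulr_ge0// ball_average_ge0.
  - by have := ball_average_quasi_decreasing n (j - n); rewrite subnKC.
have lfin : limn_esup b \is a fin_num.
  by rewrite ge0_fin_numE ?(ltW lpos)// (le_lt_trans (ub 0%N))// ltry.
pose l := fine (limn_esup b).
have lE : limn_esup b = l%:E by rewrite /l fineK.
have l0 : 0 < l by rewrite -lte_fin -lE.
exists (l `^ alpha / 4); first by rewrite divr_gt0// powR_gt0.
move=> n; rewrite ler_pdivrMr// mulrC.
have := ub n; rewrite lE lee_fin => h.
have h2 : l `^ alpha <= ((4 * ball_average n) `^ alpha^-1) `^ alpha.
  by apply: ge0_ler_powR; rewrite ?nnegrE ?powR_ge0// ltW.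
move: h2; rewrite -powRrM mulVf ?gt_eqF// powRr1//.
by rewrite mulr_ge0// ball_average_ge0.
Qed.

Lemma limn_einf_b_ratio_gt0 : (0 < limn_esup (b_ratio m a phi alpha f))%E ->
  (0 < limn_einf (b_ratio m a phi alpha f))%E.
Proof.
move=> /ball_average_bounded_below[c c0 H].
apply: (@lt_le_trans _ _ (c `^ alpha^-1)%:E); first by rewrite lte_fin powR_gt0.
rewrite limn_einf_lim.
rewrite (cvg_lim _ (@cvg_einfs_sup _ (b_ratio m a phi alpha f)))//.
apply: (@le_trans _ _ (einfs (b_ratio m a phi alpha f) 0%N)); last first.
  by apply: ereal_sup_ubound; exists 0%N.
apply: le_ereal_inf_tmp => _ [j /= _ <-]; rewrite b_ratioE lee_fin.
by apply: ge0_ler_powR; rewrite ?nnegrE ?ball_average_ge0// ?H// ?invr_ge0 ltW.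
Qed.

End Liminf.

(** * Stochastic integrals over a common refinement *)

Lemma measurable_norm_ge {R : realType} {d} {T : measurableType d} (V : T -> R) x :
  measurable_fun setT V -> measurable [set w | x <= `|V w|].
Proof.
move=> mV; rewrite (_ : mkset _ = setT `&` (fun w => `|V w|) @^-1` `[x, +oo[).
  have mN : measurable_fun setT (fun w => `|V w|) by exact: measurableT_comp.
  exact: mN.
by apply/seteqP; split=> w /=; rewrite in_itv/= andbT // => -[].
Qed.

(** A substitute for the triangle inequality with main coefficient close to 1, on both sides of
    [alpha = 1]: either [|x| <= (1 + k) * |y|], or [|x|] is at most [(1 + k^-1) * |x - y|]. *)
Lemma powR_norm_le_perturbed {R : realType} (alpha e : R) : 0 < alpha < 2 -> 0 < e ->
  exists2 C, 0 < C & forall x y : R,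
    `|x| `^ alpha <= (1 + e) * `|y| `^ alpha + C * `|x - y| `^ alpha.
Proof.
(* As [alpha < 2] and [k <= 1], [(1 + k) ^ alpha <= 1 + 3 * k <= 1 + e]. *)
move=> /andP[a0 a2] e0; pose k := Num.min 1 (e / 3).
have k0 : 0 < k by rewrite lt_min ltr01 divr_gt0.
have k1 : k <= 1 by rewrite ge_min lexx.
have ke : k <= e / 3 by rewrite ge_min lexx orbT.
have kV : 0 < k^-1 by rewrite invr_gt0.
have kk : (1 + k^-1) * k = 1 + k by rewrite mulrDl mulVf ?gt_eqF// mul1r addrC.
clearbody k.
exists ((1 + k^-1) `^ alpha); first by rewrite powR_gt0//; lra.
move=> x y; have [xy|xy] := leP `|x| ((1 + k) * `|y|).
  rewrite -[leLHS]addr0; apply: lerD; last by apply: mulr_ge0; exact: powR_ge0.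
  apply: (@le_trans _ _ (((1 + k) * `|y|) `^ alpha)).
    by apply: ge0_ler_powR => //; rewrite ?nnegrE ?(ltW a0)// (le_trans (normr_ge0 x) xy).
  rewrite powRM//; last by lra.
  apply: ler_wpM2r; first exact: powR_ge0.
  apply: (@le_trans _ _ ((1 + k) `^ 2)).
    by apply: ler_powR; lra.
  rewrite powR_mulrn ?expr2; last by lra.
  by nra.
rewrite -[leLHS]add0r; apply: lerD; first by apply: mulr_ge0; [lra|exact: powR_ge0].
rewrite -powRM//; last by lra.
apply: ge0_ler_powR; first exact: ltW.
- by rewrite nnegrE.
- by rewrite nnegrE; apply: mulr_ge0 => //; lra.
have xyd := lerB_dist x y.
have kx : k * `|x| <= (1 + k) * `|x - y| by nra.
by rewrite -(ler_pM2l k0) mulrA [k * (1 + _)]mulrC kk.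
Qed.

Lemma fine_integral_le {R : realType} {d} {S : measurableType d}
    (m : {measure set S -> \bar R}) (c e : R) (u v w : S -> R) :
  measurable_fun setT u -> measurable_fun setT v -> measurable_fun setT w ->
  (forall s, 0 <= u s) -> (forall s, 0 <= v s) -> (forall s, 0 <= w s) -> 0 <= c ->
  (\int[m]_s (v s)%:E < +oo)%E -> (\int[m]_s (w s)%:E <= e%:E)%E ->
  (forall s, u s <= c * v s + w s) ->
  fine (\int[m]_s (u s)%:E)%E <= c * fine (\int[m]_s (v s)%:E)%E + e.
Proof.
move=> mu mv mw u0 v0 w0 c0 voo we uvw.
have V0 : (0 <= \int[m]_s (v s)%:E)%E by apply: integral_ge0 => s _; rewrite lee_fin.
have U0 : (0 <= \int[m]_s (u s)%:E)%E by apply: integral_ge0 => s _; rewrite lee_fin.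
have H : (\int[m]_s (u s)%:E <= (c * fine (\int[m]_s (v s)%:E)%E + e)%:E)%E.
  rewrite EFinD EFinM fineK ?ge0_fin_numE//.
  apply: le_trans (leeD2l _ we).
  rewrite -ge0_integralZl//; [|exact/measurable_EFinP|by move=> s _; rewrite lee_fin].
  rewrite -ge0_integralD//; last 4 first.
  - by move=> s _; rewrite -EFinM lee_fin mulr_ge0.
  - by apply/measurable_EFinP; exact: measurable_funM.
  - by move=> s _; rewrite lee_fin.
  - exact/measurable_EFinP.
  apply: ge0_le_integral => //.
  - by move=> s _; rewrite lee_fin.
  - exact/measurable_EFinP.
  - apply: emeasurable_funD; apply/measurable_EFinP => //; exact: measurable_funM.
  - by move=> s _; rewrite -EFinM -EFinD lee_fin.
rewrite -lee_fin fineK// ge0_fin_numE//; exact: le_lt_trans H (ltry _).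
Qed.

Section RandomMeasure.
Import HBSimple.
Context {R : realType} {d : measure_display} {S : measurableType d}.
Variables (m : {measure set S -> \bar R}) (alpha : R).
Context {dT : measure_display} {T : measurableType dT} {P : probability T R}.
Variable M : set S -> {RV P >-> R}.
Hypothesis halpha : 0 < alpha < 2.
Hypothesis hM : SaS_random_measure m alpha M.

(** Countable additivity along the constant empty sequence: a convergent series has terms tending to
    0, and here they are all equal. *)
Lemma random_measure0 : {ae P, forall w, M set0 w = 0}.
Proof.
have [rM _ _] := hM.
have := rM (fun=> set0) (fun=> measurable0) (@trivIset_set0 _ _ _).
rewrite bigcup0// measure0 => /(_ (ltry _)).
apply: filterS => w /= cM.
have := cvg_series_cvg_0 (cvgP _ cM).
move=> /cvg_lim <- //; rewrite lim_cst //.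
Qed.

Lemma random_measure_finite_additive k (A : 'I_k -> set S) (Q : pred 'I_k) :
    (forall i, measurable (A i)) -> (forall i, (m (A i) < +oo)%E) ->
    trivIset [set: 'I_k] A ->
  {ae P, forall w, M (\bigcup_(i in [set i | Q i]) A i) w = \sum_(i | Q i) M (A i) w}.
Proof.
move=> mA mAoo tA.
have [rM _ _] := hM.
pose B n := if insub n is Some i then if Q i then A i else set0 else set0.
have BE (i : 'I_k) : B i = if Q i then A i else set0 by rewrite /B valK.
have Bout n : (k <= n)%N -> B n = set0.
  by move=> kn; rewrite /B; case: insubP => // i; rewrite ltnNge kn.
have UB : \bigcup_n B n = \bigcup_(i in [set i | Q i]) A i.
  apply/seteqP; split=> [s [n _]|s [i/= Qi Ai]].
    by rewrite /B; case: insubP => // i _ _; case: ifPn => // Qi As; exists i.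
  by exists i => //; rewrite BE Qi.
have mB n : measurable (B n).
  by rewrite /B; case: insubP => // i _ _; case: ifPn.
have tB : trivIset [set: nat] B.
  move=> n1 n2 _ _ []s []; rewrite /B.
  case: insubP => // i _ <-; case: ifPn => // _ Ai.
  case: insubP => // j _ <-; case: ifPn => // _ Aj.
  by congr (nat_of_ord _); apply: tA => //; exists s.
have UBoo : (m (\bigcup_n B n) < +oo)%E.
  have -> : \bigcup_n B n = \bigcup_(n in `I_k) B n.
    apply/seteqP; split=> s [n/= nk Bs]; exists n => //=.
    by rewrite ltnNge; apply/negP => kn; move: Bs; rewrite Bout.
  rewrite bigcup_mkord (le_lt_trans (Boole_inequality m _))//.
  by apply/lte_sum_pinfty => i _; rewrite BE; case: (Q i); rewrite ?mAoo// (@measure0 _ _ _ m) ltry.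
have := rM B mB tB UBoo.
have := random_measure0.
apply: filterS2 => w M0 /= cM.
rewrite -UB; apply: (cvg_unique _ cM); first exact: norm_hausdorff.
apply: cvg_near_cst; near=> n.
have kn : (k <= n)%N by near: n; exact: nbhs_infty_ge.
rewrite /series/= (@big_cat_nat _ _ _ k 0 n)//= [X in _ + X]big_nat_cond [X in _ + X]big1 ?addr0; last first.
  by move=> i /andP[/andP[ki _] _]; rewrite Bout.
rewrite big_mkord [RHS]big_mkcond; apply: eq_bigr => i _.
by rewrite BE; case: ifPn => // _; rewrite M0.
Unshelve. all: by end_near. Qed.

Lemma simple_integralE (h : {sfun S >-> R}) w : simple_integral M h w =
  \sum_(x <- fset_set (range h)) x * M (h @^-1` [set x]) w.
Proof. by rewrite /simple_integral fsbig_finite//; exact: fimfunP. Qed.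

Lemma measurable_simple_integral (h : {sfun S >-> R}) :
  measurable_fun setT (simple_integral M h).
Proof.
rewrite (_ : simple_integral M h =
    fun w => \sum_(x <- fset_set (range h)) x * M (h @^-1` [set x]) w); last first.
  by apply/funext => w; rewrite simple_integralE.
by apply: measurable_sum_fun => x; exact: measurable_funM.
Qed.

(** When [A] is empty the level 1 is not attained, and the equality rests on [M set0 w = 0]. *)
Lemma simple_integral_indic (A : set S) (mA : measurable A) w :
  M set0 w = 0 -> simple_integral M (indic_sfun A mA) w = M A w.
Proof.
move=> M0; rewrite /simple_integral.
rewrite (@fsbig_fwiden _ _ 0 +%R [:: 0; 1])/=.
- rewrite !big_cons big_nil mul0r add0r addr0 mul1r; congr (M _ w).
  apply/seteqP; split=> s /=; rewrite mindicE.
    by case: (boolP (s \in A)) => [/set_mem//|_ /esym/eqP]; rewrite oner_eq0.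
  by move=> As; rewrite mem_set.
- move=> x [s _ <-]; rewrite /= mindicE !inE.
  by case: (s \in A); rewrite /= eqxx ?orbT.
- by rewrite !inE eq_sym oner_eq0.
- move=> x [_ /= nr]; rewrite (_ : _ @^-1` _ = set0) ?M0 ?mulr0//.
  by apply/seteqP; split=> // s sx; apply: nr; exists s.
Qed.

(** [M A] is the stochastic integral of the indicator of [A], with a constant approximating
    sequence; the real and imaginary parts of its characteristic function are the required means. *)
Lemma stable_law_random_measure (A : set S) : measurable A -> (m A < +oo)%E ->
  stable_law alpha P (M A) (fine (m A)).
Proof.
move=> mA Aoo; have [_ _ cf] := hM; have a0 : alpha != 0 by case/andP: halpha => a0 _; rewrite gt_eqF.
have normE s : `|indic_sfun A mA s| `^ alpha = \1_A s.
  rewrite (_ : indic_sfun A mA s = \1_A s)// indicE; case: (s \in A); rewrite ?normr1 ?powR1//.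
  by rewrite normr0 powR0.
have intE : (\int[m]_s (`|indic_sfun A mA s| `^ alpha)%:E = m A)%E.
  under eq_integral do rewrite normE.
  by rewrite integral_indic// setIT.
have LA : Lalpha m alpha (indic_sfun A mA) by split=> //; rewrite intE.
have sA : stochastic_integral m alpha M (indic_sfun A mA) (M A).
  exists (fun=> indic_sfun A mA); split=> //.
    apply: cvg_near_cst; near=> n.
    by apply: integral0_eq => s _; rewrite subrr normr0 powR0.
  move=> eps eps0; apply: cvg_near_cst; near=> n.
  apply: measure_negligible.
    apply: measurable_norm_ge.
    by apply: measurable_funB => //; exact: measurable_simple_integral.
  apply: negligibleS random_measure0 => w/= + M0.
  by rewrite (simple_integral_indic mA M0) subrr normr0 leNgt eps0.
split; [exact: measurable_funPT|exact: fine_ge0| |].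
- move=> t; have := cf _ _ t LA sA; rewrite intE => -[-> _]//.
- move=> t; have := cf _ _ t LA sA; rewrite intE => -[_ ->]//.
Unshelve. all: by end_near. Qed.

Lemma mutually_independent_random_measure k (A : 'I_k -> set S) :
    (forall i, measurable (A i)) -> (forall i, (m (A i) < +oo)%E) ->
    trivIset [set: 'I_k] A ->
  mutually_independent P (fun i => M (A i)).
Proof.
by move=> mA Aoo tA B mB; have [_ ind _] := hM; apply: ind => // i; split.
Qed.

Section CommonRefinement.
Context {N : nat}.
Variable h : 'I_N -> {sfun S >-> R}.
Hypothesis Lh : forall j, Lalpha m alpha (h j).

Let vals : {fset R} := fset_set (\bigcup_j range (h j)).

Let h_vals j s : h j s \in vals.
Proof.
rewrite in_fset_set; first by apply/mem_set; exists j => //; exists s.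
by apply: bigcup_finite => // i _; exact: fimfunP.
Qed.

(** Cells are indexed by vectors of joint values. The zero vector is excluded because its cell may
    have infinite measure, and unattained vectors because their entries need not be values of the
    corresponding [h j]. *)
Let cell_index : {pred {ffun 'I_N -> vals}} :=
  [pred x : {ffun 'I_N -> vals} | [exists j, val (x j) != 0] && `[< exists s, forall j, h j s = val (x j) >]].

Definition refinement_size : nat := #|cell_index|.

Definition refinement_coef (j : 'I_N) (i : 'I_refinement_size) : R :=
  val ((enum_val i : {ffun 'I_N -> vals}) j).

Definition refinement_cell (i : 'I_refinement_size) : set S :=
  [set s | forall j, h j s = refinement_coef j i].

Local Notation a := refinement_coef.
Local Notation A := refinement_cell.

Lemma refinement_cell_nonempty i : exists s, A i s.
Proof. by have /andP[_ /asboolP[s hs]] := enum_valP i; exists s. Qed.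

Lemma refinement_coef_neq0 i : exists j, a j i != 0.
Proof. by have /andP[/existsP[j j0] _] := enum_valP i; exists j. Qed.

Lemma refinement_cover s j : h j s != 0 -> exists i, A i s.
Proof.
move=> hs0; pose x := [ffun j => [` h_vals j s]%fset].
have xc : x \in cell_index.
  apply/andP; split; first by apply/existsP; exists j; rewrite ffunE.
  by apply/asboolP; exists s => k; rewrite ffunE.
by exists (enum_rank_in xc x) => k; rewrite /refinement_coef enum_rankK_in// ffunE.
Qed.

Lemma refinement_cell_unique s i i' : A i s -> A i' s -> i = i'.
Proof.
move=> Ai Ai'; apply: enum_val_inj; apply/ffunP => j; apply: val_inj.
by rewrite -[LHS](Ai j) -[RHS](Ai' j).
Qed.

Lemma trivIset_refinement_cell : trivIset [set: 'I_refinement_size] A.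
Proof. by move=> i i' _ _ [s [Ai Ai']]; exact: refinement_cell_unique Ai Ai'. Qed.

Lemma measurable_refinement_cell i : measurable (A i).
Proof.
rewrite (_ : A i = \bigcap_(j in [set: 'I_N]) (h j @^-1` [set a j i])); last first.
  by apply/seteqP; split=> [s As j _|s As j]; [exact: As|exact: As].
apply: fin_bigcap_measurable => // j _.
Qed.

(** Markov's inequality for some [h j] whose value on the cell is nonzero. *)
Lemma refinement_cell_fin i : (m (A i) < +oo)%E.
Proof.
have [j j0] := refinement_coef_neq0 i; have [mh hoo] := Lh j.
have c0 : 0 < `|a j i| `^ alpha by rewrite powR_gt0 ?normr_gt0.
have mA := measurable_refinement_cell i.
have : ((`|a j i| `^ alpha)%:E * m (A i) < +oo)%E.
  apply: le_lt_trans hoo; rewrite -(integral_cst m mA).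
  under eq_integral => s /set_mem As do rewrite -[cst _ _]/((`|a j i| `^ alpha)%:E) -As.
  apply: ge0_subset_integral => //.
  apply/measurable_EFinP; apply: (measurableT_comp (measurable_powR alpha)).
  exact: measurableT_comp.
case: (m (A i)) (measure_ge0 m (A i)) => // [x _ _|_]; first exact: ltry.
by rewrite gt0_muley// lte_fin.
Qed.

Lemma integral_refinement (F : ('I_N -> R) -> R) :
    F (fun=> 0) = 0 -> (forall x, 0 <= F x) ->
  (\int[m]_s (F (fun j => h j s))%:E)%E =
  (\sum_i F (fun j => a j i) * fine (m (A i)))%:E.
Proof.
move=> F0 Fge0.
have FE s : (F (fun j => h j s))%:E = (\sum_(i <- enum 'I_refinement_size) (F (fun j => a j i) * \1_(A i) s)%:E)%E.
  case: (pselect (exists i, A i s)) => [[i As]|nA].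
    rewrite big_enum (bigD1 i)//= big1 ?adde0 => [|i' ii']; last first.
      rewrite indicE memNset ?mulr0// => As'.
      by move/eqP: ii'; apply; exact: refinement_cell_unique As' As.
    rewrite indicE mem_set// mulr1; congr (F _)%:E.
    by apply/funext => j; exact: As.
  rewrite big1 => [|i _]; last by rewrite indicE memNset ?mulr0// => As; apply: nA; exists i.
  rewrite (_ : (fun _ => _) = fun=> 0) ?F0//; apply/funext => j.
  by apply/eqP/negPn/negP => /refinement_cover.
under eq_integral do rewrite FE.
rewrite ge0_integral_sum//; last 2 first.
  move=> i; apply/measurable_EFinP; apply: measurable_funM => //.
  exact: measurable_indic (measurable_refinement_cell i).
  by move=> i s _; rewrite lee_fin mulr_ge0.
rewrite big_enum -sumEFin; apply: eq_bigr => i _.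
under eq_integral do rewrite EFinM.
have mA := measurable_refinement_cell i.
rewrite ge0_integralZl//; last 2 first.
  by apply/measurable_EFinP; exact: measurable_indic.
  by rewrite lee_fin.
rewrite integral_indic// setIT EFinM fineK//.
by rewrite ge0_fin_numE// refinement_cell_fin.
Qed.

Lemma simple_integral_refinement : {ae P, forall w, forall j,
  simple_integral M (h j) w = \sum_i a j i * M (A i) w}.
Proof.
(* Additivity is almost sure for each union of cells; there are finitely many unions, so one null
   set serves them all. *)
have H (Q : {set 'I_refinement_size}) := random_measure_finite_additive (fun i => i \in Q)
  measurable_refinement_cell refinement_cell_fin trivIset_refinement_cell.
have FP : Filter (almost_everywhere P) by exact: _.
have := filter_forall FP H; apply: filterS => w Hw j.
have aF i : a j i \in fset_set (range (h j)).
  have [s As] := refinement_cell_nonempty i.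
  rewrite in_fset_set; last exact: fimfunP.
  by apply/mem_set; exists s => //; exact: As.
have level x : x * M (h j @^-1` [set x]) w = \sum_(i | a j i == x) a j i * M (A i) w.
  (* The level set of 0 contains the complement of the cells and may have infinite measure, where
     [M] is uncontrolled; its factor 0 removes it. *)
  have [->|x0] := eqVneq x 0.
    by rewrite mul0r big1// => i /eqP ->; rewrite mul0r.
  have -> : h j @^-1` [set x] = \bigcup_(i in [set` [set i | a j i == x]%SET]) A i.
    apply/seteqP; split=> [s/= hs|s [i /=]].
      have [i As] : exists i, A i s by apply: (@refinement_cover s j); rewrite hs.
      by exists i => //=; rewrite inE -hs; apply/eqP; rewrite -(As j).
    by rewrite inE => /eqP <- As; exact: As.
  rewrite Hw mulr_sumr; under eq_bigl do rewrite inE.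
  by apply: eq_bigr => i /eqP ->.
rewrite simple_integralE; under eq_bigr do rewrite level.
rewrite (exchange_big_dep predT)//=; apply: eq_bigr => i _.
rewrite big_mkcond/= (bigD1_seq (a j i))//=; last exact: fset_uniq.
rewrite eqxx big1 ?addr0// => x xa.
by rewrite eq_sym (negbTE xa).
Qed.

End CommonRefinement.

Lemma stochastic_integral_approx f (Y : {RV P >-> R}) e : 0 < e ->
  stochastic_integral m alpha M f Y -> exists h : {sfun S >-> R},
  [/\ Lalpha m alpha h, (\int[m]_s (`|h s - f s| `^ alpha)%:E < e%:E)%E &
      fine (P [set w | e <= `|simple_integral M h w - Y w|]) < e].
Proof.
move=> e0 [h [Lh hf hY]].
have nbe : \forall x \near nbhs (0 : \bar R), (x < e%:E)%E.
  by apply: open_ereal_lt'; rewrite lte_fin.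
have h1 : \forall n \near \oo, (\int[m]_s (`|h n s - f s| `^ alpha)%:E < e%:E)%E := hf _ nbe.
have h2 : \forall n \near \oo, (P [set w | (e <= `|simple_integral M (h n) w - Y w|)%R] < e%:E)%E :=
  hY _ e0 _ nbe.
have [n [n1 n2]] := filter_ex (filterI h1 h2).
exists (h n); split => //.
rewrite -lte_fin fineK// ge0_fin_numE//; exact: lt_trans n2 (ltry _).
Qed.

Lemma stochastic_integral_array N (g : 'I_N -> S -> R) (Y : 'I_N -> {RV P >-> R}) (e : R) :
    0 < e -> (forall j, Lalpha m alpha (g j)) ->
    (forall j, stochastic_integral m alpha M (g j) (Y j)) ->
  exists k (V : 'I_k -> T -> R) (s : 'I_k -> R) (a : 'I_N -> 'I_k -> R)
      (W := fine (\int[m]_x (\big[Num.max/0]_(j < N) (`|g j x| `^ alpha))%:E)%E),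
    [/\ (forall i, stable_law alpha P (V i) (s i)) /\ mutually_independent P V,
        forall j, \sum_i s i * `|a j i| `^ alpha <=
          (1 + e) * fine (\int[m]_x (`|g j x| `^ alpha)%:E)%E + e,
        array_size alpha s a <= (1 + e) * W + e,
        W <= (1 + e) * array_size alpha s a + e
      & forall j, fine (P [set w | e <= `|\sum_i a j i * V i w - Y j w|]) <= e].
Proof.
move=> e0 Lg gY; case/andP: (halpha) => a0 _.
have [C C0 HC] := powR_norm_le_perturbed halpha e0.
(* The pointwise error [w] below is [C] times a sum of [N] differences, so its integral is at most
   [e]. The successor avoids a zero denominator. *)
pose e' := Num.min e (e / (C * N.+1%:R)).
have Npos : 0 < C * N.+1%:R by rewrite mulr_gt0.
have e'0 : 0 < e' by rewrite lt_min e0 divr_gt0.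
have e'e : e' <= e by rewrite ge_min lexx.
have e'C : C * N.+1%:R * e' <= e.
  by rewrite mulrC -ler_pdivlMr// ge_min lexx orbT.
clearbody e'.
have [h hP] := choice (fun j => stochastic_integral_approx e'0 (gY j)).
have Lh j : Lalpha m alpha (h j) by have [] := hP j.
have hg j : (\int[m]_s (`|h j s - g j s| `^ alpha)%:E < e'%:E)%E by have [] := hP j.
have mg j : measurable_fun setT (g j) by have [] := Lg j.
have mpow (u : S -> R) : measurable_fun setT u -> measurable_fun setT (fun s => `|u s| `^ alpha).
  by move=> mu; apply: (measurableT_comp (measurable_powR alpha)); exact: measurableT_comp.
have mh j : measurable_fun setT (h j) by have [] := Lh j.
have mhg j : measurable_fun setT (fun s => `|h j s - g j s| `^ alpha).
  by apply: mpow; exact: measurable_funB.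
exists (refinement_size h), (fun i => M (refinement_cell i)),
  (fun i => fine (m (refinement_cell i))), (@refinement_coef _ h).
pose W := fine (\int[m]_x (\big[Num.max/0]_(j < N) (`|g j x| `^ alpha))%:E)%E.
pose W' := fine (\int[m]_x (\big[Num.max/0]_(j < N) (`|h j x| `^ alpha))%:E)%E.
pose w s := C * \sum_(j < N) `|h j s - g j s| `^ alpha.
have mw : measurable_fun setT w.
  by apply: measurable_funM => //; exact: measurable_sum_fun.
have w0 s : 0 <= w s.
  by apply: mulr_ge0; [exact: ltW|apply: sumr_ge0 => j _; exact: powR_ge0].
have wle s j : C * `|h j s - g j s| `^ alpha <= w s.
  rewrite ler_pM2l// (bigD1 j)//= lerDl.
  by apply: sumr_ge0 => i _; exact: powR_ge0.
have we : (\int[m]_s (w s)%:E <= e%:E)%E.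
  under eq_integral do rewrite EFinM -sumEFin.
  rewrite ge0_integralZl ?lee_fin//; last 3 first.
  - by apply: emeasurable_sum => j; exact/measurable_EFinP.
  - by move=> s _; apply: sume_ge0 => j _; rewrite lee_fin powR_ge0.
  - exact: ltW.
  rewrite ge0_integral_sum//; last first.
    by move=> j; exact/measurable_EFinP.
  apply: (@le_trans _ _ (C%:E * \sum_(j < N) e'%:E)%E).
    by apply: lee_wpmul2l; [rewrite lee_fin ltW|apply: lee_sum => j _; exact/ltW/hg].
  rewrite sumEFin -EFinM lee_fin sumr_const card_ord.
  apply: le_trans e'C; rewrite -mulrA; apply: ler_wpM2l; first exact: ltW.
  by rewrite -(mulr_natl e'); apply: ler_wpM2r; [exact: ltW|rewrite ler_nat].
have H1 s j : `|h j s| `^ alpha <= (1 + e) * `|g j s| `^ alpha + w s.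
  exact: le_trans (HC _ _) (lerD (lexx _) (wle s j)).
have H2 s j : `|g j s| `^ alpha <= (1 + e) * `|h j s| `^ alpha + w s.
  by apply: le_trans (HC _ _) (lerD (lexx _) _); rewrite distrC.
have max_le (u v : 'I_N -> S -> R) s : (forall j, 0 <= u j s) -> (forall j, 0 <= v j s) ->
    (forall j, u j s <= (1 + e) * v j s + w s) ->
    \big[Num.max/0]_(j < N) u j s <= (1 + e) * \big[Num.max/0]_(j < N) v j s + w s.
  move=> u0 v0 uv; have V0 := bigmax0_ge0 (index_enum 'I_N) (fun j => v j s).
  have e1 : 0 <= 1 + e by rewrite addr_ge0// ltW.
  apply/bigmax0_leP; first by apply: addr_ge0 => //; exact: mulr_ge0.
  move=> j _; apply: le_trans (uv j) (lerD (ler_wpM2l e1 _) (lexx _)).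
  by apply: bigmax0_ge; rewrite mem_index_enum.
have max_fin (u : 'I_N -> S -> R) : (forall j, Lalpha m alpha (u j)) ->
    (\int[m]_s (\big[Num.max/0]_(j < N) (`|u j s| `^ alpha))%:E < +oo)%E.
  move=> Lu; have mu j : measurable_fun setT (u j) by have [] := Lu j.
  apply: (@le_lt_trans _ _ (\int[m]_s \sum_(j < N) (`|u j s| `^ alpha)%:E)%E).
    apply: ge0_le_integral => //.
    - by move=> s _; rewrite lee_fin bigmax0_ge0.
    - by apply/measurable_EFinP; apply: measurable_bigmax => j; exact: mpow.
    - by apply: emeasurable_sum => j; apply/measurable_EFinP; exact: mpow.
    - move=> s _; rewrite sumEFin lee_fin.
      apply/bigmax0_leP; first by apply: sumr_ge0 => j _; exact: powR_ge0.
      move=> j _; rewrite (bigD1 j)//= lerDl.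
      by apply: sumr_ge0 => i _; exact: powR_ge0.
  rewrite ge0_integral_sum//; last first.
    by move=> j; apply/measurable_EFinP; exact: mpow.
  by apply/lte_sum_pinfty => j _; have [] := Lu j.
have e1 : 0 <= 1 + e by rewrite addr_ge0// ltW.
have max_integral_le (u v : 'I_N -> S -> R) :
    (forall j, measurable_fun setT (u j)) -> (forall j, measurable_fun setT (v j)) ->
    (forall j, Lalpha m alpha (v j)) ->
    (forall s j, `|u j s| `^ alpha <= (1 + e) * `|v j s| `^ alpha + w s) ->
    fine (\int[m]_x (\big[Num.max/0]_(j < N) (`|u j x| `^ alpha))%:E)%E <=
    (1 + e) * fine (\int[m]_x (\big[Num.max/0]_(j < N) (`|v j x| `^ alpha))%:E)%E + e.
  move=> mu mv Lv uv; apply: (fine_integral_le (w := w)) => //.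
  - by apply: measurable_bigmax => j; exact: mpow.
  - by apply: measurable_bigmax => j; exact: mpow.
  - by move=> s; exact: bigmax0_ge0.
  - by move=> s; exact: bigmax0_ge0.
  - exact: max_fin.
  - by move=> s; apply: (max_le (fun j s => `|u j s| `^ alpha) (fun j s => `|v j s| `^ alpha)).
have a0' : alpha != 0 by rewrite gt_eqF.
have sizeE : array_size alpha (fun i => fine (m (refinement_cell i))) (@refinement_coef _ h) = W'.
  rewrite /W' (integral_refinement Lh (F := fun x => \big[Num.max/0]_(j < N) (`|x j| `^ alpha))).
  - by rewrite /=; apply: eq_bigr => i _; rewrite mulrC.
  - by apply/le_anti; rewrite bigmax0_ge0 andbT; apply/bigmax0_leP => // j _; rewrite normr0 powR0.
  - by move=> x; exact: bigmax0_ge0.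
have sumE j : \sum_(i < refinement_size h) fine (m (refinement_cell i)) * `|refinement_coef j i| `^ alpha =
    fine (\int[m]_x (`|h j x| `^ alpha)%:E)%E.
  rewrite (integral_refinement Lh (F := fun x => `|x j| `^ alpha)).
  - by rewrite /=; apply: eq_bigr => i _; rewrite mulrC.
  - by rewrite normr0 powR0.
  - by move=> x; exact: powR_ge0.
rewrite sizeE; split.
- split=> [i|].
    apply: stable_law_random_measure; first exact: measurable_refinement_cell.
    exact: refinement_cell_fin.
  apply: mutually_independent_random_measure; first exact: measurable_refinement_cell.
    exact: refinement_cell_fin.
  exact: trivIset_refinement_cell.
- move=> j; rewrite sumE.
  have [_ gj] := Lg j.
  by apply: (fine_integral_le (w := w)) => //; exact: mpow.
- exact: (max_integral_le _ _ mh mg Lg (fun s j => H1 s j)).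
- exact: (max_integral_le _ _ mg mh Lh (fun s j => H2 s j)).
- move=> j; have [_ _ hj] := hP j.
  apply: le_trans (le_trans (ltW hj) e'e).
  have mU : measurable_fun setT (fun w => \sum_(i < refinement_size h) refinement_coef j i * M (refinement_cell i) w).
    by apply: measurable_sum_fun => i; exact: measurable_funM.
  have mD : measurable [set w | e <= `|\sum_(i < refinement_size h) refinement_coef j i * M (refinement_cell i) w - Y j w|].
    by apply: measurable_norm_ge; exact: measurable_funB.
  have mD' : measurable [set w | e' <= `|simple_integral M (h j) w - Y j w|].
    by apply: measurable_norm_ge; apply: measurable_funB => //; exact: measurable_simple_integral.
  rewrite -lee_fin !EFin_fine_probability//.
  have [B [mB PB HB]] := simple_integral_refinement Lh.
  apply: (@le_trans _ _ (P ([set w | e' <= `|simple_integral M (h j) w - Y j w|] `|` B))).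
    apply: le_measure; rewrite ?inE//; first exact: measurableU.
    move=> w' /= De; case: (pselect (B w')) => [|nB]; [by right|left].
    have -> : simple_integral M (h j) w' = \sum_(i < refinement_size h) refinement_coef j i * M (refinement_cell i) w'.
      by apply: contrapT => ne; apply: nB; apply: HB => /=; move=> /(_ j).
    exact: le_trans De.
  apply: (le_trans (measureU2 P mD' mB)).
  by rewrite [X in (_ + X <= _)%E](_ : _ = 0%E) ?adde0//; exact: PB.
Qed.

End RandomMeasure.

(** * The law of the maximum *)

Lemma expRN_le_shift {R : realType} (u v t : R) : 0 <= v -> 0 <= t <= 1 / 2 -> v - t <= u ->
  expR (- u) <= expR (- v) + 2 * t.
Proof.
move=> v0 /andP[t0 t1] vtu.
have Ev : expR (- v) <= 1 by rewrite -[leRHS]expR0 ler_expR; lra.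
have Et : expR t <= 1 + 2 * t.
  have := expR_ge1Dx (- t); rewrite expRN => h.
  have Et0 := expR_gt0 t.
  have h2 : (1 - t) * expR t <= 1.
    by rewrite -ler_pdivlMr// div1r.
  by nra.
apply: (@le_trans _ _ (expR (- v) * expR t)).
  by rewrite -expRD ler_expR; lra.
have := expR_gt0 (- v); have := expR_gt0 t; nra.
Qed.

Lemma exponent_upper_aux {R : realFieldType} (C K e r r' q : R) :
    0 < C -> 0 <= K -> 0 < e -> e <= 1 / 16 -> 0 <= r -> r <= K -> 0 <= r' ->
    r' <= (1 + e) * r + e -> 0 < q -> q <= 1 + 6 * e ->
  (C + e) * (1 + e) * (r' * q) <= C * r + 20 * (1 + C) * (1 + K) * e.
Proof.
move=> C0 K0 e0 e16 r0 rK r'0 r'r Q0 qE.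
pose D := 20 * (1 + C) * (1 + K); rewrite -/D.
have CK0 : 0 <= C * K by apply: mulr_ge0 => //; exact: ltW.
have CrK : C * r <= C * K by rewrite ler_pM2l.
have C2 : 0 <= C + 2 by rewrite addr_ge0// ltW.
have K1 : 0 <= K + 1 by rewrite addr_ge0.
have e1 : e <= 1 by apply: le_trans e16 _; rewrite ler_pdivrMr// mul1r ler1n.
have h1 : (C + e) * (1 + e) <= C + e * (C + 2) by nra.
have h2 : r' <= r + e * (K + 1) by nra.
pose E := 1 + C + K + C * K.
have h3 : (C + e) * (1 + e) * r' <= C * r + e * (5 * E).
  apply: (@le_trans _ _ ((C + e * (C + 2)) * (r + e * (K + 1)))).
    by apply: ler_pM => //; apply: mulr_ge0; lra.
  have h4 : (C + 2) * r <= (C + 2) * K by exact: ler_wpM2l.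
  have h5 : e * ((C + 2) * (K + 1)) <= 1 * ((C + 2) * (K + 1)).
    by apply: ler_wpM2r => //; exact: mulr_ge0.
  rewrite (_ : (C + e * (C + 2)) * (r + e * (K + 1)) =
    C * r + e * (C * (K + 1) + (C + 2) * r + e * ((C + 2) * (K + 1)))); last by ring.
  rewrite lerD2l; apply: ler_wpM2l; first exact: ltW.
  rewrite /E; lra.
have E0 : 0 <= E by rewrite /E; lra.
have X0 : 0 <= (C + e) * (1 + e) * r' by apply: mulr_ge0 => //; apply: mulr_ge0; lra.
rewrite mulrA; apply: (@le_trans _ _ ((C * r + e * (5 * E)) * (1 + 6 * e))).
  by apply: ler_pM => //; exact: ltW.
have -> : D = 20 * E by rewrite /D /E; ring.
have h6 : C * r <= E by rewrite /E; lra.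
have h7 : e * (C * r) <= e * E by rewrite ler_pM2l.
have h8 : e * (e * E) <= 1 / 16 * (e * E) by apply: ler_wpM2r => //; apply: mulr_ge0 => //; exact: ltW.
have h9 : 0 <= e * E by apply: mulr_ge0 => //; exact: ltW.
by clearbody E; lra.
Qed.

Lemma exponent_lower_aux {R : realFieldType} (C K e r r' p : R) :
    0 < C -> 0 <= K -> 0 < e -> e <= 1 / 16 -> e <= C -> 0 <= r -> r <= K -> 0 <= r' ->
    r <= (1 + e) * r' + e -> 0 < p -> 1 - 4 * e <= p ->
  C * r - 20 * (1 + C) * (1 + K) * e <= (C - e) * (r' * p).
Proof.
move=> C0 K0 e0 e16 eC r0 rK r'0 rr' P0 pE.
pose D := 20 * (1 + C) * (1 + K); rewrite -/D.
have CK0 : 0 <= C * K by apply: mulr_ge0 => //; exact: ltW.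
have CrK : C * r <= C * K by rewrite ler_pM2l.
have h0 : 0 <= (C - e) * (r' * p).
  by apply: mulr_ge0; [lra|apply: mulr_ge0 => //; exact: ltW].
(* For [r <= e] the left side is at most 0; otherwise [r - e] is positive and the lower bounds for
   the factors can be multiplied. *)
have [re|er] := leP r e.
  have : C * r <= C * e by rewrite ler_pM2l.
  have : 0 <= e * (20 + 20 * K + 19 * C + 20 * (C * K)) by apply: mulr_ge0; lra.
  by rewrite /D; lra.
have h1 : (r - e) * (1 - e) <= r' by nra.
have h2 : (C - e) * ((r - e) * (1 - e) * (1 - 4 * e)) <= (C - e) * (r' * p).
  apply: ler_wpM2l; first by lra.
  by apply: ler_pM => //; [apply: mulr_ge0; lra|lra].
apply: le_trans h2.
have h3 : (C - e) * (r - e) * (1 - 5 * e) <= (C - e) * ((r - e) * (1 - e) * (1 - 4 * e)).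
  rewrite -!mulrA; apply: ler_wpM2l; first by lra.
  by apply: ler_wpM2l; [lra|nra].
apply: le_trans h3.
have h4 : 0 <= e * (e * (5 * C + 5 * r + 1)) * (1 - 5 * e).
  by apply: mulr_ge0; [apply: mulr_ge0; [lra|apply: mulr_ge0; lra]|lra].
have h5 : 0 <= e * (C * K - C * r) by apply: mulr_ge0; lra.
have h6 : 0 <= e * (K - r) by apply: mulr_ge0; lra.
have h7 : 0 <= e * C by apply: mulr_ge0; lra.
have h8 : 0 <= e * K by apply: mulr_ge0; lra.
have h9 : 0 <= e * (C * K) by apply: mulr_ge0; lra.
have ha : 0 <= e * e * (C + r) by apply: mulr_ge0; [apply: mulr_ge0|]; lra.
have hb : 0 <= e * e * (1 - 5 * e) by apply: mulr_ge0; [apply: mulr_ge0|]; lra.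
clear - CrK h4 h5 h6 h7 h8 h9 ha hb e0; rewrite /D; lra.
Qed.

(** Stability of the limiting exponent when the tail constant, the size and the level are all
    perturbed by order [e]. The errors are linear in [e], and [20 * (1 + C) * (1 + K)] is a generous
    common factor. *)
Lemma exponent_perturbation {R : realType} (alpha C K x : R) :
    0 < alpha < 2 -> 0 < C -> 0 <= K -> 0 < x ->
  exists2 D, 0 < D & forall e r r', 0 < e <= 1 / 16 -> e <= C -> 0 <= r <= K -> 0 <= r' ->
    r <= (1 + e) * r' + e -> r' <= (1 + e) * r + e ->
    C * (r / x `^ alpha) - D * e <= (C - e) * (r' / (x * (1 + 2 * e)) `^ alpha) /\
    (C + e) * (1 + e) * (r' / (x * (1 - 2 * e)) `^ alpha) <= C * (r / x `^ alpha) + D * e.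
Proof.
move=> /andP[a0 a2] C0 K0 x0; pose D := 20 * (1 + C) * (1 + K).
have xa0 : 0 < x `^ alpha by rewrite powR_gt0.
have Vxa0 : 0 < (x `^ alpha)^-1 by rewrite invr_gt0.
exists (D / x `^ alpha); first by rewrite mulr_gt0// /D !mulr_gt0//; lra.
move=> e r r' /andP[e0 e16] eC /andP[r0 rK] r'0 rr' r'r.
have p0 : 0 < (1 + 2 * e) `^ alpha by rewrite powR_gt0; lra.
have q0 : 0 < (1 - 2 * e) `^ alpha by rewrite powR_gt0; lra.
have pE : ((1 + 2 * e) `^ alpha)^-1 >= 1 - 4 * e.
  rewrite -[leRHS]mul1r ler_pdivlMr//.
  apply: (@le_trans _ _ ((1 - 4 * e) * (1 + 2 * e) `^ 2)).
    by apply: ler_wpM2l; [lra|apply: ler_powR; lra].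
  by rewrite powR_mulrn ?expr2; [nra|lra].
have qE : ((1 - 2 * e) `^ alpha)^-1 <= 1 + 6 * e.
  rewrite -[leLHS]mul1r ler_pdivrMr//.
  apply: (@le_trans _ _ ((1 + 6 * e) * (1 - 2 * e) `^ 2)).
    by rewrite powR_mulrn ?expr2; [nra|lra].
  apply: ler_wpM2l; first by lra.
  have b0 : 0 < 1 - 2 * e by lra.
  rewrite (_ : (1 - 2 * e) `^ 2 = (1 - 2 * e) `^ alpha * (1 - 2 * e) `^ (2 - alpha)); last first.
    rewrite -powRD; last by rewrite (gt_eqF b0) implybT.
    by congr (_ `^ _); ring.
  rewrite -[leRHS]mulr1; apply: ler_wpM2l; first exact: ltW.
  have h1 : 1 = 1 `^ (2 - alpha) :> R by rewrite powR1.
  rewrite [leRHS]h1.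
  by apply: ge0_ler_powR; rewrite ?nnegrE; lra.
rewrite !powRM; try lra.
rewrite !invfM.
have P0 : 0 < ((1 + 2 * e) `^ alpha)^-1 by rewrite invr_gt0.
have Q0 : 0 < ((1 - 2 * e) `^ alpha)^-1 by rewrite invr_gt0.
move: pE qE P0 Q0; set p := _^-1; set q := _^-1 => pE qE P0 Q0.
clearbody p q.
have up := exponent_upper_aux C0 K0 e0 e16 r0 rK r'0 r'r Q0 qE.
have lo := exponent_lower_aux C0 K0 e0 e16 eC r0 rK r'0 rr' P0 pE.
rewrite -/D in up lo; clearbody D.
split.
  have -> : C * (r / x `^ alpha) - D / x `^ alpha * e = (C * r - D * e) * (x `^ alpha)^-1 by ring.
  have -> : (C - e) * (r' * ((x `^ alpha)^-1 * p)) = (C - e) * (r' * p) * (x `^ alpha)^-1 by ring.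
  by rewrite ler_pM2r.
have -> : C * (r / x `^ alpha) + D / x `^ alpha * e = (C * r + D * e) * (x `^ alpha)^-1 by ring.
have -> : (C + e) * (1 + e) * (r' * ((x `^ alpha)^-1 * q)) =
  (C + e) * (1 + e) * (r' * q) * (x `^ alpha)^-1 by ring.
by rewrite ler_pM2r.
Qed.

Lemma add3_lt {R : realFieldType} (u v w z : R) : 0 <= u -> 0 <= v -> 0 <= w ->
  u + v + w + 1 < z -> [/\ 1 <= z, u <= z, v <= z & w <= z].
Proof. by move=> u0 v0 w0 uvw; split; lra. Qed.

Lemma two_sided_error {R : realFieldType} (p E Eu El tu tl su sl b n D dl e : R) :
    p <= su + n -> su <= tu + b -> tu <= Eu -> Eu <= E + 2 * (D * dl) ->
    E <= El + 2 * (D * dl) -> El <= tl -> tl <= sl + b -> sl <= p + n ->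
    b <= dl -> n <= dl -> dl * (2 * (D + 1)) <= e ->
  `|p - E| <= e.
Proof. by move=> *; rewrite ler_norml; apply/andP; split; lra. Qed.

Section MaximaLaw.
Import HBSimple.
Context {R : realType} {d : measure_display} {S : measurableType d}.
Variables (m : {measure set S -> \bar R}) (alpha : R).
Context {dT : measure_display} {T : measurableType dT} {P : probability T R}.
Variable M : set S -> {RV P >-> R}.
Hypothesis halpha : 0 < alpha < 2.
Hypothesis hM : SaS_random_measure m alpha M.
Variable C : R.
Hypothesis C_gt0 : 0 < C.
Hypothesis tail_asym : forall e, 0 < e -> exists2 y0, 0 < y0 & forall V s u,
  stable_law alpha P V s -> 0 < u -> s / u `^ alpha <= y0 ->
  `|tail P V u - C * (s / u `^ alpha)| <= e * (s / u `^ alpha).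

Definition fields_le N (Y : 'I_N -> T -> R) (y : R) : set T :=
  [set w | forall j, `|Y j w| <= y].

Lemma measurable_fields_le N (Y : 'I_N -> T -> R) y :
  (forall j, measurable_fun setT (Y j)) -> measurable (fields_le Y y).
Proof.
move=> mY; rewrite (_ : fields_le Y y = \bigcap_(j in [set: 'I_N]) ~` [set w | y < `|Y j w|]); last first.
  apply/seteqP; split=> w /= H j; first by move=> _; apply/negP; rewrite -leNgt.
  by rewrite leNgt; apply/negP; exact: H.
apply: fin_bigcap_measurable => // j _; apply: measurableC.
exact: measurable_tail.
Qed.

Lemma fields_le_perturbed N (Y U : 'I_N -> T -> R) y z e e' :
    (forall j, measurable_fun setT (Y j)) -> (forall j, measurable_fun setT (U j)) ->
    (forall j, fine (P [set w | e <= `|U j w - Y j w|]) <= e') -> y + e <= z ->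
  fine (P (fields_le Y y)) <= fine (P (fields_le U z)) + N%:R * e'.
Proof.
move=> mY mU UY yz.
have mD j : measurable [set w | e <= `|U j w - Y j w|].
  by apply: measurable_norm_ge; exact: measurable_funB.
have mB : measurable (\bigcup_j [set w | e <= `|U j w - Y j w|]).
  by apply: fin_bigcup_measurable.
have mYy := measurable_fields_le y mY; have mUz := measurable_fields_le z mU.
apply: (@le_trans _ _ (fine (P (fields_le U z `|` \bigcup_j [set w | e <= `|U j w - Y j w|])))).
  apply: fine_probability_le => //; first exact: measurableU.
  move=> w /= Yy; case: (pselect (exists j, e <= `|U j w - Y j w|)) => [[j]|nD]; [by right; exists j|left].
  move=> j; have : ~ (e <= `|U j w - Y j w|) by move=> De; apply: nD; exists j.
  move=> /negP; rewrite -ltNge => De; apply: le_trans yz.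
  rewrite -[U j w](subrK (Y j w)) addrC.
  by apply: le_trans (ler_normD _ _) (lerD (Yy j) (ltW De)).
apply: (@le_trans _ _ (fine (P (fields_le U z)) + fine (P (\bigcup_j [set w | e <= `|U j w - Y j w|])))).
  rewrite -lee_fin EFinD !EFin_fine_probability//; last exact: measurableU.
  exact: (measureU2 P).
rewrite lerD2l; apply: le_trans (union_bound P mD) _.
rewrite mulr_natl -[in leRHS](card_ord N) -sumr_const.
exact: ler_sum.
Qed.

(** [N0] is fixed before the functions, their number and [L], all of which vary with the ball. The
    ratio [r] is a bounded parameter, since the averages converge only along subsequences. *)
Lemma maxima_law K x e : 0 <= K -> 0 < x -> 0 < e -> exists N0 : nat,
  forall N (g : 'I_N -> S -> R) (Y : 'I_N -> {RV P >-> R}) L r, (N0 <= N)%N ->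
    0 < L -> L `^ alpha = N%:R -> (forall j, Lalpha m alpha (g j)) ->
    (forall j, stochastic_integral m alpha M (g j) (Y j)) ->
    (forall j, fine (\int[m]_s (`|g j s| `^ alpha)%:E)%E <= K) -> 0 <= r <= K ->
    fine (\int[m]_s (\big[Num.max/0]_(j < N) (`|g j s| `^ alpha))%:E)%E = r * N%:R ->
  `|fine (P (fields_le Y (x * L))) - expR (- (C * (r / x `^ alpha)))| <= e.
Proof.
move=> K0 x0 e0.
have [C1 C10 tailC] := tail_upper P halpha.
have [D D0 HD] := exponent_perturbation halpha C_gt0 K0 x0.
(* The first two entries allow [exponent_perturbation]; the third brings the total error below [e],
   and the fourth keeps [D * dl] below 1/2 for the comparison of exponentials. *)
pose dl := Num.min (Num.min (1 / 16) C) (Num.min (e / (2 * (D + 1))) (1 / (2 * (D + 1)))).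
have D2 : 0 < 2 * (D + 1) by lra.
have dl0 : 0 < dl by rewrite !lt_min C_gt0 !divr_gt0.
have dl16 : dl <= 1 / 16 by rewrite !ge_min lexx.
have dlC : dl <= C by rewrite !ge_min lexx !orbT.
have dle : dl * (2 * (D + 1)) <= e by rewrite -ler_pdivlMr// !ge_min lexx !orbT.
have dl1 : dl * (2 * (D + 1)) <= 1 by rewrite -ler_pdivlMr// !ge_min lexx !orbT.
clearbody dl.
have Ddl : 0 <= D * dl <= 1 / 2 by rewrite mulr_ge0 ?ltW//; lra.
have xl0 : 0 <= x * (1 - 2 * dl) by apply: mulr_ge0; lra.
have [t0 t00 tasym] := tail_asym dl0.
pose K' := (1 + dl) * K + dl.
have K'0 : 0 <= K' by apply: addr_ge0; [apply: mulr_ge0; lra|lra].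
have ylo0 : 0 < x * (1 - 2 * dl) by rewrite mulr_gt0//; lra.
have yhi0 : 0 < x * (1 + 2 * dl) by rewrite mulr_gt0//; lra.
have xdl0 : 0 < x * dl by rewrite mulr_gt0.
have [B BE] : {B | B = array_error alpha C1 K' (x * dl)} by exists (array_error alpha C1 K' (x * dl)).
have B0 : 0 <= B.
  by rewrite BE; apply: addr_ge0; [exact: sqr_ge0|apply: mulr_ge0 => //; exact: expR_ge0].
have yloa : 0 < (x * (1 - 2 * dl)) `^ alpha by rewrite powR_gt0.
have ylohi : (x * (1 - 2 * dl)) `^ alpha <= (x * (1 + 2 * dl)) `^ alpha.
  apply: ge0_ler_powR; rewrite ?nnegrE; try exact: ltW.
    by case/andP: halpha => /ltW.
  by rewrite ler_pM2l//; lra.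
have [Q QE] : {Q | Q = K' / (x * (1 - 2 * dl)) `^ alpha} by exists (K' / (x * (1 - 2 * dl)) `^ alpha).
have Q0 : 0 <= Q by rewrite QE; apply: divr_ge0 => //; exact: ltW.
have [q qN] : exists q : R, forall z : R, q < z ->
  [/\ 1 <= z, Q <= t0 * z, C1 * Q * (1 + dl) <= dl * z & B <= dl * z].
  have h1 : 0 <= Q / t0 by rewrite divr_ge0// (ltW t00).
  have h2 : 0 <= C1 * Q * (1 + dl) / dl by rewrite divr_ge0 ?(ltW dl0)// mulr_ge0 ?addr_ge0 ?(ltW dl0)// mulr_ge0// (ltW C10).
  have h3 : 0 <= B / dl by rewrite divr_ge0// (ltW dl0).
  exists (Q / t0 + C1 * Q * (1 + dl) / dl + B / dl + 1) => z.
  move: h1 h2 h3; rewrite -[Q <= _]ler_pdivrMl// -[_ * (1 + _) <= _]ler_pdivrMl// -[B <= _]ler_pdivrMl//.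
  rewrite ![_^-1 * _]mulrC; move: (Q / t0) (C1 * Q * (1 + dl) / dl) (B / dl) => u v w.
  exact: add3_lt.
exists (Num.truncn q).+1 => N g Y L r N0N L0 LN Lg gY gK /andP[r0 rK] rE.
have [N1 Qt0 CQ Bdl] : [/\ 1 <= N%:R :> R, Q <= t0 * N%:R, C1 * Q * (1 + dl) <= dl * N%:R & B <= dl * N%:R].
  by apply: qN; apply: lt_le_trans (truncnS_gt _) _; rewrite ler_nat.
have N0 : 0 < N%:R :> R by exact: lt_le_trans N1.
have N0n : (0 < N)%N by rewrite -(ltr_nat R).
have dlp : 0 < 1 + dl by rewrite addr_gt0.
have QN : Q / N%:R <= t0 by rewrite ler_pdivrMr.
have QN1 : C1 * (Q / N%:R) <= dl / (1 + dl).
  by rewrite mulrA ler_pdivrMr// mulrAC ler_pdivlMr.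
have BN : B / N%:R <= dl by rewrite ler_pdivrMr.
(* The precision [eta] is chosen after [N] because the failure probabilities of [N] approximations
   add up. The number of cells then depends on [eta], harmlessly, as the array bounds involve only
   [K'] and [N]. *)
have eta_ex : exists2 eta, 0 < eta & [/\ eta <= dl, N%:R * eta <= dl & eta <= x * dl * L].
  exists (Num.min (dl / N%:R) (x * dl * L)); first by rewrite lt_min divr_gt0// mulr_gt0.
  have h : Num.min (dl / N%:R) (x * dl * L) <= dl / N%:R by rewrite ge_min lexx.
  split; last by rewrite ge_min lexx orbT.
    by apply: le_trans h _; rewrite ler_pdivrMr//; nra.
  by rewrite mulrC -ler_pdivlMr.
have [eta eta0 [etadl Neta etaL]] := eta_ex.
have [k [V [s [a [[VS Vind] sK size1 size2 UY]]]]] := stochastic_integral_array halpha hM eta0 Lg gY.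
pose U j w := \sum_i a j i * V i w.
have mV i : measurable_fun setT (V i) by have [] := VS i.
have mU j : measurable_fun setT (U j).
  by apply: measurable_sum_fun => i; exact: measurable_funM.
have mY j : measurable_fun setT (Y j) by exact: measurable_funPT.
have sK' j : \sum_i s i * `|a j i| `^ alpha <= K'.
  apply: le_trans (sK j) _; apply: lerD => //.
  have g0 : 0 <= fine (\int[m]_s (`|g j s| `^ alpha)%:E)%E.
    by apply: fine_ge0; apply: integral_ge0 => x1 _; rewrite lee_fin powR_ge0.
  have e1 : 0 <= 1 + eta by rewrite addr_ge0// ltW.
  by apply: ler_pM => //; rewrite lerD2l.
pose r' := array_size alpha s a / N%:R.
have r'0 : 0 <= r'.
  apply: divr_ge0; last exact: ltW.
  apply: sumr_ge0 => i _; apply: mulr_ge0; last exact: bigmax0_ge0.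
  by have [] := VS i.
have size_r' : array_size alpha s a = r' * N%:R by rewrite /r' divfK// gt_eqF.
move: size1 size2; rewrite rE size_r'; clearbody r' => size1 size2.
have rN0 : 0 <= r * N%:R by apply: mulr_ge0 => //; exact: ltW.
have r'N0 : 0 <= r' * N%:R by apply: mulr_ge0 => //; exact: ltW.
have dlN : dl <= dl * N%:R by rewrite ler_peMr// ltW.
have rr' : r <= (1 + dl) * r' + dl.
  rewrite -(ler_pM2r N0); apply: (le_trans size2); rewrite [leRHS]mulrDl -mulrA.
  by apply: lerD; [apply: ler_wpM2r => //; rewrite lerD2l|exact: le_trans dlN].
have r'r : r' <= (1 + dl) * r + dl.
  rewrite -(ler_pM2r N0); apply: (le_trans size1); rewrite [leRHS]mulrDl -mulrA.
  by apply: lerD; [apply: ler_wpM2r => //; rewrite lerD2l|exact: le_trans dlN].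
have [lo up] := HD dl r r' (introT andP (conj dl0 dl16)) dlC (introT andP (conj r0 rK)) r'0 rr' r'r.
have bE y : r' / y `^ alpha = array_size alpha s a / (y `^ alpha * N%:R).
  by rewrite size_r' -mulf_div divff ?mulr1// gt_eqF.
have Qy y : (x * (1 - 2 * dl)) `^ alpha <= y `^ alpha -> K' / (y `^ alpha * N%:R) <= Q / N%:R.
  move=> yle; rewrite invfM mulrA; apply: ler_wpM2r; first by rewrite invr_ge0 ltW.
  by rewrite QE; apply: ler_wpM2l => //; rewrite lef_pV2// posrE// (lt_le_trans yloa yle).
have Qy1 y : (x * (1 - 2 * dl)) `^ alpha <= y `^ alpha -> K' / (y `^ alpha * N%:R) <= t0.
  by move=> /Qy /le_trans; apply.
have Qy2 y : (x * (1 - 2 * dl)) `^ alpha <= y `^ alpha ->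
    C1 * (K' / (y `^ alpha * N%:R)) <= dl / (1 + dl).
  by move=> /Qy yQ; apply: le_trans QN1; rewrite ler_pM2l.
have law := terms_le_law halpha C10 tailC dl0 tasym VS Vind K'0 sK' N0n L0 LN (bE _).
have /andP[_ law_up] := law _ yhi0 (Qy1 _ ylohi) (Qy2 _ ylohi).
have /andP[law_lo _] := law _ ylo0 (Qy1 _ (lexx _)) (Qy2 _ (lexx _)).
(* The level moves by [x * dl] twice, between fields and sums and between sums and terms, whence the
   factors [1 + 2 * dl] and [1 - 2 * dl]. *)
have up1 := sums_le_terms C10 tailC VS Vind K'0 sK' N0n L0 LN xdl0 (ltW (addr_gt0 x0 xdl0)).
have lo1 := terms_le_sums C10 tailC VS Vind K'0 sK' N0n L0 LN xdl0 xl0.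
have up2 : fine (P (fields_le Y (x * L))) <= fine (P (sums_le V a ((x + x * dl) * L))) + N%:R * eta.
  by apply: (fields_le_perturbed mY mU UY); rewrite mulrDl lerD2l.
have lo2 : fine (P (sums_le V a ((x * (1 - 2 * dl) + x * dl) * L))) <= fine (P (fields_le Y (x * L))) + N%:R * eta.
  apply: (fields_le_perturbed mU mY _ (e := eta)) => [j|].
    rewrite (_ : [set w | _] = [set w | eta <= `|U j w - Y j w|]); first exact: UY.
    by apply/seteqP; split=> w /=; rewrite distrC.
  rewrite (_ : x * (1 - 2 * dl) + x * dl = x - x * dl); last by ring.
  by rewrite mulrBl -addrA gerDl addrC subr_le0.
rewrite (_ : x + x * dl + x * dl = x * (1 + 2 * dl)) in up1; last by ring.
have v0 : 0 <= C * (r / x `^ alpha).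
  by apply: mulr_ge0; [exact: ltW|apply: divr_ge0 => //; exact: powR_ge0].
have u0 : 0 <= (C + dl) * (1 + dl) * (r' / (x * (1 - 2 * dl)) `^ alpha).
  apply: mulr_ge0; last by apply: divr_ge0 => //; exact: powR_ge0.
  by apply: mulr_ge0; apply: addr_ge0 => //; exact: ltW.
have exp_up := expRN_le_shift v0 Ddl lo.
have exp_lo : expR (- (C * (r / x `^ alpha))) <=
    expR (- ((C + dl) * (1 + dl) * (r' / (x * (1 - 2 * dl)) `^ alpha))) + 2 * (D * dl).
  by apply: expRN_le_shift => //; rewrite lerBlDr.
rewrite -BE in up1 lo1.
exact: (two_sided_error up2 up1 law_up exp_up exp_lo law_lo lo1 lo2 BN Neta dle).
Qed.

End MaximaLaw.

(** * From the kernels to the maxima of the field *)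

Section FieldKernel.
Context {R : realType} {G : groupType} {d : measure_display} {S : measurableType d}.
Variables (m : {sigma_finite_measure set S -> \bar R}) (phi : G -> S -> S).
Hypothesis hphi : group_action phi.
Hypothesis hns : nonsingular m phi.
Variables (alpha : R) (c : G -> S -> R) (f : S -> R).
Hypothesis alpha_gt0 : 0 < alpha.
Hypothesis hc : sign_cocycle m phi c.
Hypothesis hf : Lalpha m alpha f.

Lemma norm_field_kernel t s :
  `|field_kernel m phi alpha c f t s| `^ alpha = translate_weight m phi alpha f t s.
Proof.
have [_ c1 _] := hc; rewrite /field_kernel /translate_weight.
have D0 := action_density_ge0 hphi hns t s.
have -> : `|c t s * action_density m phi t s `^ alpha^-1 * f (phi t s)| =
    action_density m phi t s `^ alpha^-1 * `|f (phi t s)|.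
  rewrite !normrM [X in _ * X * _]ger0_norm ?powR_ge0//.
  by case: (c1 t s) => ->; rewrite ?normrN normr1 mul1r.
by rewrite powRM ?powR_ge0// -powRrM mulVf ?gt_eqF// powRr1.
Qed.

Lemma Lalpha_field_kernel t : Lalpha m alpha (field_kernel m phi alpha c f t).
Proof.
have [mc _ _] := hc; have [mf foo] := hf; split.
  apply: measurable_funM.
    apply: measurable_funM => //.
    apply: (measurableT_comp (measurable_powR _)).
    exact: measurable_action_density.
  by apply: measurableT_comp => //; exact: measurable_action.
under eq_integral do rewrite norm_field_kernel.
by rewrite integral_translate_weight.
Qed.

Lemma integral_field_kernel t :
  fine (\int[m]_s (`|field_kernel m phi alpha c f t s| `^ alpha)%:E)%E = Lalpha_norm alpha m f.
Proof.
under eq_integral do rewrite norm_field_kernel.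
by rewrite integral_translate_weight//; case: hf.
Qed.

End FieldKernel.

Section MaxFieldLaw.
Context {R : realType} {r : nat} {G : groupType}.
Variable a : 'I_r -> G.

Definition ball_elem n : 'I_#|` word_ball a n| -> G := tnth (in_tuple (word_ball a n)).

Lemma max_field_le {T : Type} (X : G -> T -> R) n x : 0 <= x ->
  [set w | max_field a X n w <= x] = [set w | forall j, `|X (@ball_elem n j) w| <= x].
Proof.
move=> x0; apply/seteqP; split=> w /=.
  by move=> /(bigmax0_leP _ _ x0) H j; apply: H; exact: mem_tnth.
move=> H; apply/(bigmax0_leP _ _ x0) => t tE.
have := H; rewrite /ball_elem; have /tnthP[j ->] : t \in in_tuple (word_ball a n) by [].
exact.
Qed.

Lemma eq_fdd_max_field {d d'} {T : measurableType d} {T' : measurableType d'}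
    (P : probability T R) (P' : probability T' R)
    (X : G -> {RV P >-> R}) (Y : G -> {RV P' >-> R}) n x : 0 <= x -> eq_fdd X Y ->
  P [set w | max_field a X n w <= x] = P' [set w | forall j, `|Y (@ball_elem n j) w| <= x].
Proof.
move=> x0 XY; rewrite max_field_le//.
pose B : set (#|` word_ball a n|.-tuple (measurableTypeR R)) := [set v | forall j, `|tnth v j| <= x].
have mB : measurable B.
  rewrite (_ : B = \bigcap_(j in [set: 'I__]) ~` [set v | x < `|tnth v j|]).
    apply: fin_bigcap_measurable => // j _; apply: measurableC.
    rewrite -[X in measurable X]setTI.
    have mt : measurable_fun setT (fun v : #|` word_ball a n|.-tuple (measurableTypeR R) => `|tnth v j| : R).
      by apply: measurableT_comp => //; exact: measurable_tnth.
    have := mt measurableT `]x, +oo[%classic (measurable_itv _).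
    congr measurable; apply/seteqP; split=> v /=; rewrite in_itv/= andbT//.
  apply/seteqP; split=> v /= H j; first by move=> _; apply/negP; rewrite -leNgt.
  by rewrite leNgt; apply/negP; exact: H.
have := XY _ [tuple @ball_elem n j | j < #|` word_ball a n|] B mB.
congr (_ = _).
  congr (P _); apply/seteqP; split=> w /= H j; move: (H j); by rewrite !tnth_mktuple.
congr (P' _); apply/seteqP; split=> w /= H j; move: (H j); by rewrite !tnth_mktuple.
Qed.

End MaxFieldLaw.

(** Its random measure is a nondegenerate stable variable, the reference that the tail asymptotics
    call for. The support of [f] itself may have infinite measure. *)
Lemma finite_positive_set {R : realType} {d} {S : measurableType d}
    (m : {sigma_finite_measure set S -> \bar R}) (A : set S) :
  measurable A -> (0 < m A)%E -> exists B, [/\ measurable B, (0 < m B)%E & (m B < +oo)%E].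
Proof.
move=> mA A0; have [F [mF _ UF Foo]] := sigma_finite_partition m.
apply: contrapT => nB.
have F0 k : m (F k) = 0%E.
  apply/eqP; rewrite eq_le measure_ge0 andbT leNgt; apply/negP => Fk0.
  by apply: nB; exists (F k).
have neg : m.-negligible (\bigcup_k F k).
  by apply: negligible_bigcup => k; apply/negligibleP; [exact: mF|exact: F0].
have : m A = 0%E.
  by apply: measure_negligible => //; apply: negligibleS neg => s _; rewrite UF.
by move=> mA0; rewrite mA0 ltxx in A0.
Qed.

(** * Convergence of the normalized maxima *)

Section MaxFieldLimit.
Context {R : realType} {alpha : R} {r : nat} {G : groupType} {a : 'I_r -> G}
  {d : measure_display} {S : measurableType d}
  {m : {sigma_finite_measure set S -> \bar R}} {phi : G -> S -> S} {f : S -> R}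
  {c : G -> S -> R}
  {d0 : measure_display} {T0 : measurableType d0} {P0 : probability T0 R}
  {M : set S -> {RV P0 >-> R}} {Y : G -> {RV P0 >-> R}}
  {d1 : measure_display} {T1 : measurableType d1} {P1 : probability T1 R}
  {X : G -> {RV P1 >-> R}}.
Hypotheses (halpha : 0 < alpha < 2) (hr : (2 <= r)%N) (hG : free_generators a)
  (hphi : group_action phi) (hns : nonsingular m phi) (hf : Lalpha m alpha f)
  (hc : sign_cocycle m phi c) (hM : SaS_random_measure m alpha M)
  (hY : forall t, stochastic_integral m alpha M
                    (field_kernel m phi alpha c f t) (Y t))
  (hX : eq_fdd X Y).
Variable C : R.
Hypothesis C_gt0 : 0 < C.
Hypothesis tail_asym : forall e, 0 < e -> exists2 y0, 0 < y0 & forall V s u,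
  stable_law alpha P0 V s -> 0 < u -> s / u `^ alpha <= y0 ->
  `|tail P0 V u - C * (s / u `^ alpha)| <= e * (s / u `^ alpha).

Local Notation L := (ball_scale a alpha).
Local Notation rho := (ball_average alpha a m phi f).

Let alpha_gt0 : 0 < alpha. Proof. by case/andP: halpha. Qed.

Lemma ball_scale_gt0 n : 0 < L n.
Proof. by rewrite /ball_scale powR_gt0// ltr0n (card_ball_gt0 hr hG). Qed.

Lemma max_field_law x e : 0 < x -> 0 < e -> exists N0, forall n, (N0 <= n)%N ->
  `|fine (P1 [set w | max_field a X n w / L n <= x]) - expR (- (C * (rho n / x `^ alpha)))| <= e.
Proof.
move=> x0 e0.
have [N0 HN0] := maxima_law halpha hM C_gt0 tail_asym (Lalpha_norm_ge0 alpha m f) x0 e0.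
exists N0 => n N0n; have L0 := ball_scale_gt0 n.
have -> : [set w | max_field a X n w / L n <= x] = [set w | max_field a X n w <= x * L n].
  by apply/seteqP; split=> w /=; rewrite ler_pdivrMr.
have xL0 : 0 <= x * L n by rewrite mulr_ge0// ltW.
rewrite (eq_fdd_max_field a n xL0 hX).
apply: (HN0 _ (fun j => field_kernel m phi alpha c f (@ball_elem _ _ a n j))
  (fun j => Y (@ball_elem _ _ a n j)) (L n) (rho n)).
- by apply: leq_trans N0n _; exact/ltnW/(card_word_ball_gt hG hr).
- by [].
- by rewrite /ball_scale -powRrM mulVf ?gt_eqF// powRr1.
- by move=> j; exact: Lalpha_field_kernel.
- by move=> j; exact: hY.
- by move=> j; rewrite integral_field_kernel.
- by rewrite ball_average_ge0 ball_average_le.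
under eq_integral => s _.
  under eq_bigr do rewrite norm_field_kernel//.
  over.
rewrite /ball_average divfK ?pnatr_eq0 -?lt0n ?(card_ball_gt0 hr hG)//.
rewrite /ball_integral /max_integral; congr (fine (integral _ _ _)).
by apply/funext => s; rewrite [in RHS]big_tnth.
Qed.

Lemma max_field_cvg (u : nat -> nat) (q x : R) : (forall n, (n <= u n)%N) -> 0 < x ->
  rho (u n) @[n --> \oo] --> q ->
  fine (P1 [set w | max_field a X (u n) w / L (u n) <= x]) @[n --> \oo] -->
    expR (- (C * (q / x `^ alpha))).
Proof.
move=> un x0 hq.
have hE : expR (- (C * (rho (u n) / x `^ alpha))) @[n --> \oo] --> expR (- (C * (q / x `^ alpha))).
  apply: continuous_cvg; first exact: continuous_expR.
  by apply: cvgN; apply: cvgM; [exact: cvg_cst|apply: cvgM => //; exact: cvg_cst].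
rewrite -[X in _ --> X]add0r.
rewrite (_ : (fun n => _) = (fun n =>
  (fine (P1 [set w | max_field a X (u n) w / L (u n) <= x]) - expR (- (C * (rho (u n) / x `^ alpha)))) +
  expR (- (C * (rho (u n) / x `^ alpha))))); last by apply/funext => n; rewrite subrK.
apply: cvgD => //; apply/cvgrPdist_le => e e0.
have [N0 HN0] := max_field_law x0 e0.
near=> n; rewrite sub0r normrN; apply: HN0.
apply: leq_trans (un n); near: n; exact: nbhs_infty_ge.
Unshelve. all: by end_near. Qed.

Lemma measurable_max_field n : measurable_fun setT (max_field a X n).
Proof.
rewrite /max_field; apply: measurable_bigmax => t.
by apply: measurableT_comp => //; exact: measurable_funPT.
Qed.

Lemma measurable_max_field_le n x : measurable [set w | max_field a X n w / L n <= x].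
Proof.
rewrite (_ : mkset _ = setT `&` max_field a X n @^-1` `]-oo, x * L n]).
  exact: measurable_max_field.
by apply/seteqP; split=> w /=; rewrite in_itv/= ler_pdivrMr ?ball_scale_gt0// => -[].
Qed.

Lemma max_field_cvg0 (u : nat -> nat) (q x : R) : (forall n, (n <= u n)%N) -> x <= 0 -> 0 < q ->
  rho (u n) @[n --> \oo] --> q ->
  fine (P1 [set w | max_field a X (u n) w / L (u n) <= x]) @[n --> \oo] --> 0.
Proof.
move=> un x0 q0 hq; apply/cvgrPdist_lt => e e0.
have [y y0 hy] : exists2 y, 0 < y & expR (- (C * (q / y `^ alpha))) < e.
  (* This [y] solves [C * (q / y ^ alpha) = e^-1], and [expR (- e^-1) < e]. Monotonicity in the
     level then covers all [x <= 0]. *)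
  exists ((e * (C * q)) `^ alpha^-1); first by rewrite powR_gt0// !mulr_gt0.
  have eCq : 0 < e * (C * q) by rewrite !mulr_gt0.
  rewrite -powRrM mulVf ?gt_eqF// powRr1; last exact: ltW.
  have -> : C * (q / (e * (C * q))) = e^-1.
    by field; rewrite !gt_eqF.
  rewrite expRN -[ltRHS]invrK ltf_pV2 ?posrE ?expR_gt0 ?invr_gt0//.
  by apply: lt_le_trans (expR_ge1Dx _); rewrite ltrDr.
have hlt : \forall n \near \oo, fine (P1 [set w | max_field a X (u n) w / L (u n) <= y]) < e.
  exact: (cvgr_lt _ (max_field_cvg un y0 hq) _ hy).
near=> n; rewrite sub0r normrN ger0_norm ?fine_probability_ge0//.
apply: (@le_lt_trans _ _ (fine (P1 [set w | max_field a X (u n) w / L (u n) <= y]))).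
  apply: fine_probability_le; [exact: measurable_max_field_le|exact: measurable_max_field_le|].
  by move=> w /= /le_trans; apply; exact: le_trans x0 (ltW y0).
by near: n.
Unshelve. all: by end_near. Qed.

End MaxFieldLimit.

(** [frechet] prescribes the distribution function at positive arguments only; its limit 0 at 0 from
    the right determines the rest by monotonicity. *)
Lemma frechet_le0 {R : realType} {alpha : R} {d} {T : measurableType d}
    {P : probability T R} (Z : {RV P >-> R}) (x : R) : 0 < alpha ->
  frechet alpha Z -> x <= 0 -> P [set w | Z w <= x] = 0%E.
Proof.
move=> a0 hZ x0.
have mZ y : measurable [set w | Z w <= y].
  rewrite (_ : mkset _ = setT `&` Z @^-1` `]-oo, y]); first exact: measurable_funPT.
  by apply/seteqP; split=> w /=; rewrite in_itv/= // => -[].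
rewrite -(EFin_fine_probability P (mZ x)); congr (_%:E).
apply/le_anti; rewrite fine_probability_ge0 andbT.
apply/ler_addgt0Pr => e e0; rewrite add0r.
have y0 : 0 < e `^ alpha^-1 by rewrite powR_gt0.
apply: (@le_trans _ _ (fine (P [set w | Z w <= e `^ alpha^-1]))).
  apply: fine_probability_le => // w /= /le_trans; apply; exact: le_trans x0 (ltW y0).
rewrite hZ//= -powRrM mulrN mulVf ?gt_eqF// powRN powRr1; last exact: ltW.
rewrite expRN -[leRHS]invrK lef_pV2 ?posrE ?expR_gt0 ?invr_gt0//.
by apply: le_trans (expR_ge1Dx _); rewrite lerDr.
Qed.

Lemma powRN_div_root {R : realType} (alpha k x : R) : 0 < alpha -> 0 < k -> 0 < x ->
  (x / k `^ alpha^-1) `^ (- alpha) = k / x `^ alpha.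
Proof.
move=> a0 k0 x0; have r0 : 0 < k `^ alpha^-1 by rewrite powR_gt0.
have [y yE] : {y | y = x / k `^ alpha^-1} by exists (x / k `^ alpha^-1).
have y0 : 0 < y by rewrite yE divr_gt0.
have ya0 : 0 < y `^ alpha by rewrite powR_gt0.
have -> : x = y * k `^ alpha^-1 by rewrite yE divfK ?gt_eqF.
rewrite mulfK ?gt_eqF// powRN [in RHS]powRM ?(ltW y0) ?(ltW r0)// -powRrM mulVf ?gt_eqF//.
by rewrite powRr1 ?(ltW k0)// invfM mulrC divfK ?gt_eqF.
Qed.

Lemma strictly_increasing_ge (u : nat -> nat) : {homo u : i j / (i < j)%N} ->
  forall n, (n <= u n)%N.
Proof. by move=> hu; elim=> [//|n IH]; apply: leq_ltn_trans IH _; exact: hu. Qed.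

Theorem theorem3p2 (R : realType) (alpha : R) (halpha : 0 < alpha < 2)
    (r : nat) (hr : (2 <= r)%N) (G : groupType) (a : 'I_r -> G)
    (hG : free_generators a)
    (d : measure_display) (S : measurableType d) (hS : standard_borel R S)
    (m : {sigma_finite_measure set S -> \bar R})
    (phi : G -> S -> S) (hphi : group_action phi) (hns : nonsingular m phi)
    (A : set S) (hA : nondegenerate_part m a phi alpha A)
    (f : S -> R) (hf : Lalpha m alpha f)
    (hfA : (0 < m ([set s | f s != 0%R] `&` A))%E) :
  (0 < limn_einf (b_ratio m a phi alpha f))%E /\
  (forall (c : G -> S -> R) (hc : sign_cocycle m phi c)
     (d0 : measure_display) (T0 : measurableType d0) (P0 : probability T0 R)
     (M : set S -> {RV P0 >-> R}) (hM : SaS_random_measure m alpha M)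
     (Y : G -> {RV P0 >-> R})
     (hY : forall t, stochastic_integral m alpha M
                       (field_kernel m phi alpha c f t) (Y t))
     (d1 : measure_display) (T1 : measurableType d1) (P1 : probability T1 R)
     (X : G -> {RV P1 >-> R}) (hX : eq_fdd X Y) (hstat : left_stationary X)
     (d2 : measure_display) (T2 : measurableType d2) (P2 : probability T2 R)
     (Z : {RV P2 >-> R}) (hZ : frechet alpha Z)
     (nk : nat -> nat) (hnk : {homo nk : i j / (i < j)%N}),
   exists (kl : nat -> nat) (c0 : R),
     [/\ {homo kl : i j / (i < j)%N}, 0 < c0
       & cvg_distribution P1 P2
           (fun l w => max_field a X (nk (kl l)) w / ball_scale a alpha (nk (kl l)))
           (fun w => c0 * Z w)]).
Proof.
have [B [[mA _] _ _ _ hA']] := hA.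
have hlim : (0 < limn_esup (b_ratio m a phi alpha f))%E by exact: hA'.
split; first exact: limn_einf_b_ratio_gt0.
move=> c hc d0 T0 P0 M hM Y hY d1 T1 P1 X hX _ d2 T2 P2 Z hZ nk hnk.
have alpha_gt0 : 0 < alpha by case/andP: halpha.
have [mf _] := hf.
have mfA : measurable ([set s | f s != 0] `&` A).
  apply: measurableI => //.
  rewrite (_ : [set s | f s != 0] = setT `&` f @^-1` (~` [set 0])).
    by apply: mf => //; exact: measurableC.
  by apply/seteqP; split=> s /=; [move/eqP|case=> _ /eqP].
have [A0 [mA0 A0_gt0 A0_fin]] := finite_positive_set mfA hfA.
have s0_gt0 : 0 < fine (m A0) by apply: fine_gt0; rewrite A0_gt0.
have [C C0 tailC] := tail_asymptotics halpha
  (stable_law_random_measure halpha hM mA0 A0_fin) s0_gt0.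
have [b b0 hb] := ball_average_bounded_below halpha hr hG hphi hns hf hlim.
pose rho := ball_average alpha a m phi f.
have rho_bnd : bounded_fun (fun k => rho (nk k)).
  exists (Lalpha_norm alpha m f); split; first exact: num_real.
  move=> x xK k _ /=; rewrite ger0_norm; last by apply: ball_average_ge0.
  by apply: ltW; apply: le_lt_trans xK; exact: ball_average_le.
have [kl klmono /cvg_ex[q hq]] := bolzano_weierstrass rho_bnd.
have hkl : {homo kl : i j / (i < j)%N}.
  by move=> i j ij; rewrite (leqW_mono klmono).
have bq : b <= q.
  by apply: (cvgr_to_ge hq); near=> n; exact: hb.
have q0 : 0 < q by exact: lt_le_trans bq.
pose u n := nk (kl n).
have hu n : (n <= u n)%N.
  by apply: strictly_increasing_ge => i j ij; apply: hnk; exact: hkl.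
have Cq0 : 0 < C * q by exact: mulr_gt0.
(* Scaling a Fréchet variable by [c0] multiplies [x ^ (- alpha)] in the exponent by [c0 ^ alpha],
   which has to be [C * q]. *)
exists kl, ((C * q) `^ alpha^-1).
have c0_gt0 : 0 < (C * q) `^ alpha^-1 by rewrite powR_gt0.
split=> // x _.
have mX n := measurable_max_field_le (X := X) (P1 := P1) (alpha := alpha) hr hG n x.
have -> : (fun n => P1 [set w | max_field a X (nk (kl n)) w / ball_scale a alpha (nk (kl n)) <= x]) =
    (fun n => (fine (P1 [set w | max_field a X (u n) w / ball_scale a alpha (u n) <= x]))%:E).
  by apply/funext => n; rewrite EFin_fine_probability.
have -> : [set w | (C * q) `^ alpha^-1 * Z w <= x] = [set w | Z w <= x / (C * q) `^ alpha^-1].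
  by apply/seteqP; split=> w /=; rewrite ler_pdivlMr// mulrC.
have [x0|x0] := leP x 0.
  rewrite (frechet_le0 alpha_gt0 hZ); last by rewrite pmulr_lle0 ?invr_gt0.
  apply: cvg_EFin; first by near=> n.
  exact: (max_field_cvg0 halpha hr hG hphi hns hf hc hM hY hX C0 tailC hu x0 q0).
rewrite hZ; last by rewrite divr_gt0.
apply: cvg_EFin; first by near=> n.
have -> : expR (- (x / (C * q) `^ alpha^-1) `^ (- alpha)) = expR (- (C * (q / x `^ alpha))).
  by rewrite powRN_div_root// mulrA.
exact: (max_field_cvg halpha hr hG hphi hns hf hc hM hY hX C0 tailC hu x0).
Unshelve. all: by end_near. Qed.
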